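(* Let $V$ be a grading-restricted vertex superalgebra, $g$ an automorphism of $V$ and $W$ a lower-bounded generalized $g$-twisted $V$-module with twisted vertex operator map $Y_W^g$. For $u, v\in V$, $$x_0^{-1}\delta\left(\frac{x_1 - x_2}{x_0}\right)Y_{W}^{g}(u, x_1)Y_{W}^{g}(v, x_2)- (-1)^{|u||v|} x_0^{-1}\delta\left(\frac{- x_2 + x_1}{x_0}\right)Y_{W}^{g}(v, x_2)Y_{W}^{g}(u, x_1)$$ $$= x_1^{-1}\delta\left(\frac{x_2+x_0}{x_1}\right)Y_{W}^{g}\left(Y_{V}\left(\left(\frac{x_2+x_0}{x_1}\right)^{\mathcal{L}_{g}}u, x_0\right)v, x_2\right).$$
   Context: Conventions: $x,x_0,x_1,x_2$ are formal variables; logarithms of formal variables are also formal variables; $\delta(x)=\sum_{n\in\mathbb Z}x^n$. Expressions $(x_1+x_2)^n$, $(x_1-x_2)^n$ ($n\in\mathbb C$), $\log(x_1\pm x_2)=\log x_1+\log(1\pm x_2/x_1)$, $(-x_2+x_1)^n$ ($n\in\mathbb Z$), $(x_2+x_0)^n$ etc. are expanded as power series in the second variable. For $z\in\mathbb C^\times$ and $p\in\mathbb Z$, $l_p(z)=\log|z|+i\arg z+2p\pi i$ with $0\le\arg z<2\pi$. $W\{x\}$ denotes formal series $\sum_{n\in\mathbb C}w_nx^n$, $w_n\in W$. Elements of $V$, $W$ are taken of pure parity, so $|\cdot|$ is defined. A grading-restricted vertex superalgebra is a $\frac{\mathbb Z}{2}$-graded complex vector space $V=\coprod_{n\in\frac{\mathbb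 Z}{2}}V_{(n)}$ with a linear map $Y_V:V\otimes V\to V[[x,x^{-1}]]$ and a vacuum $\mathbf 1\in V_{(0)}$ such that: (i) $\dim V_{(n)}<\infty$ and $V_{(n)}=0$ for $n$ sufficiently negative; with $L_V(0)v=nv$ for $v\in V_{(n)}$, $[L_V(0),Y_V(v,x)]=x\frac{d}{dx}Y_V(v,x)+Y_V(L_V(0)v,x)$; (ii) $Y_V(\mathbf 1,x)=1_V$ and $\lim_{x\to0}Y_V(u,x)\mathbf 1=u$; (iii) with $L_V(-1)v=\lim_{x\to0}\frac{d}{dx}Y_V(v,x)\mathbf 1$, $\frac{d}{dx}Y_V(v,x)=Y_V(L_V(-1)v,x)=[L_V(-1),Y_V(v,x)]$; (iv) duality: with $|u|=0$ for $u\in\coprod_{n\in\mathbb Z}V_{(n)}$ and $|u|=1$ for $u\in\coprod_{n\in\mathbb Z+\frac12}V_{(n)}$, for $v\in V$, $v'\in V'$ (graded dual) the series $\langle v',Y_V(u_1,z_1)Y_V(u_2,z_2)v\rangle$, $(-1)^{|u_1||u_2|}\langle v',Y_V(u_2,z_2)Y_V(u_1,z_1)v\rangle$, $\langle v',Y_V(Y_V(u_1,z_1-z_2)u_2,z_2)v\rangle$ converge absolutely in $|z_1|>|z_2|>0$, $|z_2|>|z_1|>0$, $|z_2|>|z_1-z_2|>0$, respectively, to a common rational function with only possible poles at $z_1=0,z_2=0,z_1=z_2$. An automorphism $g$ of $V$ is a weight-preserving invertible linear map with $gY_V(u,x)v=Y_V(gu,x)gv$. A generalized $g$-twisted $V$-module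 is a $\mathbb C\times\mathbb Z_2\times\mathbb C/\mathbb Z$-graded space $W=\coprod_{n\in\mathbb C,s\in\mathbb Z_2,\alpha\in P_W}W_{[n]}^{s;[\alpha]}$ (weight, fermion number, $g$-weight; $P_W\subset\{\alpha:0\le\Re(\alpha)<1\}$), $|w|=s$ for $w$ of fermion number $s$, with operators $L_W(0),L_W(-1)$, an action of $g$, and a linear map $Y_W^g:V\otimes W\to W\{x\}[\log x]$ such that, writing $(Y_W^g)^p(v,z)$ for the result of substituting $x^n=e^{nl_p(z)}$, $\log x=l_p(z)$: (1) $(Y_W^g)^{p+1}(gv,z)w=(Y_W^g)^p(v,z)w$; (2) $Y_W^g(\mathbf 1,x)w=w$; (3) duality: for $u,v\in V$, $w\in W$, $w'\in W'$ (graded dual) there is $f(z_1,z_2)=\sum_{i,j,k,l=0}^Na_{ijkl}z_1^{m_i}z_2^{n_j}(\log z_1)^k(\log z_2)^l(z_1-z_2)^{-t}$ ($m_i,n_j\in\mathbb C$, $t\in\mathbb Z_+$) such that for all $p\in\mathbb Z$ the series $\langle w',(Y_W^g)^p(u,z_1)(Y_W^g)^p(v,z_2)w\rangle$, $(-1)^{|u||v|}\langle w',(Y_W^g)^p(v,z_2)(Y_W^g)^p(u,z_1)w\rangle$, $\langle w',(Y_W^g)^p(Y_V(u,z_1-z_2)v,z_2)w\rangle$ converge absolutely in $|z_1|>|z_2|>0$, $|z_2|>|z_1|>0$, $|z_2|>|z_1-z_2|>0$, and their sums equal the branch $f^{p,p}$ (obtained with $z_i^{m}=e^{ml_p(z_i)}$,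 $\log z_i=l_p(z_i)$) in $|z_1|>|z_2|>0$, in $|z_2|>|z_1|>0$, and in $|z_2|>|z_1-z_2|>0$, $|\arg z_1-\arg z_2|<\frac\pi2$, respectively; (4) $L_W(0)-n$ is nilpotent on each element of $W_{[n]}$; $[L_W(0),Y_W^g(v,x)]=x\frac d{dx}Y_W^g(v,x)+Y_W^g(L_V(0)v,x)$; $g-e^{2\pi i\alpha}$ is nilpotent on each element of $W^{[\alpha]}$; $gY_W^g(u,x)w=Y_W^g(gu,x)gw$; $|Y_W^g(u,x)w|=|u|+|w|$; (5) $\frac d{dx}Y_W^g(v,x)=[L_W(-1),Y_W^g(v,x)]$ (then also $=Y_W^g(L_V(-1)v,x)$). Here $W_{[n]}=\coprod_{s,\alpha}W_{[n]}^{s;[\alpha]}$ and $W^{[\alpha]}=\coprod_{n,s}W_{[n]}^{s;[\alpha]}$. It is lower-bounded if for some $B\in\mathbb R$, $W_{[n]}=0$ whenever $\Re(n)<B$. $V^{[\alpha]}$ is the generalized eigenspace of $g$ on $V$ with eigenvalue $e^{2\pi i\alpha}$, $0\le\Re(\alpha)<1$. On $V$, $\mathcal S_g$ acts on $V^{[\alpha]}$ as multiplication by $\alpha$, $\mathcal N_g=\frac1{2\pi i}\log(e^{-2\pi i\mathcal S_g}g)$ is nilpotent on each $V_{(n)}$, and $\mathcal L_g=\mathcal S_g+\mathcal N_g$, so $g=e^{2\pi i\mathcal L_g}$. For $u\in V^{[\alpha]}$, $\left(\frac{x_2+x_0}{x_1}\right)^{\mathcal L_g}u=(x_2+x_0)^{\alpha}x_1^{-\alpha}e^{(\log(x_2+x_0)-\log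 x_1)\mathcal N_g}u$, extended linearly in $u$. *)

(* Defs.v *)
From HB Require Import structures.
From mathcomp Require Import all_boot all_order all_algebra.
From mathcomp Require Import complex finmap.
From mathcomp Require Import all_classical all_reals all_analysis.
From mathcomp Require summability.

Set Implicit Arguments.
Unset Strict Implicit.
Unset Printing Implicit Defensive.
Import Order.TTheory GRing.Theory Num.Theory numFieldNormedType.Exports.
Local Open Scope classical_set_scope.
Local Open Scope ring_scope.

Definition cexp (R : realType) (z : R[i]) : R[i] :=
  Complex (expR (complex.Re z) * cos (complex.Im z))
          (expR (complex.Re z) * sin (complex.Im z)).

Definition twopii (R : realType) : R[i] := Complex 0 (2 * pi).

(* The argument with [0 <= arg z < 2 pi]. *)
Definition carg (R : realType) (z : R[i]) : R :=
  xget 0 [set t : R | 0 <= t < 2 * pi /\ z = `|z| * Complex (cos t) (sin t)].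

(* [l_p(z) = log |z| + i arg z + 2 p pi i]; only used for [z != 0]. *)
Definition lbr (R : realType) (p : int) (z : R[i]) : R[i] :=
  Complex (ln (complex.Re `|z|)) (carg z + 2 * p%:~R * pi).

(* The value at [z] of the monomial [x ^ e.1 (log x) ^ e.2] on the branch p. *)
Definition mon_at (R : realType) (p : int) (z : R[i]) (e : R[i] * nat) : R[i] :=
  cexp (e.1 * lbr p z) * lbr p z ^+ e.2.

(* Absolute summability, and convergence to s of the net of finite partial sums. *)
Definition has_abs_sum (R : realType) (I : choiceType) (f : I -> R[i])
    (s : R[i]) : Prop :=
  summable [set: I] (fun i => (complex.Re `|f i|)%:E) /\
  (summability.partial_sum f : {fset I} -> R[i]^o) @ summability.totally
    --> (s : R[i]^o).

Definition decomposes (K : nzRingType) (V : lmodType K) (I : choiceType)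
    (gr : I -> set V) (v : V) (f : I -> V) : Prop :=
  [/\ finite_set [set i | f i != 0], forall i, gr i (f i)
    & v = \sum_(i \in [set: I]) f i].

Definition is_direct_sum (K : nzRingType) (V : lmodType K) (I : choiceType)
    (gr : I -> set V) : Prop :=
  (forall i, gr i 0 /\ forall a, {in gr i &, forall u v, gr i (a *: u + v)}) /\
  (forall v, exists! f : I -> V, decomposes gr v f).

Definition subsum (K : nzRingType) (V : lmodType K) (I : choiceType)
    (gr : I -> set V) (D : set I) : set V :=
  [set v | exists2 f : I -> V, decomposes gr v f & forall i, ~ D i -> f i = 0].

(* The graded dual: the functionals vanishing on all but finitely many of the
   homogeneous subspaces. *)
Definition graded_dual (K : nzRingType) (V : lmodType K) (I : choiceType)
    (gr : I -> set V) (v' : {scalar V}) : Prop :=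
  finite_set [set i | exists2 v, gr i v & v' v != 0].

Definition gen_eigenspace (K : nzRingType) (V : lmodType K) (f : V -> V)
    (a : K) : set V :=
  [set v | exists N, iter N (fun x => f x - a *: x) v = 0].

(* [vsa_wt k] is [V_(k/2)], and [vsa_Y u v n] is the coefficient of [x ^ n]
   (not of [x ^ (-n-1)]) in [Y_V(u, x) v]. *)

Definition half_parity (k : int) : bool := odd `|k|%N.

Record vertex_superalgebra (R : realType) (V : lmodType R[i]) := VertexSuperalgebra {
  vsa_wt : int -> set V;
  vsa_Y : V -> V -> int -> V;
  vsa_vac : V;
  vsa_L0 : {linear V -> V};
  vsa_grading : is_direct_sum vsa_wt;
  vsa_Y_linl : forall v n, linear (fun u => vsa_Y u v n);
  vsa_Y_linr : forall u n, linear (fun v => vsa_Y u v n);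
  vsa_vac_wt : vsa_wt 0 vsa_vac;
  vsa_findim : forall k, exists b : seq V, forall v, vsa_wt k v ->
    exists c : 'I_(size b) -> R[i], v = \sum_(i < size b) c i *: b`_i;
  vsa_truncated : exists k0 : int, forall (k : int) v, k < k0 -> vsa_wt k v -> v = 0;
  vsa_L0E : forall k v, vsa_wt k v -> vsa_L0 v = (k%:~R / 2%:R) *: v;
  vsa_L0_comm : forall v w n,
    vsa_L0 (vsa_Y v w n) - vsa_Y v (vsa_L0 w) n =
    n%:~R *: vsa_Y v w n + vsa_Y (vsa_L0 v) w n;
  vsa_identity : forall w n, vsa_Y vsa_vac w n = if n == 0 then w else 0;
  vsa_creation : forall u, vsa_Y u vsa_vac 0 = u /\
    forall n : int, n < 0 -> vsa_Y u vsa_vac n = 0;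
  vsa_Lm1 := fun v => vsa_Y v vsa_vac 1; (* the limit at 0 of the derivative *)
  vsa_Lm1_deriv : forall v w (n : int),
    (n + 1)%:~R *: vsa_Y v w (n + 1) = vsa_Y (vsa_Lm1 v) w n;
  vsa_Lm1_comm : forall v w (n : int),
    (n + 1)%:~R *: vsa_Y v w (n + 1) =
    vsa_Lm1 (vsa_Y v w n) - vsa_Y v (vsa_Lm1 w) n;
  vsa_parity := fun s : bool => subsum vsa_wt [set k | half_parity k = s];
  vsa_duality : forall (s1 s2 : bool) (u1 u2 v : V) (v' : {scalar V}),
    vsa_parity s1 u1 -> vsa_parity s2 u2 -> graded_dual vsa_wt v' ->
    exists (P : {poly {poly R[i]}}) (a b c : nat), forall z1 z2 : R[i],
      let f := P.[z2%:P].[z1] / (z1 ^+ a * z2 ^+ b * (z1 - z2) ^+ c) in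
      [/\ 0 < `|z2| < `|z1| ->
          has_abs_sum (fun e : int * int =>
            v' (vsa_Y u1 (vsa_Y u2 v e.2) e.1) * z1 ^ e.1 * z2 ^ e.2) f,
          0 < `|z1| < `|z2| ->
          has_abs_sum (fun e : int * int => (-1) ^+ (s1 && s2) *
            (v' (vsa_Y u2 (vsa_Y u1 v e.1) e.2) * z1 ^ e.1 * z2 ^ e.2)) f
        & 0 < `|z1 - z2| < `|z2| ->
          has_abs_sum (fun e : int * int =>
            v' (vsa_Y (vsa_Y u1 u2 e.1) v e.2) * (z1 - z2) ^ e.1 * z2 ^ e.2) f]
}.

Definition is_automorphism (R : realType) (V : lmodType R[i])
    (A : vertex_superalgebra V) (g : {linear V -> V}) : Prop :=
  [/\ bijective g, forall k v, vsa_wt A k v -> vsa_wt A k (g v)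
    & forall u v n, g (vsa_Y A u v n) = vsa_Y A (g u) (g v) n].

(* Series in one variable [x] and its logarithm: [s (n, k)] is the coefficient
   of [x ^ n (log x) ^ k]. *)

Definition xderiv (R : realType) (W : lmodType R[i]) (s : R[i] * nat -> W) :
    R[i] * nat -> W :=
  fun e => e.1 *: s e + e.2.+1%:R *: s (e.1, e.2.+1).

Definition deriv_log (R : realType) (W : lmodType R[i]) (s : R[i] * nat -> W) :
    R[i] * nat -> W :=
  fun e => xderiv s (e.1 + 1, e.2).

(* [tw_gr (n, s, alpha)] is the subspace of weight n, fermion number s and
   g-weight alpha. *)
Record twisted_module (R : realType) (V : lmodType R[i])
    (A : vertex_superalgebra V) (g : {linear V -> V}) (W : lmodType R[i]) :=
    TwistedModule {
  tw_P : set R[i];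
  tw_gr : R[i] * bool * R[i] -> set W;
  tw_L0 : {linear W -> W};
  tw_Lm1 : {linear W -> W};
  tw_g : {linear W -> W};
  tw_Y : V -> W -> R[i] * nat -> W;
  tw_P_strip : forall al, tw_P al -> 0 <= complex.Re al < 1;
  tw_grading : is_direct_sum tw_gr;
  tw_gr_P : forall n s al w, tw_gr (n, s, al) w -> ~ tw_P al -> w = 0;
  tw_Y_linl : forall w e, linear (fun v => tw_Y v w e);
  tw_Y_linr : forall v e, linear (fun w => tw_Y v w e);
  tw_Y_log : forall v w, exists K : nat, forall n k, (K < k)%N ->
    tw_Y v w (n, k) = 0;
  tw_weight := fun n => subsum tw_gr [set i | i.1.1 = n];
  tw_fermion := fun s => subsum tw_gr [set i | i.1.2 = s];
  tw_gweight := fun al => subsum tw_gr [set i | i.2 = al];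
  (* An identity in the completion of W, tested against the graded dual. The
     grading makes these sums finite. *)
  tw_equivariance : forall (p : int) v w z (w' : {scalar W}),
    z != 0 -> graded_dual tw_gr w' ->
    \sum_(e \in [set: R[i] * nat]) w' (tw_Y (g v) w e) * mon_at (p + 1) z e =
    \sum_(e \in [set: R[i] * nat]) w' (tw_Y v w e) * mon_at p z e;
  tw_identity : forall w e,
    tw_Y (vsa_vac A) w e = if e == (0, 0%N) then w else 0;
  tw_duality : forall (s1 s2 : bool) (u v : V) (w : W) (w' : {scalar W}),
    vsa_parity A s1 u -> vsa_parity A s2 v -> graded_dual tw_gr w' ->
    exists (N : nat)
      (a : 'I_N.+1 -> 'I_N.+1 -> 'I_N.+1 -> 'I_N.+1 -> R[i])
      (m n : 'I_N.+1 -> R[i]) (t : nat), (0 < t)%N /\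
    forall (p : int) (z1 z2 : R[i]),
      let f := \sum_i \sum_j \sum_k \sum_l
        a i j k l * mon_at p z1 (m i, k : nat) * mon_at p z2 (n j, l : nat)
        * (z1 - z2) ^- t in
      let iterate (e : int * (R[i] * nat)) :=
        w' (tw_Y (vsa_Y A u v e.1) w e.2) * (z1 - z2) ^ e.1 * mon_at p z2 e.2 in
      [/\ 0 < `|z2| < `|z1| ->
          has_abs_sum (fun e : (R[i] * nat) * (R[i] * nat) =>
            w' (tw_Y u (tw_Y v w e.2) e.1) * mon_at p z1 e.1 * mon_at p z2 e.2) f,
          0 < `|z1| < `|z2| ->
          has_abs_sum (fun e : (R[i] * nat) * (R[i] * nat) => (-1) ^+ (s1 && s2) *
            (w' (tw_Y v (tw_Y u w e.1) e.2) * mon_at p z1 e.1 * mon_at p z2 e.2)) f,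
          0 < `|z1 - z2| < `|z2| -> exists s, has_abs_sum iterate s
        & 0 < `|z1 - z2| < `|z2| -> `|carg z1 - carg z2| < pi / 2 ->
          has_abs_sum iterate f];
  tw_L0_nilp : forall n, tw_weight n `<=` gen_eigenspace tw_L0 n;
  tw_L0_comm : forall v w e,
    tw_L0 (tw_Y v w e) - tw_Y v (tw_L0 w) e =
    xderiv (tw_Y v w) e + tw_Y (vsa_L0 A v) w e;
  tw_g_nilp : forall al, tw_P al ->
    tw_gweight al `<=` gen_eigenspace tw_g (cexp (twopii R * al));
  tw_g_Y : forall u w e, tw_g (tw_Y u w e) = tw_Y (g u) (tw_g w) e;
  tw_Y_parity : forall (s1 s2 : bool) u w e,
    vsa_parity A s1 u -> tw_fermion s2 w -> tw_fermion (s1 (+) s2) (tw_Y u w e);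
  tw_Lm1_comm : forall v w e,
    deriv_log (tw_Y v w) e = tw_Lm1 (tw_Y v w e) - tw_Y v (tw_Lm1 w) e
}.

Definition lower_bounded (R : realType) (V : lmodType R[i])
    (A : vertex_superalgebra V) (g : {linear V -> V}) (W : lmodType R[i])
    (M : twisted_module A g W) : Prop :=
  exists B : R, forall n w, complex.Re n < B -> tw_weight M n w -> w = 0.

(* [V^[alpha]] for [0 <= Re alpha < 1], and 0 for the other values of alpha. *)
Definition eig_gr (R : realType) (V : lmodType R[i]) (g : V -> V)
    (al : R[i]) : set V :=
  [set v | if 0 <= complex.Re al < 1
           then gen_eigenspace g (cexp (twopii R * al)) v else v = 0].

(* The component of u in [V^[alpha]]; V is the direct sum of the [V^[alpha]]
   when g is an automorphism. *)
Definition eig_comp (R : realType) (V : lmodType R[i]) (g : V -> V)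
    (u : V) : R[i] -> V :=
  xget (fun=> 0) [set f | decomposes (eig_gr g) u f].

(* [e ^ (c S_g)], where S_g is multiplication by alpha on [V^[alpha]]. *)
Definition exp_Sg (R : realType) (V : lmodType R[i]) (g : V -> V) (c : R[i])
    (u : V) : V :=
  \sum_(al \in [set: R[i]]) cexp (c * al) *: eig_comp g u al.

(* [N_g = (2 pi i)^-1 log (e ^ (- 2 pi i S_g) g)], by the logarithmic series. *)
Definition Ng (R : realType) (V : lmodType R[i]) (g : V -> V) (u : V) : V :=
  (twopii R)^-1 *: \sum_(k \in [set: nat]) ((-1) ^+ k / k.+1%:R) *:
    iter k.+1 (fun x => exp_Sg g (- twopii R) (g x) - x) u.

Definition x0 : 'I_3 := @Ordinal 3 0 isT.
Definition x1 : 'I_3 := @Ordinal 3 1 isT.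
Definition x2 : 'I_3 := @Ordinal 3 2 isT.

(* The monomial m is the product of the [x_i ^ (m i).1 (log x_i) ^ (m i).2];
   monomials are multiplied by adding exponents. A formal series with
   coefficients in T is a function [mono R -> T]. *)
Notation mono R := {ffun 'I_3 -> (R[i] * nat)%type}.

Definition mono_at (R : realType) (i : 'I_3) (e : R[i] * nat) : mono R :=
  [ffun j => if j == i then e else 0].

Definition xpow (R : realType) (i : 'I_3) (n : R[i]) : mono R :=
  mono_at i (n, 0%N).

Definition xlog (R : realType) (i : 'I_3) : mono R := mono_at i (0, 1%N).

Definition fmono (R : realType) (m0 : mono R) : mono R -> R[i] :=
  fun m => (m == m0)%:R.

(* The series with terms [c i] times the monomial [mo i]; each monomial may
   occur only finitely often. *)
Definition fseries (R : realType) (T : nmodType) (I : choiceType)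
    (c : I -> T) (mo : I -> mono R) : mono R -> T :=
  fun m => \sum_(i \in [set i | mo i = m]) c i.

(* For a series S with terms [s m] and F mapping coefficients to series,
   [fapply F S] is the sum of the series [F s m]; [fapply_ok F S] says
   that only finitely many products contribute to each coefficient, that is, that
   the formal expression is well defined. *)
Definition fapply (R : realType) (T U : nmodType) (F : T -> mono R -> U)
    (S : mono R -> T) : mono R -> U :=
  fun m => \sum_(p \in [set p : mono R * mono R | p.1 + p.2 = m])
    F (S p.1) p.2.

Definition fapply_ok (R : realType) (T U : nmodType) (F : T -> mono R -> U)
    (S : mono R -> T) : Prop :=
  forall m, finite_set
    [set p : mono R * mono R | p.1 + p.2 = m /\ F (S p.1) p.2 != 0].

Definition fmul (R : realType) (T : lmodType R[i]) (S : mono R -> R[i])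
    (U : mono R -> T) : mono R -> T :=
  fapply (fun c m => c *: U m) S.

Definition fmul_ok (R : realType) (T : lmodType R[i]) (S : mono R -> R[i])
    (U : mono R -> T) : Prop :=
  fapply_ok (fun c m => c *: U m) S.

Definition fpow (R : realType) (S : mono R -> R[i]) (q : nat) : mono R -> R[i] :=
  iter q (@fmul R R[i]^o S) (fmono 0).

Definition cbin (R : realType) (a : R[i]) (k : nat) : R[i] :=
  (\prod_(j < k) (a - j%:R)) / k`!%:R.

(* [(x_i + x_j) ^ a], expanded in nonnegative powers of [x_j] *)
Definition fbinomial (R : realType) (i j : 'I_3) (a : R[i]) : mono R -> R[i] :=
  fseries (fun k : nat => cbin a k)
          (fun k : nat => xpow i (a - k%:R) + xpow j k%:R).

(* [log (x_i + x_j) = log x_i + log (1 + x_j / x_i)] *)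
Definition flog (R : realType) (i j : 'I_3) : mono R -> R[i] :=
  fmono (xlog R i) +
  fseries (fun k : nat => (-1) ^+ k / k.+1%:R)
          (fun k : nat => xpow i (- k.+1%:R) + xpow j k.+1%:R).

(* [x_l ^ -1 delta ((e1 x_i + e2 x_j) / x_l)], the binomials being expanded in
   nonnegative powers of [x_j] *)
Definition fdelta (R : realType) (l : 'I_3) (e1 : R[i]) (i : 'I_3) (e2 : R[i])
    (j : 'I_3) : mono R -> R[i] :=
  fseries (fun nk : int * nat =>
             cbin nk.1%:~R nk.2 * e1 ^ (nk.1 - nk.2%:Z) * e2 ^+ nk.2)
          (fun nk : int * nat =>
             xpow l (- nk.1 - 1)%:~R + xpow i (nk.1 - nk.2%:Z)%:~R
             + xpow j nk.2%:R).

(* [e ^ (S f) u]; the sum is finite when f is nilpotent on u. *)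
Definition fexp (R : realType) (T : lmodType R[i]) (S : mono R -> R[i])
    (f : T -> T) (u : T) : mono R -> T :=
  fun m => \sum_(q \in [set: nat]) (fpow S q m / q`!%:R) *: iter q f u.

(* [((x_2 + x_0) / x_1) ^ L_g u] *)
Definition pow_Lg (R : realType) (V : lmodType R[i]) (g : V -> V) (u : V) :
    mono R -> V :=
  fun m => \sum_(al \in [set: R[i]])
    fmul (@fmul R R[i]^o (fbinomial x2 x0 al) (fmono (xpow x1 (- al))))
         (fexp (flog x2 x0 - fmono (xlog R x1)) (Ng g) (eig_comp g u al)) m.

Definition YV (R : realType) (V : lmodType R[i]) (A : vertex_superalgebra V)
    (i : 'I_3) (u v : V) : mono R -> V :=
  fseries (fun n : int => vsa_Y A u v n) (fun n : int => xpow i n%:~R).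

Definition YW (R : realType) (V : lmodType R[i]) (A : vertex_superalgebra V)
    (g : {linear V -> V}) (W : lmodType R[i]) (M : twisted_module A g W)
    (i : 'I_3) (v : V) (w : W) : mono R -> W :=
  fseries (fun e : R[i] * nat => tw_Y M v w e) (fun e => mono_at i e).

(* Main.v *)
From HB Require Import structures.
Require Import Defs.
From mathcomp Require Import all_boot all_order all_algebra.
From mathcomp Require Import complex finmap.
From mathcomp Require Import ring lra zify.
From mathcomp Require Import all_classical all_reals all_analysis.
From mathcomp Require summability.

Set Implicit Arguments.
Unset Strict Implicit.
Unset Printing Implicit Defensive.
Import Order.TTheory GRing.Theory Num.Theory numFieldNormedType.Exports.
Local Open Scope classical_set_scope.
Local Open Scope ring_scope.

(** The coefficients of the identity are residues. Take [u], [v], [w] homogeneous and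
    a functional [w'] that vanishes outside one homogeneous subspace of [W]; such
    functionals separate points ([graded_separation]). By weights, each of the three
    products has only one free exponent, so nothing is lost by setting [z_2 = 1] on
    the branch [p], that is, [log z_2 = lambda = 2 pi i p]. The three series of the
    duality property then become expansions in [z = z_1] of one function: at infinity,
    at 0 and at 1. If this function were a Laurent polynomial divided by a power of
    [z - 1], the identity would say that the residues of its products with
    [z ^ (- m - 1) (z - 1) ^ n] sum to 0 ([residue_theorem]).

    It is not, because of the monodromy: it involves [log z] and powers of [z] that are
    not integral. Equivariance says that [g] moves between the branches, so [g] acts on
    the polynomial in [log x] that multiplies a power of [x] as a translation by
    [- 2 pi i], and its logarithm [N_g] acts as [- d / d (log x)] ([tw_Ng]). Hence, for
    [u] in [V^[alpha]], the series [Y (x ^ L_g u, x)] is free of logarithms and has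
    integral exponents ([tw_exponent], [tw_Y_logE]). Inserting [z ^ L_g] before [u]
    makes the function rational ([expansions_residue]). In the products the operator is
    absorbed by the powers and logarithms of [z]; in the iterate, at [z = 1 + x], it is
    [(1 + x) ^ L_g e ^ (lambda L_g)], and this is the source of
    [((x_2 + x_0) / x_1) ^ L_g].

    The coefficients of the series are recovered from their sums along real [z]:
    absolutely convergent sums have asymptotic expansions, and these are unique
    ([asym_unique], [asym0_unique]). This gives the same function at the three points
    ([duality_same_function]) and a residue identity for every [p]. Both sides of that
    identity are polynomials in [lambda], so their coefficients agree; they are the
    coefficients of the powers of [log x_2] ([jacobi_mc]).

    What remains is formal: the finitely many contributions to each coefficient of each
    formal product are listed ([pow_Lg_eigen], [delta012_at], [delta021_at],
    [delta120_at]), and the identity is extended additively from homogeneous vectors to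
    all vectors of pure parity ([jacobi_add], [parity_ind]). *)
(** * Residues of Laurent polynomials divided by a power of z - 1 *)

Section Residues.
Variable R : realType.
Local Notation C := R[i].
Implicit Types (c : nat -> C) (b P Q K : int -> C).

Definition vanish_below b (n0 : int) := forall n, n < n0 -> b n = 0.

(** The Cauchy product of a power series with a Laurent series. *)
Definition conv c b (M : int) : C := \sum_(k \in [set: nat]) c k * b (M - k%:Z).

Lemma convE c b n0 M (B : nat) : vanish_below b n0 -> M - n0 < B%:Z ->
  conv c b M = \sum_(k < B) c k * b (M - k%:Z).
Proof.
move=> hb hB; rewrite (@fsbig_ord _ _ _ B (fun k => c k * b (M - k%:Z))) /conv.
apply/esym/fsbig_widen => // k [_ /= /negP]; rewrite -leqNgt => hk.
by rewrite hb ?mulr0 //; lia.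
Qed.

Lemma vanish_belowW b n0 n1 : n1 <= n0 -> vanish_below b n0 -> vanish_below b n1.
Proof. by move=> h hb n hn; apply: hb; apply: lt_le_trans hn h. Qed.

Lemma vanish_belowS b n0 j : vanish_below b n0 ->
  vanish_below (fun n => b (n + j)) (n0 - j).
Proof. by move=> hb n hn; apply: hb; lia. Qed.

Lemma vanish_belowB b b' n0 : vanish_below b n0 -> vanish_below b' n0 ->
  vanish_below (fun n => b n - b' n) n0.
Proof. by move=> hb hb' n hn; rewrite hb ?hb' ?subr0. Qed.

Lemma vanish_belowD b b' n0 : vanish_below b n0 -> vanish_below b' n0 ->
  vanish_below (fun n => b n + b' n) n0.
Proof. by move=> hb hb' n hn; rewrite hb ?hb' ?addr0. Qed.

Lemma eq_conv c c' b b' M : c =1 c' -> b =1 b' -> conv c b M = conv c' b' M.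
Proof. by move=> h h'; apply: eq_fsbigr => k _; rewrite h h'. Qed.

Lemma convS c b M j : conv c (fun n => b (n + j)) M = conv c b (M + j).
Proof. by apply: eq_fsbigr => k _; congr (_ * b _); ring. Qed.

Lemma conv_ex_bound (M n0 : int) : exists B : nat, M - n0 < B%:Z.
Proof. by exists `|M - n0|.+1; lia. Qed.

Lemma convB c b b' n0 M : vanish_below b n0 -> vanish_below b' n0 ->
  conv c (fun n => b n - b' n) M = conv c b M - conv c b' M.
Proof.
move=> hb hb'; have [B hB] := conv_ex_bound M n0.
rewrite !(@convE _ _ n0 _ B) //; last exact: vanish_belowB.
by rewrite -sumrB; apply: eq_bigr => k _; rewrite mulrBr.
Qed.

Lemma convD c b b' n0 M : vanish_below b n0 -> vanish_below b' n0 ->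
  conv c (fun n => b n + b' n) M = conv c b M + conv c b' M.
Proof.
move=> hb hb'; have [B hB] := conv_ex_bound M n0.
rewrite !(@convE _ _ n0 _ B) //; last exact: vanish_belowD.
by rewrite -big_split; apply: eq_bigr => k _; rewrite mulrDr.
Qed.

Lemma conv_sum c (I : eqType) (s : seq I) (a : I -> C) (f : I -> int -> C) M :
  (forall i, i \in s -> exists n0, vanish_below (f i) n0) ->
  conv c (fun n => \sum_(i <- s) a i * f i n) M =
  \sum_(i <- s) a i * conv c (f i) M.
Proof.
move=> hf; have [n0 h0] : exists n0, forall i, i \in s -> vanish_below (f i) n0.
  elim: s hf => [|i s IH] hf; first by exists 0.
  have [n0 h0] := hf i (mem_head _ _).
  have [j js|n1 h1] := IH; first by apply: hf; rewrite inE js orbT.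
  exists (Num.min n0 n1) => j; rewrite inE => /predU1P[->|/h1 hj].
    by apply: vanish_belowW h0; rewrite ge_min lexx.
  by apply: vanish_belowW hj; rewrite ge_min lexx orbT.
have [B hB] := conv_ex_bound M n0.
rewrite (@convE _ _ n0 _ B) //; last first.
  move=> n hn; rewrite big_seq big1 // => i /h0 hi; by rewrite hi ?mulr0.
under eq_bigr => k _ do rewrite mulr_sumr.
rewrite exchange_big /= !big_seq; apply: eq_bigr => i /h0 hi.
rewrite (@convE _ _ n0 _ B) // mulr_sumr; apply: eq_bigr => k _; ring.
Qed.

(** The hypothesis says that the power series [c'] is [1 + e x] times [c]. With Pascal's
    rule this turns products with [z] and [z - 1] into shifts of [m] and [n]. *)
Lemma conv_pascal c c' e b n0 M :
  (forall k, c' k = c k + e * (if k is k'.+1 then c k' else 0)) ->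
  vanish_below b n0 -> conv c' b M = conv c b M + e * conv c b (M - 1).
Proof.
move=> hc hb; have [B hB] := conv_ex_bound M n0.
rewrite (@convE _ _ n0 _ B.+1) //; last by lia.
rewrite (@convE c _ n0 _ B.+1) //; last by lia.
rewrite (@convE _ _ n0 _ B) //; last by lia.
under eq_bigr => k _ do rewrite hc mulrDl.
rewrite big_split /=; congr (_ + _).
rewrite big_ord_recl /= mulr0 mul0r add0r mulr_sumr.
apply: eq_bigr => k _; rewrite -mulrA; congr (_ * (_ * b _)).
rewrite /bump /= add1n; lia.
Qed.

Lemma cbin0 (a : C) : cbin a 0 = 1.
Proof. by rewrite /cbin big_ord0 fact0 divr1. Qed.

Lemma cbin_rec (a : C) k : k.+1%:R * cbin a k.+1 = (a - k%:R) * cbin a k.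
Proof.
rewrite /cbin big_ord_recr /= factS natrM.
have h1 : (k.+1%:R : C) != 0 by rewrite pnatr_eq0.
have h2 : ((k`!)%:R : C) != 0 by rewrite pnatr_eq0 -lt0n fact_gt0.
by move: (k.+1%:R : C) ((k`!)%:R : C) h1 h2 => x y h1 h2; field; rewrite h1 h2.
Qed.

Lemma cbinS (a : C) k : k.+1%:R * cbin (a + 1) k.+1 = (a + 1) * cbin a k.
Proof.
rewrite /cbin big_ord_recl /= factS natrM.
have h1 : (k.+1%:R : C) != 0 by rewrite pnatr_eq0.
have h2 : ((k`!)%:R : C) != 0 by rewrite pnatr_eq0 -lt0n fact_gt0.
rewrite subr0 [X in _ * X / _](_ : _ = \prod_(j < k) (a - j%:R)); last first.
  by apply: eq_bigr => j _; rewrite /bump /= add1n -natr1; ring.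
by move: (k.+1%:R : C) ((k`!)%:R : C) h1 h2 => x y h1 h2; field; rewrite h1 h2.
Qed.

Lemma cbin_pascal (a : C) k : cbin (a + 1) k.+1 = cbin a k.+1 + cbin a k.
Proof.
have h1 : (k.+1%:R : C) != 0 by rewrite pnatr_eq0.
apply: (mulfI h1); rewrite cbinS mulrDr cbin_rec -natr1; ring.
Qed.

Lemma cbin0n k : cbin (0 : C) k = (k == 0%N)%:R.
Proof.
case: k => [|k]; first by rewrite cbin0.
by rewrite /cbin big_ord_recl /= subr0 !mul0r.
Qed.

Lemma cbinN1 k : cbin (-1 : C) k = (-1) ^+ k.
Proof.
elim: k => [|k IH]; first by rewrite cbin0 expr0.
have := cbin_pascal (-1) k; rewrite addNr cbin0n /= => /esym/eqP.
by rewrite addr_eq0 IH exprS mulN1r => /eqP.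
Qed.

(** The coefficients at infinity, at 0 and at 1 that occur in the residues of
    [z ^ (- m - 1) (z - 1) ^ n H(z)] at these points, where [P], [Q] and [K] are
    the expansions of [H] in powers of [z], [z] and [z - 1]. *)
Definition coef_inf (n m : int) P : C :=
  conv (fun k => cbin n%:~R k * (-1) ^+ k) (fun j => P (- j)) (n - m).
Definition coef_0 (n m : int) Q : C :=
  conv (fun k => cbin n%:~R k * (-1) ^ (n - k%:Z)) Q m.
Definition coef_1 (n m : int) K : C :=
  conv (fun k => cbin (- m - 1)%:~R k) K (- n - 1).

(** Products with [z] and with [z - 1], on coefficients. For expansions at 1 the
    variable is [z - 1], so there [mulz] is the product with [z - 1]. *)
Definition mulz P : int -> C := fun m => P (m - 1).
Definition mulzB1 P : int -> C := fun m => P (m - 1) - P m.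

(** The residues of [z ^ (- m - 1) (z - 1) ^ n H(z)] at infinity, 0 and 1 sum to 0. *)
Definition residue_thm P Q K :=
  forall n m, coef_inf n m P - coef_0 n m Q = coef_1 n m K.

Lemma coef_inf_mulzB1 n m P m0 : vanish_below (fun j => P (- j)) m0 ->
  coef_inf n m (mulzB1 P) = coef_inf (n + 1) m P.
Proof.
move=> hP; rewrite /coef_inf.
rewrite [RHS](@conv_pascal (fun k => cbin n%:~R k * (-1) ^+ k) _ (-1) _ m0) //; last first.
  case=> [|k] /=; first by rewrite !cbin0 ?mulr0 ?addr0.
  rewrite intrD cbin_pascal exprS; ring.
rewrite mulN1r (_ : n + 1 - m - 1 = n - m); last by ring.
rewrite (_ : n + 1 - m = n - m + 1); last by ring.
rewrite -(convS _ _ (n - m) 1) -(@convB _ _ _ (m0 - 1)).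
- by apply: eq_conv => // j; rewrite /mulzB1 opprD.
- exact: (@vanish_belowS (fun j => P (- j)) m0 1 hP).
- by apply: vanish_belowW hP; lia.
Qed.

Lemma coef_0_mulzB1 n m Q m0 : vanish_below Q m0 ->
  coef_0 n m (mulzB1 Q) = coef_0 (n + 1) m Q.
Proof.
move=> hQ; rewrite /coef_0.
rewrite [RHS](@conv_pascal (fun k => - (cbin n%:~R k * (-1) ^ (n - k%:Z))) _ (-1) _ m0) //;
    last first.
  case=> [|k] /=.
    rewrite !cbin0 mulr0 addr0 !mul1r !subr0 exprzDr ?unitrN1 //. by rewrite expr1z mulrN1 addr0.
  rewrite intrD cbin_pascal (_ : n + 1 - k.+1%:Z = n - k%:Z); last by lia.
  rewrite (_ : n - k.+1%:Z = n - k%:Z - 1); last by lia.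
  rewrite [in RHS]exprzDr ?unitrN1 // exprN1 invrN1; ring.
have convN c b M n0 : vanish_below b n0 ->
    conv (fun k => - c k) b M = - conv c b M.
  move=> hb; have [B hB] := conv_ex_bound M n0.
  by rewrite !(@convE _ _ n0 _ B) // -sumrN; apply: eq_bigr => k _; rewrite mulNr.
rewrite !(@convN _ _ _ m0) // mulN1r opprK addrC.
rewrite -(convS _ _ m (-1)) -(@convB _ _ _ m0) //.
by apply: vanish_belowW (@vanish_belowS Q m0 (-1) hQ); lia.
Qed.

Lemma coef_1_mulz n m K : coef_1 n m (mulz K) = coef_1 (n + 1) m K.
Proof.
by rewrite /coef_1 (convS _ _ _ (-1)); congr conv; ring.
Qed.

(** The product of [H] with [z - 1] shifts [n], so a pole at 1 can be removed. *)
Lemma residue_thm_mulz P Q K m0 m1 n0 :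
  vanish_below (fun j => P (- j)) m0 -> vanish_below Q m1 -> vanish_below K n0 ->
  residue_thm (mulzB1 P) (mulzB1 Q) (mulz K) -> residue_thm P Q K.
Proof.
move=> hP hQ hK h n m.
have := h (n - 1) m.
by rewrite (@coef_inf_mulzB1 _ _ _ m0) // (@coef_0_mulzB1 _ _ _ m1) // coef_1_mulz subrK.
Qed.

(** The product of [H] with [z = 1 + (z - 1)] shifts [m]. *)
Lemma residue_thm_shift P Q K n0 : vanish_below K n0 ->
  residue_thm (mulz P) (mulz Q) (fun n => K n + K (n - 1)) <-> residue_thm P Q K.
Proof.
move=> hK.
suff E : forall n m, [/\ coef_inf n (m + 1) (mulz P) = coef_inf n m P,
    coef_0 n (m + 1) (mulz Q) = coef_0 n m Q
    & coef_1 n (m + 1) (fun n => K n + K (n - 1)) = coef_1 n m K].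
  split=> h n m; last by have := h n (m - 1); have [<- <- <-] := E n (m - 1); rewrite subrK.
  by have [<- <- <-] := E n m; exact: h.
move=> n m; split.
- apply: eq_fsbigr => k _; rewrite /mulz; congr (_ * P _); lia.
- rewrite /coef_0 (convS _ _ _ (-1)); congr conv; lia.
- rewrite /coef_1 (@convD _ _ _ n0) //; last first.
    by apply: vanish_belowW (@vanish_belowS K n0 (-1) hK); lia.
  rewrite (convS _ _ _ (-1)).
  rewrite [RHS](@conv_pascal (fun k => cbin (- (m + 1) - 1)%:~R k) _ 1 _ n0) //.
    by rewrite mul1r.
  case=> [|k] /=; first by rewrite !cbin0 ?mulr0 ?addr0.
  by rewrite mul1r -cbin_pascal (_ : - m - 1 = - (m + 1) - 1 + 1) ?intrD //; lia.
Qed.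

(** For [H = 1] the defect satisfies [D (n + 1) m = D n (m - 1) - D n m]. It vanishes for
    [n = 0], hence for all [n >= 0], and [n = - 1] is a computation. Below, the recursion
    only shows that [D n m] does not depend on [m]; its value at [m = - 1] is 0. *)
Lemma residue_thm_1 :
  residue_thm (fun m => (m == 0)%:R) (fun m => (m == 0)%:R) (fun m => (m == 0)%:R).
Proof.
pose d : int -> C := fun m => (m == 0)%:R.
have hd : vanish_below d 0 by move=> n hn; rewrite /d lt_eqF.
have hdN : vanish_below (fun j => d (- j)) 0.
  by move=> n hn; rewrite /d oppr_eq0 lt_eqF.
have convd c M : conv c d M = if 0 <= M then c `|M|%N else 0.
  rewrite (@convE _ _ 0 _ `|M|.+1) //; last by lia.
  case: (lerP 0 M) => hM; last first.
    rewrite big1 // => k _; rewrite /d (_ : _ == _ = false) ?mulr0 //; lia.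
  rewrite big_ord_recr /= /d (_ : M - `|M|%N%:Z = 0) ?eqxx ?mulr1; last by lia.
  rewrite big1 ?add0r // => k _.
  by rewrite (_ : _ == _ = false) ?mulr0 //; have := ltn_ord k; lia.
have convdN c M : conv c (fun j => d (- j)) M = if 0 <= M then c `|M|%N else 0.
  by rewrite -convd; apply: eq_conv => // j; rewrite /d oppr_eq0.
pose D n m := coef_inf n m d - coef_0 n m d - coef_1 n m d.
suff D0 : forall n m, D n m = 0.
  by move=> n m; apply/eqP; rewrite -subr_eq0; apply/eqP/D0.
have DE n m : D n m = (if 0 <= n - m then cbin n%:~R `|(n - m)%R|%N * (-1) ^+ `|(n - m)%R|%N else 0)
   - (if 0 <= m then cbin n%:~R `|m|%N * (-1) ^ (n - `|m|%N%:Z) else 0)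
   - (if 0 <= - n - 1 then cbin (- m - 1)%:~R `|(- n - 1)%R|%N else 0).
  by rewrite /D /coef_inf /coef_0 /coef_1 convdN !convd.
have rec n m : D (n + 1) m = D n (m - 1) - D n m.
  rewrite /D -(@coef_inf_mulzB1 _ _ _ 0) // -(@coef_0_mulzB1 _ _ _ 0) // -coef_1_mulz.
  have -> : coef_inf n m (mulzB1 d) = coef_inf n (m - 1) d - coef_inf n m d.
    rewrite /coef_inf (_ : n - (m - 1) = n - m + 1); last by ring.
    rewrite -(convS _ _ (n - m) 1) -(@convB _ _ _ (-1)).
    - by apply: eq_conv => // j; rewrite /mulzB1 opprD.
    - exact: (@vanish_belowS (fun j => d (- j)) 0 1 hdN).
    - by apply: vanish_belowW hdN.
  have -> : coef_0 n m (mulzB1 d) = coef_0 n (m - 1) d - coef_0 n m d.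
    rewrite /coef_0 -(convS _ _ m (-1)) -(@convB _ _ _ 0) //.
    by apply: vanish_belowW (@vanish_belowS d 0 (-1) hd).
  have -> : coef_1 n m (mulz d) = coef_1 n (m - 1) d - coef_1 n m d.
    rewrite coef_1_mulz /coef_1.
    rewrite [conv (fun k => cbin (- (m - 1) - 1)%:~R k) _ _]
      (@conv_pascal (fun k => cbin (- m - 1)%:~R k) _ 1 _ 0) //.
      rewrite mul1r [RHS]addrAC subrr add0r; congr conv; ring.
    case=> [|k] /=; first by rewrite !cbin0 ?mulr0 ?addr0.
    by rewrite mul1r -cbin_pascal (_ : - (m - 1) - 1 = - m - 1 + 1) ?intrD //; lia.
  ring.
have Dge n : 0 <= n -> forall m, D n m = 0.
  move=> hn; rewrite -(gez0_abs hn); elim: `|n|%N => [|j IH] m; last first.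
    by rewrite -addn1 PoszD rec !IH subrr.
  rewrite DE !mulr0z !cbin0n !sub0r /= subr0.
  case: (eqVneq m 0) => [->|hm]; first by rewrite /= !expr0 mulr1 subrr.
  rewrite !absz_eq0 oppr_eq0 (negbTE hm) !mul0r; by do 2 case: ifP; rewrite ?subrr.
move=> n m; have [/Dge -> //|hn] := lerP 0 n.
have [j ->] : exists j : nat, n = - j.+1%:Z by exists `|n|.-1; lia.
elim: j m => [|j IH] m.
  have e1 : ((- 1%:Z)%:~R : C) = -1 by rewrite rmorphN.
  rewrite DE opprK subrr lexx absz0 cbin0 e1 !cbinN1.
  have [hm|hm] := lerP 0 m.
    rewrite (_ : 0 <= - 1%:Z - m = false); last by lia.
    rewrite exprzDr ?unitrN1 // exprN1 invrN1 -exprnN -exprVn invrN1.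
    by rewrite mulrCA -exprMn mulrNN mulr1 expr1n mulr1 sub0r opprK subrr.
  rewrite (_ : 0 <= - 1%:Z - m); last by lia.
  by rewrite -exprMn mulrNN mulr1 expr1n subr0 subrr.
have hc m' : D (- j.+2%:Z) m' = D (- j.+2%:Z) (m' - 1).
  apply/eqP; rewrite eq_sym -subr_eq0 -rec (_ : - j.+2%:Z + 1 = - j.+1%:Z) ?IH //; lia.
have hc' (i : nat) m' : D (- j.+2%:Z) m' = D (- j.+2%:Z) (m' - i%:Z).
  elim: i => [|i IHi]; first by rewrite subr0.
  by rewrite IHi hc; congr (D _ _); lia.
have h1 : D (- j.+2%:Z) (- 1) = 0.
  rewrite DE (_ : 0 <= - j.+2%:Z - (- 1 : int) = false); last by lia.
  rewrite (_ : 0 <= (- 1 : int) = false) // (_ : 0 <= - - j.+2%:Z - 1); last by lia.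
  rewrite opprK subrr mulr0z cbin0n (_ : absz _ == _ = false) ?subrr //; lia.
have [hm|hm] := lerP m (- 1).
  by rewrite -h1 (hc' `|(- 1 - m)%R|%N (- 1)); congr (D _ _); lia.
by rewrite (hc' `|(m + 1)%R|%N m) -h1; congr (D _ _); lia.
Qed.

Lemma residue_thm_monomial (i : int) :
  residue_thm (fun m => (m == i)%:R) (fun m => (m == i)%:R)
    (fun n => if 0 <= n then cbin i%:~R `|n|%N else 0).
Proof.
pose X (i : int) : int -> C := fun m => (m == i)%:R.
pose B (i : int) : int -> C := fun n => if 0 <= n then cbin i%:~R `|n|%N else 0.
have hB j : vanish_below (B j) 0 by move=> n hn; rewrite /B leNgt hn.
rewrite -/(X i) -/(B i).
have BD j n : B (j + 1) n = B j n + B j (n - 1).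
  rewrite /B; case: (ltrgtP 0 n) => hn.
  - rewrite (_ : 0 <= n - 1); last by lia.
    rewrite (_ : `|n|%N = `|(n - 1)%R|%N.+1); last by lia.
    by rewrite intrD cbin_pascal.
  - by rewrite (_ : 0 <= n - 1 = false) ?addr0 //; lia.
  - by rewrite -hn /= !cbin0 addr0.
have XS j : mulz (X j) = X (j + 1).
  by apply/funext => m; rewrite /mulz /X subr_eq.
have step j : residue_thm (X (j + 1)) (X (j + 1)) (B (j + 1)) <->
    residue_thm (X j) (X j) (B j).
  rewrite -XS (_ : B (j + 1) = fun n => B j n + B j (n - 1)).
    exact: (@residue_thm_shift _ _ _ 0).
  by apply/funext => n; rewrite BD.
have h0 : residue_thm (X 0) (X 0) (B 0).
  rewrite (_ : B 0 = fun n => (n == 0)%:R); first exact: residue_thm_1.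
  apply/funext => n; rewrite /B mulr0z cbin0n absz_eq0.
  by case: ifP => // hn; case: eqP => // h; move: hn; rewrite h.
case: (intP i) => [//|n|n].
  by elim: n.+1 => [//|j IH]; rewrite -addn1 PoszD; apply/step.
elim: n.+1 => [//|j IH]; apply: (step (- j.+1%:Z)).1.
by rewrite (_ : - j.+1%:Z + 1 = - j%:Z) //; lia.
Qed.

(** Here [P], [Q] and [K] expand a function [H] for which [(z - 1) ^ T H(z)] is the Laurent
    polynomial [\sum_(i <- s) a i z ^ i]. The product with [z - 1] only shifts [n], which
    removes the denominator; the product with [z] only shifts [m], which reduces the
    monomials to [H = 1]. *)
Lemma residue_theorem P Q K (T : nat) (s : seq int) (a : int -> C) m0 m1 n0 :
  vanish_below (fun j => P (- j)) m0 -> vanish_below Q m1 -> vanish_below K n0 ->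
  iter T mulzB1 P = (fun m => \sum_(i <- s) a i * (m == i)%:R) ->
  iter T mulzB1 Q = (fun m => \sum_(i <- s) a i * (m == i)%:R) ->
  iter T mulz K = (fun n => \sum_(i <- s) a i *
                     (if 0 <= n then cbin i%:~R `|n|%N else 0)) ->
  residue_thm P Q K.
Proof.
elim: T P Q K m0 m1 n0 => [|T IH] P Q K m0 m1 n0 hP hQ hK.
  rewrite /= => -> -> -> n m; rewrite /coef_inf /coef_0 /coef_1.
  rewrite !conv_sum.
  - rewrite -sumrB; apply: eq_bigr => i _; rewrite -mulrBr; congr (_ * _).
    exact: residue_thm_monomial.
  - by move=> i _; exists 0 => k hk; rewrite leNgt hk.
  - by move=> i _; exists i => k hk; rewrite lt_eqF.
  - move=> i _; exists (- i) => k hk.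
    by rewrite (_ : _ == _ = false) //; apply/negbTE/eqP; lia.
rewrite !iterSr => eP eQ eK.
apply: (@residue_thm_mulz _ _ _ m0 m1 n0) => //.
apply: (IH _ _ _ (m0 - 1) m1 n0) => //.
- move=> j hj; rewrite /mulzB1 (_ : - j - 1 = - (j + 1)); last by ring.
  by rewrite !hP ?subrr //; lia.
- by move=> j hj; rewrite /mulzB1 !hQ ?subrr //; lia.
- by move=> j hj; rewrite /mulz hK //; lia.
Qed.

End Residues.

(** * Complex exponentials *)

Section ComplexExp.
Variable R : realType.
Local Notation C := R[i].
Local Notation normc := (@Normc.normc R).
Implicit Types (z a b : C) (x t : R).

Lemma normcE z : `|z| = (normc z)%:C%C.
Proof. by []. Qed.

Lemma normc_ge0 z : 0 <= normc z.
Proof. by case: z => a b /=; exact: sqrtr_ge0. Qed.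

Lemma normc_eq0 z : (normc z == 0) = (z == 0).
Proof. by apply/eqP/eqP => [/Normc.eq0_normc//|->]; exact: Normc.normc0. Qed.

Lemma normcX z n : normc (z ^+ n) = normc z ^+ n.
Proof.
by elim: n => [|n IH]; rewrite ?expr0 ?Normc.normc1 // !exprS Normc.normcM IH.
Qed.

Lemma normc_real x : normc x%:C%C = `|x|.
Proof. by rewrite /Normc.normc /= expr0n /= addr0 sqrtr_sqr. Qed.

Lemma ler_normcB z b : normc (z - b) <= normc z + normc b.
Proof. by rewrite -(normcN b); exact: le_normcD. Qed.

Lemma ler_normc_sum (I : Type) (s : seq I) (F : I -> C) :
  normc (\sum_(i <- s) F i) <= \sum_(i <- s) normc (F i).
Proof.
elim: s => [|i s IH]; first by rewrite !big_nil Normc.normc0.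
rewrite !big_cons; apply: le_trans (le_normcD _ _) _; exact: lerD.
Qed.

Lemma ler_Re_normc z : `|complex.Re z| <= normc z.
Proof. by have := normc_ge_Re z; rewrite normcE lecR. Qed.

Lemma eqC z b : complex.Re z = complex.Re b -> complex.Im z = complex.Im b -> z = b.
Proof. by case: z => ? ?; case: b => ? ? /= -> ->. Qed.

Lemma ReD z b : complex.Re (z + b) = complex.Re z + complex.Re b.
Proof. by case: z => ? ?; case: b. Qed.

Lemma ImD z b : complex.Im (z + b) = complex.Im z + complex.Im b.
Proof. by case: z => ? ?; case: b. Qed.

Lemma ReN z : complex.Re (- z) = - complex.Re z.
Proof. by case: z. Qed.

Lemma ImN z : complex.Im (- z) = - complex.Im z.
Proof. by case: z. Qed.

Lemma ReM_real z x : complex.Re (z * x%:C%C) = complex.Re z * x.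
Proof. by case: z => a b /=; rewrite mulr0 subr0. Qed.

Lemma ImM_real z x : complex.Im (z * x%:C%C) = complex.Im z * x.
Proof. by case: z => a b /=; rewrite mulr0 add0r. Qed.

Lemma intC (n : int) : n%:~R = (n%:~R : R)%:C%C :> C.
Proof. by rewrite rmorph_int. Qed.

Lemma natC (n : nat) : n%:R = (n%:R : R)%:C%C :> C.
Proof. by rewrite rmorph_nat. Qed.

Lemma Re_int (n : int) : complex.Re (n%:~R : C) = n%:~R.
Proof. by rewrite intC. Qed.

Lemma Re_nat (n : nat) : complex.Re (n%:R : C) = n%:R.
Proof. by rewrite natC. Qed.

Lemma cexpD a b : cexp (a + b) = cexp a * cexp b.
Proof.
rewrite /cexp ReD ImD expRD cosD sinD.
by apply: eqC => /=; ring.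
Qed.

Lemma cexp0 : cexp (0 : C) = 1.
Proof. by rewrite /cexp /= expR0 cos0 sin0 !mul1r. Qed.

Lemma cexp_real x : cexp (x%:C%C : C) = (expR x)%:C%C.
Proof. by rewrite /cexp /= cos0 sin0 mulr1 mulr0. Qed.

Lemma normc_cexp a : normc (cexp a) = expR (complex.Re a).
Proof.
by rewrite /cexp /Normc.normc !exprMn -mulrDr cos2Dsin2 mulr1 sqrtr_sqr ger0_norm.
Qed.

Lemma cexp_neq0 a : cexp a != 0.
Proof. by rewrite -normc_eq0 normc_cexp gt_eqF // expR_gt0. Qed.

Lemma cexpN a : cexp (- a) = (cexp a)^-1.
Proof.
by apply: (mulfI (cexp_neq0 a)); rewrite -cexpD subrr cexp0 divff // cexp_neq0.
Qed.

Lemma cexpMn a n : cexp (a * n%:R) = cexp a ^+ n.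
Proof.
elim: n => [|n IH]; first by rewrite mulr0 cexp0.
by rewrite -natr1 mulrDr mulr1 cexpD IH exprSr.
Qed.

Lemma cexpMz a (n : int) : cexp (a * n%:~R) = cexp a ^ n.
Proof.
case: n => n; first exact: cexpMn.
by rewrite NegzE rmorphN mulrN cexpN (cexpMn a n.+1) exprnN.
Qed.

Lemma cexp_twopii : cexp (twopii R) = 1.
Proof. by rewrite /cexp /= expR0 !mul1r mulr_natl cos2pi sin2pi. Qed.

Lemma cexp_twopii_int (n : int) : cexp (twopii R * n%:~R) = 1.
Proof. by rewrite cexpMz cexp_twopii exp1rz. Qed.

Lemma twopii_neq0 : twopii R != 0.
Proof. by rewrite eq_complex /= negb_and mulf_neq0 ?orbT // gt_eqF // pi_gt0. Qed.

Lemma cos_eq1 t : 0 <= t < 2 * pi -> cos t = 1 -> t = 0.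
Proof.
move=> /andP[t0 t2] ct.
have [tpi|pit] := lerP t pi.
  by apply: (@cos_inj R); rewrite ?cos0 // ?in_itv /= ?t0 ?tpi ?lexx ?pi_ge0.
have c0 : cos (2 * pi - t) = cos 0.
  by rewrite cosB mulr_natl cos2pi sin2pi ct cos0 mul0r addr0 mulr1.
have := @cos_inj R _ _ _ _ c0; rewrite !in_itv /= lexx pi_ge0.
have h1 : 0 <= 2 * pi - t <= pi by apply/andP; split; lra.
by move=> /(_ h1 isT) h; move: t2; rewrite ltNge -subr_le0 h lexx.
Qed.

Lemma cexp_eq1 a : cexp a = 1 -> exists n : int, a = twopii R * n%:~R.
Proof.
move=> h; have r0 : complex.Re a = 0.
  have := congr1 normc h; rewrite normc_cexp Normc.normc1 -expR0.
  exact: expR_inj.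
pose n := Num.floor (complex.Im a / (2 * pi)); exists n.
have pi2 : 0 < 2 * pi :> R by rewrite mulr_gt0 // pi_gt0.
have : cexp (a - twopii R * n%:~R) = 1.
  by rewrite cexpD h cexpN cexp_twopii_int invr1 mulr1.
set b := a - _ => hb.
have bR : complex.Re b = 0 by rewrite /b ReD ReN intC ReM_real r0 mul0r subr0.
have bI : complex.Im b = complex.Im a - 2 * pi * n%:~R by rewrite /b ImD ImN intC ImM_real.
have : cos (complex.Im b) = 1.
  by have := congr1 (@complex.Re R) hb; rewrite /cexp /= bR expR0 mul1r.
move=> /cos_eq1 hc; apply/eqP; rewrite -subr_eq0; apply/eqP.
apply: eqC; rewrite -/b ?bR //= hc // bI.
have /andP[f1 f2] := floor_itv (complex.Im a / (2 * pi)).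
move: f1 f2; rewrite -/n ler_pdivlMr // ltr_pdivrMr // intrD mulrDl mul1r => f1 f2.
by apply/andP; split; lra.
Qed.

Lemma cexp_twopii_eq a b : cexp (twopii R * a) = cexp (twopii R * b) ->
  exists n : int, a = b + n%:~R.
Proof.
move=> h; have [|n hn] := @cexp_eq1 (twopii R * a - twopii R * b).
  by rewrite cexpD cexpN h divff // cexp_neq0.
exists n; apply/eqP; rewrite addrC -subr_eq; apply/eqP.
by apply: (mulfI twopii_neq0); rewrite mulrBr.
Qed.

Lemma Re_strip_inj a b : 0 <= complex.Re a < 1 -> 0 <= complex.Re b < 1 ->
  cexp (twopii R * a) = cexp (twopii R * b) -> a = b.
Proof.
move=> /andP[a0 a1] /andP[b0 b1] /cexp_twopii_eq[n e].
suff n0 : n = 0 by rewrite e n0 addr0.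
have eR : complex.Re a = complex.Re b + n%:~R by rewrite e ReD Re_int.
have h1 : (n%:~R : R) < 1%:~R by rewrite mulr1z; lra.
have h2 : ((- 1)%:~R : R) < n%:~R by rewrite rmorphN /= mulr1z; lra.
by move: h1 h2; rewrite !ltr_int; lia.
Qed.

Lemma polar_exists x y : x ^+ 2 + y ^+ 2 = 1 ->
  exists2 t : R, 0 <= t < 2 * pi & x = cos t /\ y = sin t.
Proof.
move=> h; have hx : -1 <= x <= 1.
  rewrite -ler_norml -(@ler_pXn2r _ 2) ?nnegrE // expr1n real_normK ?num_real //.
  by rewrite -h lerDl sqr_ge0.
have hc : cos (acos x) = x by rewrite acosK // in_itv.
have hs : sin (acos x) = `|y|.
  by rewrite sin_acos // -h addrAC subrr add0r sqrtr_sqr.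
have a0 := acos_ge0 hx; have api := acos_lepi hx.
have pi0 := pi_gt0 R.
have [y0|y0] := lerP 0 y.
  exists (acos x); last by rewrite hc hs ger0_norm.
  by apply/andP; split => //; lra.
have sg : 0 < sin (acos x) by rewrite hs normr_gt0 lt_eqF.
have a1 : 0 < acos x.
  rewrite lt_neqAle a0 andbT; apply/eqP => e.
  by move: sg; rewrite -e sin0 ltxx.
exists (2 * pi - acos x); first by apply/andP; split; lra.
rewrite cosB sinB mulr_natl cos2pi sin2pi !mul1r !mul0r addr0 sub0r.
by rewrite hc hs ltr0_norm // opprK.
Qed.

(** The eigenvalues of [g] have logarithms in the strip of the g-weights. *)
Lemma clog_strip z : z != 0 ->
  exists2 a : C, 0 <= complex.Re a < 1 & cexp (twopii R * a) = z.
Proof.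
move=> z0; have n0 : 0 < normc z by rewrite lt_neqAle normc_ge0 eq_sym normc_eq0 z0.
case: z z0 n0 => x y z0 n0; set r := normc _ in n0.
have hr : (x / r) ^+ 2 + (y / r) ^+ 2 = 1.
  rewrite !expr_div_n -mulrDl -[X in X / _](@sqr_sqrtr _ (x ^+ 2 + y ^+ 2)).
    by rewrite divff // expf_neq0 // gt_eqF.
  by rewrite addr_ge0 ?sqr_ge0.
have [t /andP[t0 t2] [ex ey]] := polar_exists hr.
have pi2 : 0 < 2 * pi :> R by rewrite mulr_gt0 // pi_gt0.
exists (Complex (t / (2 * pi)) (- (ln r / (2 * pi)))) => /=.
  by rewrite divr_ge0 // ?ltW //= ltr_pdivrMr // mul1r.
have -> : twopii R * Complex (t / (2 * pi)) (- (ln r / (2 * pi))) = Complex (ln r) t.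
  apply: eqC => /=; rewrite mul0r.
    by rewrite sub0r mulrN opprK mulrC mulfVK // gt_eqF.
  by rewrite add0r mulrC mulfVK // gt_eqF.
rewrite /cexp /= lnK ?posrE // -ex -ey.
by apply: eqC => /=; rewrite mulrC mulfVK // gt_eqF.
Qed.

Lemma carg_real x : 0 < x -> carg (x%:C%C : C) = 0.
Proof.
move=> x0; have pi2 : 0 < 2 * pi :> R by rewrite mulr_gt0 // pi_gt0.
rewrite /carg; case: xgetP => [t -> [ht e]|/(_ 0) []].
  apply: cos_eq1 => //; have := congr1 (@complex.Re R) e.
  rewrite normcE normc_real gtr0_norm // /= mul0r subr0 => /esym.
  by rewrite -[X in _ = X]mulr1 => /(mulfI (lt0r_neq0 x0)).
split; first by rewrite lexx pi2.
by rewrite normcE normc_real gtr0_norm // cos0 sin0 mulr1.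
Qed.

Lemma lbr_real (p : int) x : 0 < x ->
  lbr p (x%:C%C : C) = twopii R * p%:~R + (ln x)%:C%C.
Proof.
move=> x0; rewrite /lbr carg_real // add0r normcE normc_real gtr0_norm //=.
by apply: eqC; rewrite ?ReD ?ImD intC ?ReM_real ?ImM_real /=; ring.
Qed.

(** Used to pass from infinitely many branches, or from all natural numbers, to
    polynomial identities. *)
Lemma poly0_inj_roots (f : nat -> C) (q : {poly C}) :
  injective f -> (forall n, q.[f n] = 0) -> q = 0.
Proof.
move=> fi hq; apply/eqP/negPn/negP => q0.
have := @max_poly_roots _ q [seq f i | i <- iota 0 (size q)] q0.
rewrite map_inj_uniq // iota_uniq size_map size_iota ltnn => h.
have /h : all (root q) [seq f i | i <- iota 0 (size q)]; last by move/(_ isT).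
by apply/allP => _ /mapP[n _ ->]; rewrite rootE hq.
Qed.

End ComplexExp.

(** * Uniqueness of asymptotic expansions in exponentials and powers *)

Section Asymptotics.
Variable R : realType.
Local Notation C := R[i].
Local Notation normc := (@Normc.normc R).
Implicit Types (u v : nat -> C).

Definition tends0 u := forall eps : R, 0 < eps ->
  exists N, forall n, (N <= n)%N -> normc (u n) < eps.

Lemma tends0_le u v : (exists N, forall n, (N <= n)%N -> normc (u n) <= normc (v n)) ->
  tends0 v -> tends0 u.
Proof.
move=> [N0 h] hv eps /hv[N hN]; exists (maxn N0 N) => n; rewrite geq_max => /andP[n0 n1].
exact: le_lt_trans (h n n0) (hN n n1).
Qed.

Lemma tends0_0 : tends0 (fun=> 0).
Proof. by move=> eps e0; exists 0%N => n _; rewrite Normc.normc0. Qed.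

Lemma tends0D u v : tends0 u -> tends0 v -> tends0 (fun n => u n + v n).
Proof.
move=> hu hv eps e0; have e2 : 0 < eps / 2 by rewrite divr_gt0.
have [N hN] := hu _ e2; have [N' hN'] := hv _ e2.
exists (maxn N N') => n; rewrite geq_max => /andP[n0 n1].
apply: le_lt_trans (le_normcD _ _) _; rewrite [ltRHS](splitr eps).
exact: ltrD (hN n n0) (hN' n n1).
Qed.

Lemma tends0_bounded u (b : nat -> C) (M : R) : (forall n, normc (b n) <= M) ->
  tends0 u -> tends0 (fun n => b n * u n).
Proof.
move=> hb hu eps e0.
have M1 : 0 < M + 1 by have := le_trans (normc_ge0 _) (hb 0%N); lra.
have [N hN] := hu _ (divr_gt0 e0 M1); exists N => n /hN h.
rewrite Normc.normcM; move: h; rewrite ltr_pdivlMr // mulrC; apply: le_lt_trans.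
apply: ler_wpM2r; first exact: normc_ge0.
by have := hb n; lra.
Qed.

Lemma tends0Z u a : tends0 u -> tends0 (fun n => a * u n).
Proof. by move=> hu; apply: (@tends0_bounded u (fun=> a) (normc a)). Qed.

Lemma tends0B u v : tends0 u -> tends0 v -> tends0 (fun n => u n - v n).
Proof.
move=> hu hv; have := tends0D hu (tends0Z (-1) hv).
by rewrite (_ : (fun n => _) = fun n => u n - v n) //; apply/funext => n; rewrite mulN1r.
Qed.

Lemma tends0S u : tends0 u -> tends0 (fun n => u n.+1).
Proof. by move=> hu eps /hu[N hN]; exists N => n hn; apply/hN/ltnW. Qed.

Lemma tends0_sum (I : Type) (s : seq I) (F : I -> nat -> C) :
  (forall i, tends0 (F i)) -> tends0 (fun n => \sum_(i <- s) F i n).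
Proof.
move=> h; elim: s => [|i s IH].
  by rewrite (_ : (fun n => _) = fun=> 0); [exact: tends0_0|apply/funext => n; rewrite big_nil].
rewrite (_ : (fun n => _) = fun n => F i n + \sum_(j <- s) F j n); first exact: tends0D.
by apply/funext => n; rewrite big_cons.
Qed.

Lemma poly_natS_eq0 (p : {poly C}) : p \Po ('X + 1%:P) = p -> exists c, p = c%:P.
Proof.
move=> h; exists p.[0].
apply/eqP; rewrite -subr_eq0; apply/eqP.
apply: (@poly0_inj_roots _ (fun n => n%:R)).
  by move=> m n /eqP; rewrite eqr_nat => /eqP.
move=> n; rewrite hornerD hornerN hornerC.
suff -> : p.[n%:R] = p.[0] by rewrite subrr.
elim: n => [//|n <-]; rewrite -[in RHS]h horner_comp; congr (_.[_]).
by rewrite !hornerE natr1.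
Qed.

Lemma size_polyS (p : {poly C}) : size (p \Po ('X + 1%:P)) = size p.
Proof. by apply: size_comp_poly2; rewrite -[1]opprK polyCN size_XsubC. Qed.

Lemma lead_coef_polyS (p : {poly C}) :
  (p \Po ('X + 1%:P))`_(size p).-1 = p`_(size p).-1.
Proof.
rewrite -{1}(size_polyS p) -[LHS]/(lead_coef (p \Po ('X + 1%:P))) -[RHS]/(lead_coef p).
have [/size1_polyC ->|hp] := leqP (size p) 1; first by rewrite comp_polyC.
rewrite lead_coef_comp -[1]opprK polyCN ?size_XsubC //.
by rewrite lead_coefXsubC expr1n mulr1.
Qed.

(** Replacing [u n] by [u (n + 1) - l u n] removes one degree of the polynomial
    that goes with the base [l] and keeps the degrees of the others, so induction
    on the sum of the sizes applies. *)
Lemma expseq_indep (s : seq C) (P : C -> {poly C}) :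
  uniq s -> (forall l, l \in s -> 1 <= normc l) ->
  tends0 (fun n => \sum_(l <- s) (P l).[n%:R] * l ^+ n) ->
  forall l, l \in s -> P l = 0.
Proof.
move=> us hs; have [N] := ubnP (\sum_(l <- s) size (P l)).
elim: N P => // N IH P; rewrite ltnS => hN h0.
have [/allP h|/allPn[l0 ls]] := boolP (all (fun l => P l == 0) s).
  by move=> l /h/eqP.
move=> Pl0; exfalso.
pose P' l := l *: (P l \Po ('X + 1%:P)) - l0 *: P l.
have sP' l : (size (P' l) <= size (P l))%N.
  rewrite /P'; apply: leq_trans (size_polyD _ _) _; rewrite size_polyN geq_max.
  apply/andP; split; last exact: size_scale_leq.
  by apply: leq_trans (size_scale_leq _ _) _; rewrite size_polyS.
have cP' l : (P' l)`_(size (P l)).-1 = (l - l0) * lead_coef (P l).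
  by rewrite /P' coefB !coefZ lead_coef_polyS lead_coefE mulrBl.
have sP0 : (size (P' l0) < size (P l0))%N.
  have p0 : (0 < size (P l0))%N by rewrite size_poly_gt0.
  rewrite -(prednK p0) ltnS; apply/leq_sizeP => j; rewrite leq_eqVlt => /predU1P[<-|hj].
    by rewrite cP' subrr mul0r.
  apply: (leq_sizeP _ _ (leqnn _)); apply: leq_trans (sP' _) _.
  by rewrite -(prednK p0).
have P'0 : forall l, l \in s -> P' l = 0.
  apply: IH.
    apply: leq_trans hN.
    rewrite !(big_rem l0 ls) /= -addSn; apply: leq_add => //.
    by apply: leq_sum => l _; exact: sP'.
  have := tends0B (tends0S h0) (tends0Z l0 h0).
  rewrite (_ : (fun n => _ - _) = fun n => \sum_(l <- s) (P' l).[n%:R] * l ^+ n) //.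
  apply/funext => n; rewrite mulr_sumr -sumrB; apply: eq_bigr => l _.
  rewrite /P' hornerD hornerN !hornerZ horner_comp hornerD hornerX hornerC natr1 exprS; ring.
have Pl l : l \in s -> l != l0 -> P l = 0.
  move=> /P'0 h ne; have := cP' l; rewrite h coef0 => /esym/eqP.
  by rewrite mulf_eq0 subr_eq0 (negbTE ne) lead_coef_eq0 => /eqP.
have l00 : l0 != 0.
  by rewrite -normc_eq0 gt_eqF //; apply: lt_le_trans (hs _ ls).
have [c hc] : exists c, P l0 = c%:P.
  apply: poly_natS_eq0; apply/eqP; rewrite -subr_eq0.
  have := P'0 _ ls; rewrite /P' -scalerBr => /eqP.
  by rewrite scaler_eq0 (negbTE l00).
have c0 : 0 < normc c.
  rewrite lt_neqAle normc_ge0 andbT eq_sym normc_eq0.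
  by apply: contraNneq Pl0; rewrite hc => ->.
have [N1 /(_ N1 (leqnn _))] := h0 _ c0.
rewrite (bigD1_seq l0) //= big_seq_cond big1 ?addr0; last first.
  by move=> l /andP[ll lne]; rewrite (Pl l ll lne) hornerC mul0r.
rewrite hc hornerC Normc.normcM normcX ltNge => /negP; apply.
by rewrite ler_peMr ?normc_ge0 // exprn_ege1 // hs.
Qed.

Lemma expR_decay (a : R) k : 0 < a ->
  exists M : R, forall t, 0 <= t -> t ^+ k * expR (- (a * t)) <= M.
Proof.
move=> a0; exists ((k.+1%:R / a) ^+ k) => t t0.
have k0 : (0 : R) < k.+1%:R by rewrite ltr0n.
have h1 : a * t / k.+1%:R <= expR (a * t / k.+1%:R).
  by apply: le_trans (expR_ge1Dx _); rewrite lerDr.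
have h0 : 0 <= a * t / k.+1%:R by rewrite divr_ge0 ?mulr_ge0 // ltW.
have h2 : (a * t / k.+1%:R) ^+ k <= expR (a * t).
  apply: (@le_trans _ _ (expR (a * t / k.+1%:R) ^+ k)).
    by rewrite lerXn2r // nnegrE // expR_ge0.
  rewrite -expRM_natl ler_expR.
  rewrite (_ : k%:R * _ = a * t * (k%:R / k.+1%:R)); last by ring.
  by rewrite ler_piMr ?mulr_ge0 ?(ltW a0) // ler_pdivrMr // mul1r ler_nat.
have -> : t ^+ k = (k.+1%:R / a) ^+ k * (a * t / k.+1%:R) ^+ k.
  by rewrite -exprMn; congr (_ ^+ _); field; rewrite !gt_eqF.
rewrite -[leLHS]mulrA -[leRHS]mulr1; apply: ler_wpM2l.
  by rewrite exprn_ge0 // divr_ge0 // ltW.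
by rewrite expRN ler_pdivrMr ?expR_gt0 // mul1r.
Qed.

(** The value of [x ^ e.1 (log x) ^ e.2] where [log x = l]. *)
Definition expo (l : C) (e : C * nat) : C := cexp (e.1 * l) * l ^+ e.2.

Lemma normc_expo l e : normc (expo l e) = expR (complex.Re (e.1 * l)) * normc l ^+ e.2.
Proof. by rewrite /expo Normc.normcM normc_cexp normcX. Qed.

Lemma expo_small (sg : R) (l0 : C) e (K : R) : sg * complex.Re e.1 < - K ->
  exists2 M : R, 0 <= M & forall t, 0 <= t ->
    normc (expo (l0 + (sg * t)%:C%C) e) <= M * expR (- (K * t)).
Proof.
case: e => b k /= hK; set d := - K - sg * complex.Re b; have d0 : 0 < d by rewrite /d; lra.
have [M hM] := expR_decay k d0.
pose A := normc l0 + `|sg|; have A0 : 0 <= A by rewrite addr_ge0 // normc_ge0.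
have M0 : 0 <= M by apply: le_trans (hM 0 (lexx _)); rewrite mulr_ge0 ?expR_ge0 ?exprn_ge0.
exists (expR (complex.Re (b * l0)) * A ^+ k * (expR d * M)).
  by rewrite !mulr_ge0 ?exprn_ge0 ?expR_ge0.
move=> t t0; rewrite normc_expo /= mulrDr ReD ReM_real.
have nl : normc (l0 + (sg * t)%:C%C) <= A * (1 + t).
  apply: le_trans (le_normcD _ _) _; rewrite normc_real normrM (ger0_norm t0) /A.
  have := normc_ge0 l0; have := normr_ge0 sg => h1 h2.
  rewrite mulrDr mulr1 mulrDl -addrA lerD2l.
  have := mulr_ge0 h2 t0; have := h1; lra.
have nlk : normc (l0 + (sg * t)%:C%C) ^+ k <= A ^+ k * (1 + t) ^+ k.
  by rewrite -exprMn lerXn2r // nnegrE ?normc_ge0 // mulr_ge0 // addr_ge0.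
have e1 : complex.Re b * (sg * t) = - (K * t) + d + - (d * (1 + t)) by rewrite /d; ring.
rewrite e1 expRD [expR (- (K * t) + d - _)]expRD [expR (- (K * t) + d)]expRD.
have t1 : 0 <= 1 + t by rewrite addr_ge0.
have h3 := hM _ t1.
apply: (@le_trans _ _ (expR (complex.Re (b * l0)) *
   (expR (- (K * t)) * expR d * expR (- (d * (1 + t)))) * (A ^+ k * (1 + t) ^+ k))).
  by apply: ler_wpM2l nlk; rewrite !mulr_ge0 ?expR_ge0.
have -> : expR (complex.Re (b * l0)) *
   (expR (- (K * t)) * expR d * expR (- (d * (1 + t)))) * (A ^+ k * (1 + t) ^+ k) =
   expR (complex.Re (b * l0)) * A ^+ k * (expR d * ((1 + t) ^+ k * expR (- (d * (1 + t)))))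
     * expR (- (K * t)) by ring.
apply: ler_wpM2r; first exact: expR_ge0.
apply: ler_wpM2l; first by rewrite mulr_ge0 ?expR_ge0 ?exprn_ge0.
by apply: ler_wpM2l => //; exact: expR_ge0.
Qed.

Lemma tends0_expR (d : R) : 0 < d -> tends0 (fun n => (expR (- (d * n%:R)))%:C%C).
Proof.
move=> d0 eps e0; have [M hM] := expR_decay 1 d0.
exists (Num.truncn (M / eps)).+1 => n hn.
have n0 : (0 : R) < n%:R by rewrite ltr0n; apply: leq_trans hn.
rewrite normc_real ger0_norm ?expR_ge0 //.
have := hM _ (ltW n0); rewrite expr1 mulrC -ler_pdivlMr // => hE.
apply: le_lt_trans hE _; rewrite ltr_pdivrMr // mulrC -ltr_pdivrMr //.
by apply: lt_le_trans (truncnS_gt _) _; rewrite ler_nat.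
Qed.

(** If the imaginary part of [b] is less than [2 pi / h] in absolute value,
    [e ^ (b h) = 1] forces [b = 0]; so for small [h], sampling at the multiples of [h]
    separates the exponents. *)
Lemma exists_sep_step (s : seq C) : exists2 h : R, 0 < h &
  {in s &, forall a b, cexp (a * h%:C%C) = cexp (b * h%:C%C) -> a = b}.
Proof.
pose M := \sum_(a <- s) normc a.
have M0 : 0 <= M by apply: sumr_ge0 => a _; exact: normc_ge0.
have hM a : a \in s -> normc a <= M.
  move=> as_; rewrite /M (big_rem a) //= lerDl sumr_ge0 // => i _; exact: normc_ge0.
have pi0 := pi_gt0 R.
exists (pi / (M + 1)); first by rewrite divr_gt0 // ltr_wpDl.
move=> a b /hM ha /hM hb e.
have [|n hn] := @cexp_eq1 R ((a - b) * (pi / (M + 1))%:C%C).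
  by rewrite mulrBl cexpD cexpN e divff // cexp_neq0.
have hR : complex.Re (a - b) = 0.
  have := congr1 (@complex.Re R) hn; rewrite intC !ReM_real mul0r => /eqP.
  by rewrite mulf_eq0 orbC gt_eqF ?divr_gt0 // ?ltr_wpDl //= => /eqP.
have hI := congr1 (@complex.Im R) hn.
move: hI; rewrite intC !ImM_real /= => hI.
have nI : `|complex.Im (a - b)| <= 2 * M.
  apply: (@le_trans _ _ (normc (a - b))).
    rewrite /Normc.normc; case: (a - b) => x y /=.
    by rewrite -sqrtr_sqr ler_sqrt ?lerDr ?sqr_ge0 // addr_ge0 ?sqr_ge0.
  by apply: le_trans (ler_normcB _ _) _; lra.
have hI2 : complex.Im (a - b) = 2 * (M + 1) * n%:~R.
  apply: (@mulIf _ (pi / (M + 1))); first by rewrite gt_eqF // divr_gt0 // ltr_wpDl.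
  rewrite hI; field; rewrite gt_eqF //; lra.
suff n0 : n = 0.
  apply/eqP; rewrite -subr_eq0; apply/eqP; apply: eqC => //=.
  by rewrite hI2 n0 mulr0.
apply/eqP; rewrite -absz_eq0; apply/negPn/negP; rewrite -lt0n => n1.
move: nI; rewrite hI2 normrM ger0_norm; last by lra.
have : (1 : R) <= `|n%:~R| by rewrite -intr_norm -[1]/(1%:~R) ler_int; lia.
move=> h1 h2.
have : 2 * (M + 1) <= 2 * (M + 1) * `|n%:~R : R| by rewrite ler_peMr //; lra.
lra.
Qed.

(** Asymptotic expansions in [z] and [log z] along [log z = l0 + sg t]: as [z] tends to
    infinity if [sg = 1] and to 0 if [sg = - 1]. The remainder is controlled at every
    order [K]. *)
Definition asym (sg : R) (l0 : C) (g : R -> C) (c : C * nat -> C) :=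
  forall K : R, exists s : seq (C * nat), [/\ uniq s,
    forall e, c e != 0 -> - K < sg * complex.Re e.1 -> e \in s
    & exists M : R, forall t, 1 <= t ->
        normc (g t - \sum_(e <- s) c e * expo (l0 + (sg * t)%:C%C) e) <=
        M * expR (- (K * t))].

Lemma sum_pred1_seq (I : eqType) (V : nmodType) (s : seq I) i (x : V) : uniq s -> i \in s ->
  \sum_(j <- s | j == i) x = x.
Proof.
by move=> us is_; rewrite -big_filter filter_pred1_uniq // big_seq1.
Qed.

Lemma asym_fin sg l0 (c : C * nat -> C) (s : seq (C * nat)) :
  uniq s -> (forall e, c e != 0 -> e \in s) ->
  asym sg l0 (fun t => \sum_(e <- s) c e * expo (l0 + (sg * t)%:C%C) e) c.
Proof.
move=> us hs K; exists s; split => //; first by move=> e /hs.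
by exists 0 => t _; rewrite subrr Normc.normc0 mul0r.
Qed.

Lemma asym_eq sg l0 g g' c : (forall t, 1 <= t -> g t = g' t) ->
  asym sg l0 g c -> asym sg l0 g' c.
Proof.
move=> h hg K; have [s [us hs [M hM]]] := hg K; exists s; split => //.
by exists M => t t1; rewrite -h //; exact: hM.
Qed.

(** Terms of order beyond [K] can be added to the partial sum at will, once the
    remainder is controlled at order [K + 1]: the powers of [l] are absorbed. *)
Lemma asym_super sg l0 g c : asym sg l0 g c -> forall K : R,
  exists s : seq (C * nat), [/\ uniq s,
    forall e, c e != 0 -> - K < sg * complex.Re e.1 -> e \in s
    & forall s', uniq s' -> {subset s <= s'} -> exists M : R, forall t, 1 <= t ->
        normc (g t - \sum_(e <- s') c e * expo (l0 + (sg * t)%:C%C) e) <=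
        M * expR (- (K * t))].
Proof.
move=> hg K; have [s [us hs [M hM]]] := hg (K + 1); exists s; split => //.
  by move=> e e0 he; apply: hs => //; lra.
move=> s' us' ss'.
have [B hB] : exists B : C * nat -> R, forall e, e \in s' -> e \notin s ->
    forall t, 1 <= t ->
    normc (c e * expo (l0 + (sg * t)%:C%C) e) <= B e * expR (- (K * t)).
  have H e : exists B : R, e \in s' -> e \notin s -> forall t, 1 <= t ->
      normc (c e * expo (l0 + (sg * t)%:C%C) e) <= B * expR (- (K * t)).
    have [c0|c0] := eqVneq (c e) 0.
      by exists 0 => _ _ t _; rewrite c0 !mul0r Normc.normc0.
    have [eK|eK] := ltrP (- (K + 1)) (sg * complex.Re e.1).
      by exists 0 => _; rewrite (hs e c0 eK).
    have [|B B0 hB] := @expo_small sg l0 e K; first by lra.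
    exists (normc (c e) * B) => _ _ t t1.
    rewrite Normc.normcM -mulrA; apply: ler_wpM2l; first exact: normc_ge0.
    by apply: hB; lra.
  by have [B hB] := choice H; exists B.
exists (M + \sum_(e <- s' | e \notin s) B e) => t t1.
have -> : \sum_(e <- s') c e * expo (l0 + (sg * t)%:C%C) e =
    \sum_(e <- s) c e * expo (l0 + (sg * t)%:C%C) e +
    \sum_(e <- s' | e \notin s) c e * expo (l0 + (sg * t)%:C%C) e.
  rewrite (bigID [in s]) /=; congr (_ + _); rewrite -big_filter; apply: perm_big.
  apply: uniq_perm => //; first exact: filter_uniq.
  by move=> i; rewrite mem_filter; apply/andP/idP => [[]//|h]; split => //; apply: ss'.
rewrite opprD addrA mulrDl; apply: le_trans (ler_normcB _ _) _; apply: lerD.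
  apply: le_trans (hM t t1) _.
  have M0 : 0 <= M.
    have := le_trans (normc_ge0 _) (hM 1 (lexx _)).
    by rewrite pmulr_lge0 // expR_gt0.
  by apply: ler_wpM2l => //; rewrite ler_expR; lra.
rewrite -big_filter; apply: le_trans (ler_normc_sum _ _) _.
rewrite mulr_suml -[X in _ <= X]big_filter !big_seq; apply: ler_sum => e.
by rewrite mem_filter => /andP[h1 h2]; exact: hB.
Qed.

Lemma asymB sg l0 g g' c c' : asym sg l0 g c -> asym sg l0 g' c' ->
  asym sg l0 (fun t => g t - g' t) (fun e => c e - c' e).
Proof.
move=> hg hg' K.
have [s [us hs h]] := asym_super hg K; have [s' [us' hs' h']] := asym_super hg' K.
have uss : uniq (undup (s ++ s')) by exact: undup_uniq.
have sub1 : {subset s <= undup (s ++ s')} by move=> e he; rewrite mem_undup mem_cat he.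
have sub2 : {subset s' <= undup (s ++ s')} by move=> e he; rewrite mem_undup mem_cat he orbT.
have [M hM] := h _ uss sub1; have [M' hM'] := h' _ uss sub2.
exists (undup (s ++ s')); split => //.
  move=> e; have [c0|c0] := eqVneq (c e) 0.
    by rewrite c0 sub0r oppr_eq0 => c'0 eK; apply/sub2/hs'.
  by move=> _ eK; apply/sub1/hs.
exists (M + M') => t t1; rewrite mulrDl.
under eq_bigr => e _ do rewrite mulrBl.
rewrite sumrB.
rewrite (_ : _ + _ = (g t - \sum_(e <- undup (s ++ s')) c e * expo (l0 + (sg * t)%:C%C) e) -
  (g' t - \sum_(e <- undup (s ++ s')) c' e * expo (l0 + (sg * t)%:C%C) e)); last by ring.
by apply: le_trans (ler_normcB _ _) _; apply: lerD; [exact: hM|exact: hM'].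
Qed.

(** Products with [z] and with [z - 1], on expansions. *)
Definition mulze (c : C * nat -> C) : C * nat -> C := fun e => c (e.1 - 1, e.2).
Definition mulzB1e (c : C * nat -> C) : C * nat -> C := fun e => mulze c e - c e.

Lemma expo_shift l e : expo l (e.1 + 1, e.2) = cexp l * expo l e.
Proof. by rewrite /expo /= mulrDl mul1r cexpD; ring. Qed.

Lemma asym_mulze sg l0 g c : asym sg l0 g c ->
  asym sg l0 (fun t => cexp (l0 + (sg * t)%:C%C) * g t) (mulze c).
Proof.
move=> hg K; have [s [us hs [M hM]]] := hg (K + sg).
pose f (e : C * nat) := (e.1 + 1, e.2).
exists (map f s); split.
- by rewrite map_inj_uniq // => -[a k] [b j] [/addIr -> ->].
- move=> e ce eK; apply/mapP; exists (e.1 - 1, e.2); last first.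
    by rewrite /f /= subrK -surjective_pairing.
  apply: hs => //=; rewrite ReD ReN -[1]/(1%:R) Re_nat; lra.
- exists (expR (complex.Re l0) * M) => t t1; rewrite big_map.
  under eq_bigr => e _ do rewrite /mulze /f /= addrK -surjective_pairing
    expo_shift mulrCA.
  rewrite -mulr_sumr -mulrBr Normc.normcM normc_cexp ReD expRD -!mulrA.
  apply: ler_wpM2l; first exact: expR_ge0.
  apply: le_trans (ler_wpM2l (expR_ge0 _) (hM t t1)) _.
  rewrite mulrCA -expRD le_eqVlt; apply/orP; left; apply/eqP; congr (_ * expR _) => /=.
  ring.
Qed.

Lemma asym_mulzB1 sg l0 g c n : asym sg l0 g c ->
  asym sg l0 (fun t => (cexp (l0 + (sg * t)%:C%C) - 1) ^+ n * g t) (iter n mulzB1e c).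
Proof.
elim: n => [|n IH] hg; first by apply: asym_eq hg => t _; rewrite mul1r.
have {}IH := IH hg; have := asymB (asym_mulze IH) IH.
by apply: asym_eq => t _; rewrite exprS; ring.
Qed.

(** On the sample points [t = h n], an expansion of 0 turns, after rescaling by
    its largest term, into a linear relation between generalized exponential
    sequences up to a sequence tending to 0; these are independent
    ([expseq_indep]). *)
Lemma asym_zero_unique sg l0 c : sg != 0 -> asym sg l0 (fun=> 0) c -> c = fun=> 0.
Proof.
move=> sg0 hg; apply/funext => e0; apply/eqP/negPn/negP => ce0.
pose K := - (sg * complex.Re e0.1).
have [s [us hs [M hM]]] := hg (K + 1).
have e0s : e0 \in s by apply: hs => //; rewrite /K; lra.
pose p (e : C * nat) := - K <= sg * complex.Re e.1.
pose s1 := [seq e <- s | p e].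
have [h h0 hinj] := exists_sep_step [seq e.1 * sg%:C%C | e <- s1].
pose lam (b : C) := cexp ((b * sg%:C%C + K%:C%C) * h%:C%C).
have lam_inj e e' : e \in s1 -> e' \in s1 -> lam e.1 = lam e'.1 -> e.1 = e'.1.
  move=> es es'; rewrite /lam !mulrDl !cexpD => /(mulIf (cexp_neq0 _)) he.
  have sC : (sg%:C%C : C) != 0 by rewrite eq_complex /= negb_and sg0.
  apply: (mulIf sC); apply: hinj he; exact: map_f.
have e0s1 : e0 \in s1 by rewrite mem_filter /p e0s andbT /K opprK.
pose q : {poly C} := l0%:P + (sg * h)%:C%C *: 'X.
pose P l := \sum_(e <- s1 | lam e.1 == l) (c e * cexp (e.1 * l0)) *: q ^+ e.2.
pose S := undup [seq lam e.1 | e <- s1].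
pose E n (e : C * nat) : C :=
  (expR (K * (h * n%:R)))%:C%C * (c e * expo (l0 + (sg * (h * n%:R))%:C%C) e).
have EE n e : E n e = ((c e * cexp (e.1 * l0)) *: q ^+ e.2).[n%:R] * lam e.1 ^+ n.
  rewrite /E /expo /lam /q hornerZ horner_exp hornerD hornerC hornerZ hornerX -cexpMn -!cexp_real.
  rewrite [e.1 * (l0 + _)]mulrDr cexpD.
  have -> : (e.1 * sg%:C%C + K%:C%C) * h%:C%C * n%:R =
      e.1 * (sg * (h * n%:R))%:C%C + (K * (h * n%:R))%:C%C.
    rewrite !rmorphM /= rmorph_nat; ring.
  have -> : (sg * h)%:C%C * n%:R = (sg * (h * n%:R))%:C%C :> C.
    rewrite !rmorphM /= rmorph_nat; ring.
  rewrite cexpD; ring.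
have hP : forall l, l \in S -> P l = 0.
  apply: expseq_indep; first exact: undup_uniq.
    move=> l; rewrite mem_undup => /mapP[e]; rewrite mem_filter => /andP[pe _] ->.
    rewrite /lam normc_cexp -expR0 ler_expR ReM_real ReD ReM_real /=.
    apply: mulr_ge0; last exact: ltW.
    by move: pe; rewrite /p; lra.
  have -> : (fun n => \sum_(l <- S) (P l).[n%:R] * l ^+ n) =
      (fun n => \sum_(e <- s) E n e - \sum_(e <- s | ~~ p e) E n e).
    apply/funext => n; rewrite (bigID p) /= addrK -[RHS]big_filter -/s1.
    under [RHS]eq_bigr => e _ do rewrite EE.
    rewrite (eq_bigr (fun l => \sum_(e <- s1 | lam e.1 == l)
       ((c e * cexp (e.1 * l0)) *: q ^+ e.2).[n%:R] * lam e.1 ^+ n)); last first.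
      move=> l _; rewrite horner_sum mulr_suml; apply: eq_bigr => e /eqP -> //.
    rewrite (exchange_big_dep predT) //= !big_seq; apply: eq_bigr => e es.
    under eq_bigl => l do rewrite eq_sym.
    by rewrite sum_pred1_seq ?undup_uniq // mem_undup (map_f (fun e => lam e.1)).
  apply: tends0B.
    apply: (@tends0_le _ (fun n => M%:C%C * (expR (- (h * n%:R)))%:C%C)); last first.
      exact/tends0Z/tends0_expR.
    exists (Num.truncn h^-1).+1 => n hn; rewrite -mulr_sumr.
    have t1 : 1 <= h * n%:R.
      rewrite mulrC -ler_pdivrMr // div1r; apply: ltW.
      by apply: lt_le_trans (truncnS_gt _) _; rewrite ler_nat.
    have := hM _ t1; rewrite sub0r normcN => hb.
    rewrite !Normc.normcM !normc_real !(ger0_norm (expR_ge0 _)).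
    apply: le_trans (ler_wpM2l (expR_ge0 _) hb) _.
    rewrite mulrCA -expRD (_ : K * _ - _ = - (h * n%:R)); last by ring.
    by apply: ler_wpM2r; rewrite ?expR_ge0 ?ler_norm.
  rewrite (_ : (fun n => _) = fun n => \sum_(e <- [seq e <- s | ~~ p e])
      (if p e then 0 else E n e)); last first.
    apply/funext => n; rewrite -big_filter !big_seq; apply: eq_bigr => e.
    by rewrite mem_filter => /andP[/negbTE ->].
  apply: (@tends0_sum _ _ (fun e n => if p e then 0 else E n e)) => e.
  have [pe|pe] := boolP (p e); first exact: tends0_0.
  set d := (- K - sg * complex.Re e.1) / 2.
  have d0 : 0 < d by move: pe; rewrite /p -ltNge /d; lra.
  have [|B B0 hB] := @expo_small sg l0 e (K + d); first by rewrite /d; move: d0; rewrite /d; lra.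
  apply: (@tends0_le _ (fun n => (c e * B%:C%C) * (expR (- (d * h * n%:R)))%:C%C)); last first.
    by apply/tends0Z/tends0_expR; rewrite mulr_gt0.
  exists 0%N => n _; have t0 : 0 <= h * n%:R by rewrite mulr_ge0 // ltW.
  rewrite /E (Normc.normcM _%:C%C) (Normc.normcM (c e) (expo _ _)) (Normc.normcM (c e * _)).
  rewrite (Normc.normcM (c e) B%:C%C) !normc_real !(ger0_norm (expR_ge0 _)) (ger0_norm B0).
  rewrite mulrCA -mulrA; apply: ler_wpM2l; first exact: normc_ge0.
  apply: le_trans (ler_wpM2l (expR_ge0 _) (hB _ t0)) _.
  by rewrite mulrCA -expRD (_ : K * _ - _ = - (d * h * n%:R)) //; ring.
have := hP (lam e0.1); rewrite mem_undup (map_f (fun e => lam e.1)) // => /(_ isT) hP0.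
pose r : {poly C} := ((sg * h)%:C%C)^-1 *: ('X - l0%:P).
have sh0 : ((sg * h)%:C%C : C) != 0.
  by rewrite eq_complex /= negb_and mulf_neq0 // gt_eqF.
have qr : q \Po r = 'X.
  rewrite /q comp_polyD comp_polyC comp_polyZ comp_polyX /r scalerA divff //.
  by rewrite scale1r addrC subrK.
have : (P (lam e0.1) \Po r)`_e0.2 = 0 by rewrite hP0 comp_poly0 coef0.
rewrite /P [_ \Po r]linear_sum coef_sum /=.
rewrite (eq_bigr (fun e => c e * cexp (e.1 * l0) * (e0.2 == e.2)%:R)); last first.
  by move=> e _; rewrite comp_polyZ coefZ rmorphXn /= qr coefXn.
have us1 : uniq s1 by exact: filter_uniq.
rewrite big_mkcond (bigD1_seq e0) //= !eqxx mulr1 big_seq_cond big1 ?addr0.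
  by apply/eqP; rewrite mulf_neq0 // cexp_neq0.
move=> e /andP[es ne]; case: eqP => // hl; have h1 := lam_inj _ _ es e0s1 hl.
case: eqP => [h2|_]; last by rewrite mulr0.
by move: ne; rewrite [e]surjective_pairing h1 -h2 -surjective_pairing eqxx.
Qed.

Lemma asym_unique sg l0 g c c' : sg != 0 ->
  asym sg l0 g c -> asym sg l0 g c' -> c = c'.
Proof.
move=> sg0 h h'; have := asymB h h'.
move=> /(@asym_eq _ _ _ (fun=> 0) _ (fun t _ => subrr (g t))) /(asym_zero_unique sg0) h0.
by apply/funext => e; apply/eqP; rewrite -subr_eq0; apply/eqP; rewrite -[RHS](congr1 (@^~ e) h0).
Qed.

End Asymptotics.

(** * Absolutely convergent sums and their asymptotic expansions *)

Lemma fsum_seq (V : nmodType) (I : choiceType) (A : set I) (r : seq I) (f : I -> V) :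
  uniq r -> (forall i, i \in r -> A i) -> (forall i, A i -> f i != 0 -> i \in r) ->
  \sum_(i \in A) f i = \sum_(i <- r) f i.
Proof.
move=> ur rA Ar; rewrite (@fsbigE _ _ _ _ A r) //; last first.
  by move=> i Ai; apply: contraNeq; exact: Ar.
rewrite big_seq_cond [RHS]big_seq; apply: eq_bigl => i.
by apply/andP/idP => [[]//|ir]; split => //; apply/mem_set/rA.
Qed.

Section AbsSums.
Variable R : realType.
Local Notation C := R[i].
Local Notation normc := (@Normc.normc R).
Variable I : choiceType.
Implicit Types (f : I -> C) (s : C).

Lemma abs_sum_bound f s : has_abs_sum f s ->
  exists2 M : R, 0 <= M & forall F : seq I, uniq F -> \sum_(i <- F) normc (f i) <= M.
Proof.
move=> [hs _]; set S := (\esum_(i in [set: I]) `|(complex.Re `|f i|)%:E|)%E in hs.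
have hS : S \is a fin_num by rewrite -summableE.
have ub F : uniq F -> ((\sum_(i <- F) normc (f i))%:E <= S)%E.
  move=> uF; apply: esum_ge; exists [set` F]; first by split => //; exact: finite_seq.
  rewrite -fsbig_seq // -sumEFin; apply: lee_sum => i _.
  by rewrite normcE /= lee_fin ler_norm.
exists (fine S); last by move=> F uF; rewrite -lee_fin fineK // ub.
by rewrite -lee_fin fineK //; have := ub [::] isT; rewrite big_nil.
Qed.

(** The finite partial sums may be tested beyond any finite set that contains [F]. *)
Lemma abs_sum_dist f s (F : seq I) (B : R) : has_abs_sum f s -> uniq F ->
  (forall G, uniq G -> (forall i, i \in G -> i \notin F) -> \sum_(i <- G) normc (f i) <= B) ->
  normc (s - \sum_(i <- F) f i) <= B.
Proof.
move=> [_ hc] uF hB; apply/ler_addgt0Pr => e e0.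
have e0C : (0 : C) < e%:C%C by rewrite ltcR.
have FF := @filter_filter _ _ (@summability.totally_filter I).
have [A _ hA] := @cvgr_dist_lt _ R[i]^o _ _ FF _ _ hc _ e0C.
have /hA /= : [set B | (A `<=` B)%fset] (A `|` [fset i in F])%fset by exact: fsubsetUl.
set G := (A `|` _)%fset => hG.
have FG : {subset F <= G} by move=> i iF; rewrite in_fsetU !inE iF orbT.
have pE : summability.partial_sum f G =
    \sum_(i <- F) f i + \sum_(i <- G | i \notin F) f i :> C.
  transitivity (\sum_(i <- G) f i); first by rewrite big_seq_fsetE.
  rewrite [LHS](bigID [in F]) /=; congr (_ + _).
  rewrite -big_filter; apply: perm_big; apply: uniq_perm => //.
    by apply: filter_uniq; exact: fset_uniq.
  by move=> i; rewrite mem_filter; apply/andP/idP => [[]//|iF]; split => //; apply: FG.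
have -> : s - \sum_(i <- F) f i =
   (s - summability.partial_sum f G) + \sum_(i <- G | i \notin F) f i.
  rewrite pE; ring.
apply: le_trans (le_normcD _ _) _; rewrite addrC; apply: lerD; last first.
  by move: hG; rewrite normcE ltcR => /ltW.
rewrite -big_filter; apply: le_trans (ler_normc_sum _ _) _; apply: hB.
  by apply: filter_uniq; exact: fset_uniq.
by move=> i; rewrite mem_filter => /andP[].
Qed.

(** The absolute sums of [f0] bound those of [f] outside [F], uniformly in [f] and
    [rho]. *)
Lemma abs_sum_tail f0 s0 : has_abs_sum f0 s0 -> exists2 M : R, 0 <= M &
  forall f s (rho : R) (F : seq I), has_abs_sum f s -> 0 <= rho -> uniq F ->
    (forall i, i \notin F -> normc (f i) <= rho * normc (f0 i)) ->
    normc (s - \sum_(i <- F) f i) <= rho * M.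
Proof.
move=> /abs_sum_bound[M M0 hM]; exists M => // f s rho F hf rho0 uF hdom.
apply: abs_sum_dist => // G uG hG.
apply: le_trans (ler_wpM2l rho0 (hM G uG)).
by rewrite mulr_sumr !big_seq; apply: ler_sum => i /hG; exact: hdom.
Qed.

Lemma sum_fibers (J : choiceType) (h : I -> J) (F : seq I) (G : seq J)
    (a : I -> C) (b : J -> C) :
  uniq F -> uniq G -> (forall i, a i != 0 -> h i \in G -> i \in F) ->
  (forall i, i \in F -> h i \in G) ->
  \sum_(i <- F) a i * b (h i) =
  \sum_(j <- G) (\sum_(i \in [set i | h i = j]) a i) * b j.
Proof.
move=> uF uG hF hG.
rewrite [RHS]big_seq (eq_bigr (fun j => \sum_(i <- F | h i == j) a i * b (h i))).
  rewrite -big_seq (exchange_big_dep predT) //= !big_seq.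
  apply: eq_bigr => i iF; under eq_bigl => j do rewrite eq_sym.
  by rewrite sum_pred1_seq // hG.
move=> j jG; rewrite (@fsum_seq _ _ _ [seq i <- F | h i == j]).
- by rewrite big_filter mulr_suml; apply: eq_bigr => i /eqP ->.
- exact: filter_uniq.
- by move=> i; rewrite mem_filter => /andP[/eqP].
- by move=> i /= hi ai; rewrite mem_filter hi eqxx /= hF // hi.
Qed.

(** The terms of order more than [K] are dominated at [t] by [e ^ (- K (t - 1))]
    times their values at [t = 1], up to powers of [l]. *)
Lemma asym_of_sum (sg : R) (l0 : C) (g : R -> C) (a : I -> C) (e : I -> C * nat)
    (kmax : nat) :
  `|sg| = 1 -> complex.Re l0 = 0 ->
  (forall t, 1 <= t -> has_abs_sum (fun i => a i * expo (l0 + (sg * t)%:C%C) (e i)) (g t)) ->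
  (forall i, a i != 0 -> ((e i).2 <= kmax)%N) ->
  (forall K : R, exists2 F : seq I, uniq F &
      forall i, a i != 0 -> - K < sg * complex.Re (e i).1 -> i \in F) ->
  asym sg l0 g (fun e0 => \sum_(i \in [set i | e i = e0]) a i).
Proof.
move=> sg1 hl0 hs hk hfin K.
have [F0 uF0 hF0] := hfin (K + 1).
pose F := [seq i <- F0 | (a i != 0) && (- (K + 1) < sg * complex.Re (e i).1)].
have uF : uniq F by exact: filter_uniq.
have hF i : (i \in F) = (a i != 0) && (- (K + 1) < sg * complex.Re (e i).1).
  by rewrite mem_filter; apply/andP/idP => [[]//|/[dup] /andP[h1 h2] ->]; split => //; apply: hF0.
pose G := undup (map e F).
have hG (x : C * nat) : (x \in G) -> - (K + 1) < sg * complex.Re x.1.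
  by rewrite mem_undup => /mapP[j]; rewrite hF => /andP[_ h] ->.
exists G; split; first exact: undup_uniq.
  move=> x cx xK; have [i hi ai] : exists2 i, e i = x & a i != 0.
    case: (pselect (exists2 i, e i = x & a i != 0)) => // hn; move: cx.
    rewrite fsbig1 ?eqxx // => j hj; apply/eqP/negPn/negP => aj.
    by apply: hn; exists j.
  by rewrite mem_undup -hi map_f // hF ai hi /=; lra.
have nl t : 1 <= t -> 1 <= normc (l0 + (sg * t)%:C%C).
  move=> t1; apply: le_trans (ler_Re_normc _).
  by rewrite ReD hl0 add0r /= normrM sg1 mul1r ger0_norm //; lra.
have [M M0 hM] := abs_sum_tail (hs 1 (lexx _)).
have [B hB] := expR_decay kmax (ltr01 : 0 < (1 : R)).
exists (expR (K + 1) * (expR (normc l0) * B) * M) => t t1.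
pose rho := expR (- ((K + 1) * (t - 1))) * normc (l0 + (sg * t)%:C%C) ^+ kmax.
have rho0 : 0 <= rho by rewrite mulr_ge0 ?expR_ge0 ?exprn_ge0 ?normc_ge0.
have hdom i : i \notin F -> normc (a i * expo (l0 + (sg * t)%:C%C) (e i)) <=
    rho * normc (a i * expo (l0 + (sg * 1)%:C%C) (e i)).
  have [->|ai] := eqVneq (a i) 0; first by rewrite !mul0r Normc.normc0 mulr0.
  rewrite hF ai /= -leNgt => iK.
  rewrite !(Normc.normcM (a i)) [leRHS]mulrCA; apply: ler_wpM2l; first exact: normc_ge0.
  rewrite !normc_expo /rho mulrACA; apply: ler_pM.
  - exact: expR_ge0.
  - by rewrite exprn_ge0 // normc_ge0.
  - rewrite -expRD ler_expR !mulrDr !ReD !ReM_real.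
    have : (sg * complex.Re (e i).1) * (t - 1) <= - (K + 1) * (t - 1).
      by apply: ler_wpM2r => //; lra.
    lra.
  - rewrite -[leLHS]mulr1; apply: ler_pM => //.
    + by rewrite exprn_ge0 // normc_ge0.
    + by rewrite ler_weXn2l ?nl ?hk.
    + by rewrite exprn_ege1 // nl.
have := hM _ _ _ _ (hs t t1) rho0 uF hdom.
rewrite (@sum_fibers _ e F G) //; first last.
- by move=> i iF; rewrite mem_undup map_f.
- by move=> i ai; rewrite hF ai => /hG.
- exact: undup_uniq.
move=> h; apply: le_trans h _; rewrite [leRHS]mulrAC; apply: ler_wpM2r => //.
have t0 : 0 <= normc l0 + t by rewrite addr_ge0 ?normc_ge0 //; lra.
have h1 : normc (l0 + (sg * t)%:C%C) ^+ kmax <= (normc l0 + t) ^+ kmax.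
  rewrite lerXn2r ?nnegrE ?normc_ge0 //; apply: le_trans (le_normcD _ _) _.
  by rewrite lerD2l normc_real normrM sg1 mul1r ger0_norm //; lra.
have h2 := hB _ t0.
rewrite /rho (_ : - ((K + 1) * (t - 1)) = (K + 1) + normc l0 + - (K * t) + - (1 * (normc l0 + t)));
  last by ring.
rewrite expRD [expR (K + 1 + _ + _)]expRD [expR (K + 1 + _)]expRD.
rewrite (_ : _ * _ = expR (K + 1) * expR (normc l0) * expR (- (K * t)) *
  (normc (l0 + (sg * t)%:C%C) ^+ kmax * expR (- (1 * (normc l0 + t))))); last by ring.
rewrite (_ : expR (K + 1) * (expR (normc l0) * B) * expR (- (K * t)) =
  expR (K + 1) * expR (normc l0) * expR (- (K * t)) * B); last by ring.
apply: ler_wpM2l; first by rewrite !mulr_ge0 ?expR_ge0.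
apply: le_trans h2; apply: ler_wpM2r => //; exact: expR_ge0.
Qed.

End AbsSums.

(** * Expansions at 0 *)

Section AsymptoticsAt0.
Variable R : realType.
Local Notation C := R[i].
Local Notation normc := (@Normc.normc R).
Implicit Types (g : R -> C) (c d : nat -> C) (x : R).

(** Expansions in powers of [x > 0] at 0. The bound [1 / 2] keeps [1 + x] inside the disc
    of radius 1 about 1, where the iterates converge. *)
Definition asym0_at (K : nat) g c := exists M : R, forall x, 0 < x <= 2^-1 ->
  normc (g x - \sum_(k < K) c k * x%:C%C ^+ k) <= M * x ^+ K.

Definition asym0 g c := forall K, asym0_at K g c.

Lemma asym0_atD K g g' c c' : asym0_at K g c -> asym0_at K g' c' ->
  asym0_at K (fun x => g x + g' x) (fun k => c k + c' k).
Proof.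
move=> [M hM] [M' hM']; exists (M + M') => x hx; rewrite mulrDl.
under eq_bigr => k _ do rewrite mulrDl.
rewrite big_split /= opprD addrACA; apply: le_trans (le_normcD _ _) _.
by apply: lerD; [exact: hM|exact: hM'].
Qed.

Lemma asym0_atZ K g c a : asym0_at K g c -> asym0_at K (fun x => a * g x) (fun k => a * c k).
Proof.
move=> [M hM]; exists (normc a * M) => x hx.
under eq_bigr => k _ do rewrite -mulrA.
rewrite -mulr_sumr -mulrBr Normc.normcM -mulrA.
by apply: ler_wpM2l; [exact: normc_ge0|exact: hM].
Qed.

Lemma asym0_at_eq K g g' c c' : (forall x, 0 < x <= 2^-1 -> g x = g' x) ->
  (forall k, c k = c' k) -> asym0_at K g c -> asym0_at K g' c'.
Proof.
move=> h h' [M hM]; exists M => x hx; rewrite -h //.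
by under eq_bigr => k _ do rewrite -h'; exact: hM.
Qed.

Lemma asym0_poly (p : {poly C}) : asym0 (fun x => p.[x%:C%C]) (fun k => p`_k).
Proof.
move=> K; exists (\sum_(i < size p) normc p`_i) => x /andP[x0 x1].
rewrite horner_coef.
have -> : \sum_(k < K) p`_k * x%:C%C ^+ k = \sum_(i < size p | (i < K)%N) p`_i * x%:C%C ^+ i.
  rewrite -(big_mkord (fun=> true) (fun k => p`_k * x%:C%C ^+ k)).
  rewrite -(big_mkord (fun k => (k < K)%N) (fun k => p`_k * x%:C%C ^+ k)).
  rewrite [LHS](big_nat_widen _ _ (maxn K (size p))) ?leq_maxl //=.
  rewrite [RHS](big_nat_widen _ _ (maxn K (size p))) ?leq_maxr //=.
  rewrite [LHS](bigID (fun k => k < size p)%N) /= [X in _ + X]big1 ?addr0; last first.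
    by move=> k /andP[_]; rewrite -leqNgt => hk; rewrite nth_default ?mul0r.
  by apply: eq_bigl => k; rewrite andbC.
rewrite [X in X - _](bigID (fun i : 'I__ => (i < K)%N)) /= addrAC subrr add0r.
rewrite mulr_suml [leRHS](bigID (fun i : 'I__ => (i < K)%N)) /=.
rewrite -[leLHS]add0r; apply: lerD.
  by apply: sumr_ge0 => i _; rewrite mulr_ge0 ?normc_ge0 // exprn_ge0 // ltW.
rewrite -!(big_filter _ (fun i : 'I__ => ~~ (i < K)%N)).
apply: le_trans (ler_normc_sum _ _) _; rewrite !big_filter; apply: ler_sum => i.
rewrite -leqNgt => hi; rewrite Normc.normcM normcX normc_real gtr0_norm //.
apply: ler_wpM2l; first exact: normc_ge0.
by apply: ler_wiXn2l => //; lra.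
Qed.

Lemma asym0_at_bounded K g c : asym0_at K g c ->
  exists2 M : R, 0 <= M & forall x, 0 < x <= 2^-1 -> normc (g x) <= M.
Proof.
move=> [M hM]; exists (`|M| + \sum_(k < K) normc (c k)).
  by rewrite addr_ge0 // sumr_ge0 // => k _; exact: normc_ge0.
move=> x /[dup] hx /andP[x0 x1].
rewrite -[g x](subrK (\sum_(k < K) c k * x%:C%C ^+ k)).
have x1' : x <= 1 by lra.
apply: le_trans (le_normcD _ _) _; apply: lerD.
  apply: le_trans (hM x hx) _; apply: le_trans (_ : `|M| * x ^+ K <= _).
    by apply: ler_wpM2r; [exact/exprn_ge0/ltW|exact: ler_norm].
  by rewrite ler_piMr // exprn_ile1 // ltW.
apply: le_trans (ler_normc_sum _ _) _; apply: ler_sum => k _.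
rewrite Normc.normcM normcX normc_real gtr0_norm // ler_piMr ?normc_ge0 //.
by rewrite exprn_ile1 // ltW.
Qed.

Definition cauchy c d : nat -> C := fun k => \sum_(i < k.+1) c i * d (k - i)%N.

(** Both factors are replaced by polynomials, up to remainders of order [K]. *)
Lemma asym0M g g' c c' : asym0 g c -> asym0 g' c' ->
  asym0 (fun x => g x * g' x) (cauchy c c').
Proof.
move=> hg hg' K; have [M hM] := hg K; have [M' hM'] := hg' K.
have [B B0 hB] := asym0_at_bounded (hg' 0%N).
pose P := \poly_(k < K) c k; pose Q := \poly_(k < K) c' k.
have [A A0 hA] := asym0_at_bounded (asym0_poly P 0).
have [D hD] := asym0_poly (P * Q) K.
exists (`|M| * B + A * `|M'| + D) => x /[dup] hx /andP[x0 x1].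
have PE (a : nat -> C) : (\poly_(k < K) a k).[x%:C%C] = \sum_(k < K) a k * x%:C%C ^+ k.
  by rewrite poly_def horner_sum; apply: eq_bigr => k _; rewrite hornerZ hornerXn.
have -> : \sum_(k < K) cauchy c c' k * x%:C%C ^+ k =
    \sum_(k < K) (P * Q)`_k * x%:C%C ^+ k.
  apply: eq_bigr => k _; congr (_ * _); rewrite coefM; apply: eq_bigr => i _.
  rewrite !coef_poly (leq_ltn_trans (leq_subr _ _) (ltn_ord k)).
  by rewrite (leq_ltn_trans _ (ltn_ord k)) // -ltnS ltn_ord.
have -> : g x * g' x - \sum_(k < K) (P * Q)`_k * x%:C%C ^+ k =
  (g x - P.[x%:C%C]) * g' x + P.[x%:C%C] * (g' x - Q.[x%:C%C]) +
  ((P * Q).[x%:C%C] - \sum_(k < K) (P * Q)`_k * x%:C%C ^+ k).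
  rewrite hornerM; ring.
rewrite (_ : (_ + _) * x ^+ K = `|M| * B * x ^+ K + A * `|M'| * x ^+ K + D * x ^+ K);
  last by ring.
have xK : 0 <= x ^+ K by exact/exprn_ge0/ltW.
apply: le_trans (le_normcD _ _) _; apply: lerD; last exact: hD.
apply: le_trans (le_normcD _ _) _; apply: lerD; rewrite Normc.normcM.
  rewrite mulrAC; apply: ler_pM => //; rewrite ?normc_ge0 ?hB // PE.
  by apply: le_trans (hM x hx) _; apply: ler_wpM2r => //; exact: ler_norm.
rewrite -mulrA; apply: ler_pM => //; rewrite ?normc_ge0 ?hA // PE.
by apply: le_trans (hM' x hx) _; apply: ler_wpM2r => //; exact: ler_norm.
Qed.

(** The first nonzero coefficient would be bounded by a multiple of every small [x]. *)
Lemma asym0_eq0 c : asym0 (fun=> 0) c -> c = fun=> 0.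
Proof.
move=> h; apply/funext => k; have [n] := ubnP k; elim: n k => // n IH k; rewrite ltnS => kn.
have [M hM] := h k.+1; apply/eqP/negPn/negP => ck.
have c0 : 0 < normc (c k) by rewrite lt_neqAle normc_ge0 eq_sym normc_eq0 ck.
have hx x : 0 < x <= 2^-1 -> normc (c k) <= `|M| * x.
  move=> /[dup] hx /andP[x0 x1].
  have := hM x hx; rewrite sub0r normcN big_ord_recr /= big1 ?add0r; last first.
    by move=> i _; rewrite IH ?mul0r //; apply: leq_trans (ltn_ord i) kn.
  rewrite Normc.normcM normcX normc_real gtr0_norm // exprSr mulrA mulrAC.
  rewrite ler_pM2r ?exprn_gt0 // => /le_trans; apply.
  by apply: ler_wpM2r; [exact: ltW|exact: ler_norm].
pose x := Num.min (2^-1) (normc (c k) / (2 * (`|M| + 1))).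
have M1 : 0 < 2 * (`|M| + 1) by rewrite mulr_gt0 // ltr_wpDl.
have x0 : 0 < x by rewrite lt_min invr_gt0 ltr0n /= divr_gt0.
have := hx x; rewrite x0 ge_min lexx => /(_ isT).
have : x <= normc (c k) / (2 * (`|M| + 1)) by rewrite ge_min lexx orbT.
rewrite ler_pdivlMr // => h1 h2.
have : 0 <= `|M| * x by rewrite mulr_ge0 // ltW.
lra.
Qed.

Lemma asym0_unique g c c' : asym0 g c -> asym0 g c' -> c = c'.
Proof.
move=> h h'; have h0 : asym0 (fun=> 0) (fun k => c k + - 1 * c' k).
  move=> K; apply: asym0_at_eq (asym0_atD (h K) (asym0_atZ (-1) (h' K))) => //.
  by move=> x _; rewrite mulN1r subrr.
apply/funext => k; have := congr1 (@^~ k) (asym0_eq0 h0) => /= /eqP.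
by rewrite mulN1r subr_eq0 => /eqP.
Qed.

Definition cderiv g g' := forall x, - 1 < x ->
  is_derive x 1 (fun y => complex.Re (g y)) (complex.Re (g' x)) /\
  is_derive x 1 (fun y => complex.Im (g y)) (complex.Im (g' x)).

Definition cprim (c0 : C) d : nat -> C := fun k => if k is k'.+1 then d k' / k'.+1%:R else c0.

(** Expansions can be integrated term by term, by the mean value theorem. *)
Lemma asym0_prim K g g' d : cderiv g g' -> asym0_at K g' d ->
  asym0_at K.+1 g (cprim (g 0) d).
Proof.
move=> hg [M hM]; exists (2 * `|M|) => x /[dup] hx /andP[x0 x1].
have main (h h' : R -> R) :
    (forall y : R, - 1 < y -> is_derive y (1 : R) h (h' y)) -> h 0 = 0 ->
    (forall y, 0 < y <= 2^-1 -> `|h' y| <= `|M| * y ^+ K) -> `|h x| <= `|M| * x ^+ K.+1.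
  move=> dh h0 hb.
  have dh' (y : R) : y \in `]0, x[ -> is_derive y (1 : R) h (h' y).
    by rewrite in_itv /= => /andP[y0 _]; apply: dh; apply: lt_trans y0; rewrite ltrN10.
  have [|y yx] := MVT x0 dh'.
    apply: derivable_within_continuous => y; rewrite in_itv /= => /andP[y0 _].
    by have [] := dh y (lt_le_trans (ltrN10 R) y0).
  move: yx; rewrite in_itv /= h0 !subr0 => /andP[y0 yx] ->.
  rewrite normrM (gtr0_norm x0) exprSr mulrA; apply: ler_wpM2r; first exact: ltW.
  apply: le_trans (hb y _) _; first by apply/andP; split => //; lra.
  by apply: ler_wpM2l => //; rewrite lerXn2r // ?nnegrE; apply: ltW.
pose r (y : R) := g y - \sum_(k < K.+1) cprim (g 0) d k * y%:C%C ^+ k.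
pose r' (y : R) := g' y - \sum_(k < K) d k * y%:C%C ^+ k.
have hr' y : 0 < y <= 2^-1 -> normc (r' y) <= `|M| * y ^+ K.
  move=> /[dup] hy /andP[y0 _]; apply: le_trans (hM y hy) _.
  by apply: ler_wpM2r; [exact/exprn_ge0/ltW|exact: ler_norm].
have r0 : r 0 = 0.
  rewrite /r big_ord_recl /= expr0 mulr1 big1 ?addr0 ?subrr // => i _.
  by rewrite /bump /= add1n exprS mul0r mulr0.
have polyd (b : nat -> R) (b0 y : R) :
    let q := b0%:P + \sum_(k < K) (b k / k.+1%:R) *: 'X^(k.+1) in
    q.[y] = b0 + \sum_(k < K) b k / k.+1%:R * y ^+ k.+1 /\
    q^`().[y] = \sum_(k < K) b k * y ^+ k.
  move=> q; split.
    rewrite /q hornerD hornerC horner_sum; congr (_ + _).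
    by apply: eq_bigr => k _; rewrite hornerZ hornerXn.
  rewrite /q derivD derivC add0r raddf_sum horner_sum; apply: eq_bigr => k _.
  rewrite /= derivZ derivXn hornerZ hornerMn hornerXn -mulr_natr /=; field.
  by rewrite addrC natr1 pnatr_eq0.
have part (p : {additive C -> R}) :
    (forall (z : C) (y : R), p (z * y%:C%C) = p z * y) ->
    (forall y : R, - 1 < y -> is_derive y 1 (fun y => p (g y)) (p (g' y))) ->
    (forall z, `|p z| <= normc z) ->
    `|p (r x)| <= `|M| * x ^+ K.+1.
  move=> pM dp pn.
  have pMX (z : C) (y : R) k : p (z * y%:C%C ^+ k) = p z * y ^+ k.
    by rewrite -rmorphXn pM.
  have pdiv (z : C) (n : nat) : p (z / n.+1%:R) = p z / n.+1%:R.
    by rewrite natC -[(_%:C)%C^-1](fmorphV (real_complex R)) pM.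
  pose q := (p (g 0))%:P + \sum_(k < K) (p (d k) / k.+1%:R) *: 'X^(k.+1).
  have qE y : p (r y) = p (g y) - q.[y].
    have [-> _] := polyd (fun k => p (d k)) (p (g 0)) y.
    rewrite /r raddfB raddf_sum big_ord_recl /= expr0 mulr1; congr (_ - (_ + _)).
    by apply: eq_bigr => k _; rewrite /bump /= add1n pMX pdiv.
  have qE' y : p (r' y) = p (g' y) - q^`().[y].
    have [_ ->] := polyd (fun k => p (d k)) (p (g 0)) y.
    by rewrite /r' raddfB raddf_sum; congr (_ - _); apply: eq_bigr => k _; rewrite pMX.
  apply: (@main (fun y => p (r y)) (fun y => p (r' y))).
  - move=> y /dp hy; rewrite qE'.
    rewrite (_ : (fun y => _) = (fun y => p (g y)) - horner q); last first.
      by apply/funext => y'; rewrite qE.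
    exact: is_deriveB.
  - by rewrite r0 raddf0.
  - by move=> y hy; apply: le_trans (pn _) _; exact: hr'.
have rRe := part (@complex.Re R) (@ReM_real R) (fun y hy => (hg y hy).1) (@ler_Re_normc R).
have ler_Im z : `|complex.Im z| <= normc z.
  case: z => a b /=; rewrite -sqrtr_sqr ler_sqrt ?lerDr ?sqr_ge0 //.
  by rewrite addr_ge0 ?sqr_ge0.
have rIm := part (@complex.Im R) (@ImM_real R) (fun y hy => (hg y hy).2) ler_Im.
have : normc (r x) <= `|complex.Re (r x)| + `|complex.Im (r x)|.
  case: (r x) => a b /=; rewrite -(@ler_pXn2r _ 2) ?nnegrE ?sqrtr_ge0 ?addr_ge0 //.
  rewrite sqr_sqrtr ?addr_ge0 ?sqr_ge0 // sqrrD !real_normK ?num_real // lerD2r.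
  by rewrite lerDl mulrn_wge0 // mulr_ge0.
move/le_trans; apply.
by rewrite mulrDl mul1r mulrDl; apply: lerD.
Qed.

End AsymptoticsAt0.

Section Expansions.
Variable R : realType.
Local Notation C := R[i].
Local Notation normc := (@Normc.normc R).
Implicit Types (x : R) (a : C).

(** The coefficients of [log (1 + x)] and of its powers. *)
Definition logco (k : nat) : C := if k is k'.+1 then (-1) ^+ k' / k'.+1%:R else 0.
Definition logpow (r : nat) : nat -> C := iter r (cauchy logco) (fun k => (k == 0%N)%:R).

Definition ln1p x : C := (ln (1 + x))%:C%C.
Definition pow1p a x : C := cexp (a * ln1p x).

Lemma is_derive_ln1p x : - 1 < x ->
  is_derive x (1 : R) (fun y => ln (1 + y)) (1 + x)^-1.
Proof.
move=> x1; have x0 : 0 < 1 + x by lra.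
have h1 : is_derive x (1 : R) (cst (1 : R) + id) (0 + 1) by exact: is_deriveD.
have h := @is_derive1_comp R (@ln R) (cst (1 : R) + id) x _ _ (is_derive1_ln x0) h1.
by apply: is_derive_eq h _; rewrite add0r mulr1.
Qed.

Lemma cderiv_ln1p : cderiv ln1p (fun x => ((1 + x)^-1)%:C%C).
Proof. by move=> x /is_derive_ln1p h; split => //=; exact: is_derive_cst. Qed.

Lemma pow1pB1 a x : - 1 < x -> pow1p (a - 1) x = pow1p a x * ((1 + x)^-1)%:C%C.
Proof.
move=> x1; have x0 : 0 < 1 + x by lra.
by rewrite /pow1p mulrBl mul1r cexpD -rmorphN cexp_real expRN lnK.
Qed.

Lemma cderiv_pow1p a : cderiv (pow1p a) (fun x => a * pow1p (a - 1) x).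
Proof.
case: a => b c x x1; rewrite pow1pB1 //.
have dl (k : R) : is_derive x (1 : R) (fun y => k * ln (1 + y)) (k * (1 + x)^-1).
  by have := is_deriveZ k (is_derive_ln1p x1).
have dE := @is_derive1_comp R expR (fun y => b * ln (1 + y)) x _ _
  (is_derive_expR _) (dl b).
have dC := @is_derive1_comp R (@cos R) (fun y => c * ln (1 + y)) x _ _
  (is_derive_cos _) (dl c).
have dS := @is_derive1_comp R (@sin R) (fun y => c * ln (1 + y)) x _ _
  (is_derive_sin _) (dl c).
have hE y : pow1p (Complex b c) y =
    Complex (expR (b * ln (1 + y)) * cos (c * ln (1 + y)))
            (expR (b * ln (1 + y)) * sin (c * ln (1 + y))).
  by rewrite /pow1p /cexp ReM_real ImM_real.
split.
  rewrite (_ : (fun y => _) = (expR \o (fun y => b * ln (1 + y))) *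
     (cos \o (fun y => c * ln (1 + y)))); last first.
    by apply/funext => y; rewrite hE.
  apply: is_derive_eq (is_deriveM dE dC) _.
  rewrite hE /GRing.scale /=; ring.
rewrite (_ : (fun y => _) = (expR \o (fun y => b * ln (1 + y))) *
   (sin \o (fun y => c * ln (1 + y)))); last first.
  by apply/funext => y; rewrite hE.
apply: is_derive_eq (is_deriveM dE dS) _.
rewrite hE /GRing.scale /=; ring.
Qed.

Lemma asym0_geometric : asym0 (fun x => ((1 + x)^-1)%:C%C : C) (fun k => (-1) ^+ k).
Proof.
move=> K; exists 1 => x /andP[x0 x1]; rewrite mul1r.
have y0 : 0 < 1 + x by lra.
under eq_bigr => k _ do rewrite -exprMn mulN1r.
have h : (1 + x%:C%C) * \sum_(k < K) (- x%:C%C) ^+ k = 1 - (- x%:C%C) ^+ K :> C.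
  have := subrXX 1 (- x%:C%C : C) K; rewrite expr1n opprK => ->.
  by congr (_ * _); apply: eq_bigr => k _; rewrite expr1n mul1r.
have yC : (1 + x%:C%C : C) != 0.
  by rewrite -[1]/((1 : R)%:C%C) -rmorphD eq_complex /= negb_and gt_eqF.
have -> : ((1 + x)^-1)%:C%C - \sum_(k < K) (- x%:C%C) ^+ k =
    ((1 + x)^-1)%:C%C * (- x%:C%C) ^+ K :> C.
  rewrite fmorphV rmorphD rmorph1; apply: (mulfI yC).
  rewrite mulrBr h mulrA !divff //; ring.
have x0' := ltW x0; have y0' := ltW y0.
rewrite Normc.normcM normcX normcN !normc_real !ger0_norm ?invr_ge0 //.
by rewrite ler_piMl ?exprn_ge0 // invf_le1 // lerDl.
Qed.

Lemma ln1p0 : ln1p 0 = 0.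
Proof. by rewrite /ln1p addr0 ln1. Qed.

Lemma asym0_ln1p : asym0 ln1p logco.
Proof.
case=> [|K].
  have [M M0 hM] := asym0_at_bounded (asym0_prim cderiv_ln1p (asym0_geometric 0%N)).
  by exists M => x /hM; rewrite big_ord0 subr0 expr0 mulr1.
have := asym0_prim cderiv_ln1p (asym0_geometric K).
by apply: asym0_at_eq => // -[|k] //=; rewrite ln1p0.
Qed.

(** By induction on the order of the remainder, integrating the derivative
    [a (1 + x) ^ (a - 1)]. *)
Lemma asym0_pow1p a : asym0 (pow1p a) (cbin a).
Proof.
have h0 b : asym0_at 0 (pow1p b) (cbin b).
  exists (expR `|complex.Re b|) => x /andP[x0 x1].
  rewrite big_ord0 subr0 expr0 mulr1 normc_cexp ler_expR ReM_real.
  have l0 : 0 <= ln (1 + x) by rewrite ln_ge0 // lerDl ltW.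
  have l1 : ln (1 + x) <= 1.
    by apply: le_trans (le_ln1Dx _) _; lra.
  apply: le_trans (ler_norm _) _; rewrite normrM (ger0_norm l0).
  by rewrite ler_piMr.
move=> K; elim: K a => [|K IH] a; first exact: h0.
have := asym0_prim (cderiv_pow1p a) (asym0_atZ a (IH (a - 1))).
apply: asym0_at_eq => // -[|k] /=; first by rewrite cbin0 /pow1p ln1p0 mulr0 cexp0.
have k0 : (k.+1%:R : C) != 0 by rewrite pnatr_eq0.
by apply: (mulfI k0); rewrite -{3}(subrK 1 a) cbinS subrK mulrC divfK.
Qed.

Lemma asym0_ln1pX r : asym0 (fun x => ln1p x ^+ r) (logpow r).
Proof.
elim: r => [|r IH].
  move=> K; apply: asym0_at_eq (asym0_poly 1 K) => [x _|k]; first by rewrite hornerC.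
  by rewrite coef1.
move=> K; apply: asym0_at_eq (asym0M asym0_ln1p IH K) => // x _.
by rewrite exprS.
Qed.

Lemma exprz_dominated (F : realFieldType) (x y r : F) (q m : int) :
  x = y * r -> 0 < y -> y <= 1 -> 0 < r -> q <= m -> x ^ m <= y ^ q * r ^ m.
Proof.
move=> -> y0 y1 r0 qm; rewrite expfzMl; apply: ler_wpM2r; first by rewrite exprz_ge0 ?ltW.
have [p ->] : exists p : nat, m = q + p%:Z by exists (absz (m - q)%R); lia.
rewrite expfzDr ?gt_eqF // ler_piMr ?exprz_ge0 ?(ltW y0) //.
by rewrite -exprnP exprn_ile1 // ltW.
Qed.

Lemma exprz_shift (F : fieldType) (x : F) (k n0 : nat) : x != 0 ->
  x ^+ n0 * x ^ (k%:Z - n0%:Z) = x ^+ k.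
Proof. by move=> x0; rewrite exprnP -expfzDr // addrC subrK. Qed.

Lemma mem_shifted_iota (K n0 : nat) (m : int) :
  (m \in [seq k%:Z - n0%:Z | k <- iota 0 K]) = (- n0%:Z <= m < K%:Z - n0%:Z).
Proof.
apply/mapP/idP => [[k]|h]; first by rewrite mem_iota => hk ->; lia.
by exists (absz (m + n0%:Z)%R); [rewrite mem_iota; lia|lia].
Qed.

(** The analogue of [asym_of_sum] at 0: outside a finite part, the terms at [x] are
    dominated by [(2 x) ^ (K - n0)] times the terms at [1 / 2]. The power [x ^ n0] clears
    the pole. *)
Lemma asym0_of_sum (I : choiceType) (g : R -> C) (a : I -> C) (n : I -> int) (n0 : nat) :
  (forall x, 0 < x <= 2^-1 -> has_abs_sum (fun i => a i * x%:C%C ^ n i) (g x)) ->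
  (forall i, a i != 0 -> - n0%:Z <= n i) ->
  (forall K : int, exists2 F : seq I, uniq F & forall i, a i != 0 -> n i < K -> i \in F) ->
  asym0 (fun x => x%:C%C ^+ n0 * g x)
        (fun k => \sum_(i \in [set i | n i = k%:Z - n0%:Z]) a i).
Proof.
move=> hs hn hfin K.
have [F0 uF0 hF0] := hfin (K%:Z - n0%:Z).
pose F := [seq j <- F0 | (a j != 0) && (n j < K%:Z - n0%:Z)].
have uF : uniq F by exact: filter_uniq.
have hF j : (j \in F) = (a j != 0) && (n j < K%:Z - n0%:Z).
  by rewrite mem_filter; apply/andP/idP => [[]//|/[dup] /andP[h1 h2] ->]; split => //; apply: hF0.
have [r rE] : exists r : R, r = 2^-1 by exists 2^-1.
have r0 : 0 < r by rewrite rE invr_gt0.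
have h2 : 0 < r <= 2^-1 by rewrite r0 rE lexx.
have [M M0 hM] := abs_sum_tail (hs _ h2).
exists (2 ^ (K%:Z - n0%:Z) * M) => x /[dup] hx /andP[x0 x1].
have xC : (x%:C%C : C) != 0 by rewrite eq_complex /= negb_and gt_eqF.
pose G := [seq k%:Z - n0%:Z | k <- iota 0 K].
have uG : uniq G.
  by rewrite map_inj_uniq ?iota_uniq // => p q /addIr [].
have nz (y : R) (m : int) : 0 < y -> normc ((y%:C%C : C) ^ m) = y ^ m.
  move=> y0; case: m => m; first by rewrite -exprnP normcX normc_real gtr0_norm.
  by rewrite !NegzE -!exprnN Normc.normcV normcX normc_real gtr0_norm.
have rho0 : 0 <= (2 * x) ^ (K%:Z - n0%:Z) by rewrite exprz_ge0 // mulr_ge0 // ltW.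
have hdom (j : I) : j \notin F -> normc (a j * x%:C%C ^ n j) <=
    (2 * x) ^ (K%:Z - n0%:Z) * normc (a j * r%:C%C ^ n j).
  have [aj|aj] := eqVneq (a j) 0.
    move=> _; apply: (@le_trans _ _ 0); last exact: mulr_ge0 rho0 (normc_ge0 _).
    by rewrite aj mul0r Normc.normc0.
  rewrite hF aj /= -leNgt => jK.
  apply: (@le_trans _ _ (normc (a j) * x ^ n j)); first by rewrite Normc.normcM nz.
  apply: (@le_trans _ _ ((2 * x) ^ (K%:Z - n0%:Z) * (normc (a j) * r ^ n j))); last first.
    by apply: ler_wpM2l rho0 _ _ _; rewrite Normc.normcM nz.
  rewrite mulrCA; apply: ler_wpM2l; first exact: normc_ge0.
  apply: exprz_dominated => //; first by rewrite rE mulrAC divff ?mul1r // gt_eqF.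
    by rewrite mulr_gt0.
  by rewrite mulrC -ler_pdivlMr // div1r.
have := hM _ _ _ _ (hs x hx) rho0 uF hdom.
rewrite (@sum_fibers _ _ _ n F G a (fun z => x%:C%C ^ z)) //; first last.
- by move=> j; rewrite hF mem_shifted_iota => /andP[aj ->]; rewrite hn.
- by move=> j aj; rewrite mem_shifted_iota hF aj => /andP[].
rewrite big_map => h.
have -> : x%:C%C ^+ n0 * g x - \sum_(k < K)
    (\sum_(i \in [set i | n i = k%:Z - n0%:Z]) a i) * x%:C%C ^+ k =
   x%:C%C ^+ n0 * (g x - \sum_(k <- iota 0 K)
    (\sum_(i \in [set i | n i = k%:Z - n0%:Z]) a i) * x%:C%C ^ (k%:Z - n0%:Z)).
  rewrite mulrBr mulr_sumr; congr (_ - _).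
  rewrite -(big_mkord xpredT (fun k => (\sum_(i \in [set i | n i = k%:Z - n0%:Z]) a i) * x%:C%C ^+ k)).
  rewrite /index_iota subn0; apply: eq_bigr => k _.
  by rewrite mulrCA exprz_shift.
rewrite Normc.normcM normcX normc_real gtr0_norm //.
apply: le_trans (ler_wpM2l (exprn_ge0 _ (ltW x0)) h) _.
rewrite expfzMl -[X in _ <= _ * X](@exprz_shift _ _ K n0) ?gt_eqF //.
by rewrite le_eqVlt; apply/orP; left; apply/eqP; ring.
Qed.

End Expansions.

(** * Generalized eigenspaces, direct sums and linear functionals *)

Section PolyAction.
Variables (K : fieldType) (V : lmodType K) (f : {linear V -> V}).
Implicit Types (p q : {poly K}) (u v : V) (a : K).

(** [V] as a module over [{poly K}], where [X] acts as [f]: relations between coprime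
    polynomials take the place of Jordan forms. *)
Definition pact p v : V := \sum_(i < size p) p`_i *: iter i f v.

Lemma pactE n p v : (size p <= n)%N -> pact p v = \sum_(i < n) p`_i *: iter i f v.
Proof.
move=> h; rewrite /pact (big_ord_widen n (fun i => p`_i *: iter i f v) h).
rewrite big_mkcond; apply: eq_bigr => i _; case: ltnP => // hi.
by rewrite nth_default // scale0r.
Qed.

Lemma iter_linear n u v a : iter n f (a *: u + v) = a *: iter n f u + iter n f v.
Proof. by elim: n => [//|n IH]; rewrite !iterS IH linearP. Qed.

Lemma pact_linear p : linear (pact p).
Proof.
move=> a u v; rewrite /pact scaler_sumr -big_split; apply: eq_bigr => i _.
by rewrite iter_linear scalerDr !scalerA mulrC.
Qed.

HB.instance Definition _ p := GRing.isLinear.Build K V V *:%R (pact p) (pact_linear p).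

Lemma pactN p v : pact p (- v) = - pact p v.
Proof. exact: linearN. Qed.

Lemma pact_sum p (I : Type) (s : seq I) (F : I -> V) :
  pact p (\sum_(i <- s) F i) = \sum_(i <- s) pact p (F i).
Proof. exact: linear_sum. Qed.

Lemma pactD p q v : pact (p + q) v = pact p v + pact q v.
Proof.
pose n := maxn (size p) (size q).
rewrite !(@pactE n) ?leq_maxl ?leq_maxr ?size_polyD //.
by rewrite -big_split; apply: eq_bigr => i _; rewrite coefD scalerDl.
Qed.

Lemma pactC a v : pact a%:P v = a *: v.
Proof.
rewrite (@pactE 1) ?size_polyC_leq1 // big_ord1 coefC eqxx //.
Qed.

Lemma pactMX p v : pact (p * 'X) v = pact p (f v).
Proof.
rewrite (@pactE (size p).+1); last first.
  by apply: leq_trans (size_polyMleq _ _) _; rewrite size_polyX addn2.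
rewrite big_ord_recl coefMX eqxx scale0r add0r; apply: eq_bigr => i _.
by rewrite coefMX /= -iterSr.
Qed.

Lemma pactf p v : pact p (f v) = f (pact p v).
Proof.
by rewrite /pact linear_sum; apply: eq_bigr => i _; rewrite linearZ -iterSr.
Qed.

Lemma pactM p q v : pact (p * q) v = pact p (pact q v).
Proof.
elim/poly_ind: p v => [|p c IH] v.
  by rewrite mul0r /pact size_poly0 !big_ord0.
rewrite mulrDl mulrAC !pactD !pactMX IH pactf; congr (_ + _).
rewrite pactC mul_polyC (@pactE (size q)) ?size_scale_leq // /pact scaler_sumr.
by apply: eq_bigr => i _; rewrite coefZ scalerA.
Qed.

Lemma pactXsubC a v : pact ('X - a%:P) v = f v - a *: v.
Proof.
by rewrite -polyCN pactD pactC scaleNr -[X in pact X](mul1r) pactMX pactC scale1r.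
Qed.

Lemma pactXsubC_exp a n v : pact (('X - a%:P) ^+ n) v = iter n (fun x => f x - a *: x) v.
Proof.
elim: n v => [|n IH] v; first by rewrite expr0 pactC scale1r.
by rewrite exprSr pactM IH pactXsubC iterSr.
Qed.

Lemma gen_eigenspaceP a v :
  gen_eigenspace f a v <-> exists n, pact (('X - a%:P) ^+ n) v = 0.
Proof.
by split=> -[n h]; exists n; move: h; rewrite pactXsubC_exp.
Qed.

Lemma pact_coprime p q v : coprimep p q -> pact p v = 0 -> pact q v = 0 -> v = 0.
Proof.
move=> /Bezout_eq1_coprimepP[[x y] /= e] hp hq.
by rewrite -[v]scale1r -pactC polyC1 -e pactD !pactM hp hq !linear0 addr0.
Qed.

Lemma gen_eigenspace_linear a (c : K) u v :
  gen_eigenspace f a u -> gen_eigenspace f a v -> gen_eigenspace f a (c *: u + v).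
Proof.
move=> /gen_eigenspaceP[n hu] /gen_eigenspaceP[m hv]; apply/gen_eigenspaceP.
exists (m + n)%N; rewrite exprD pact_linear [pact _ u]pactM hu linear0 scaler0 add0r.
by rewrite mulrC pactM hv linear0.
Qed.

Lemma gen_eigenspace0 a : gen_eigenspace f a 0.
Proof. by exists 0%N. Qed.

Lemma gen_eigenspaceD a u v :
  gen_eigenspace f a u -> gen_eigenspace f a v -> gen_eigenspace f a (u + v).
Proof. by rewrite -{2}[u]scale1r; exact: gen_eigenspace_linear. Qed.

Lemma gen_eigenspaceZ a c u : gen_eigenspace f a u -> gen_eigenspace f a (c *: u).
Proof.
by move=> h; rewrite -[_ *: _]addr0; apply: gen_eigenspace_linear h (gen_eigenspace0 a).
Qed.

Lemma gen_eigenspace_sum a (I : Type) (s : seq I) (P : pred I) (F : I -> V) :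
  (forall i, P i -> gen_eigenspace f a (F i)) ->
  gen_eigenspace f a (\sum_(i <- s | P i) F i).
Proof.
move=> h; elim/big_ind: _ => //; first exact: gen_eigenspace0.
exact: gen_eigenspaceD.
Qed.

Lemma gen_eigenspace_pact a p u : gen_eigenspace f a u -> gen_eigenspace f a (pact p u).
Proof.
move=> /gen_eigenspaceP[n h]; apply/gen_eigenspaceP; exists n.
by rewrite -pactM mulrC pactM h linear0.
Qed.

(** Powers of [X - key a] for distinct keys are coprime, so the term at [a], which is
    minus the sum of the others, is killed by two coprime polynomials. *)
Lemma gen_eigenspace_indep (I : eqType) (s : seq I) (key : I -> K) (y : I -> V) :
  uniq s -> {in s &, injective key} ->
  (forall (a : I), a \in s -> gen_eigenspace f (key a) (y a)) -> \sum_(a <- s) y a = 0 ->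
  forall (a : I), a \in s -> y a = 0.
Proof.
move=> us ki hy hs a as_.
have [n hn] : exists n : I -> nat, forall b, b \in s ->
    pact (('X - (key b)%:P) ^+ n b) (y b) = 0.
  have H b : exists n, b \in s -> pact (('X - (key b)%:P) ^+ n) (y b) = 0.
    have [/hy /gen_eigenspaceP[n h]|_] := boolP (b \in s); last by exists 0%N.
    by exists n.
  by have [n hn] := choice H; exists n.
apply: (@pact_coprime (('X - (key a)%:P) ^+ n a)
  (\prod_(b <- rem a s) ('X - (key b)%:P) ^+ n b)).
- rewrite big_seq; elim/big_ind: _ => [|p q hp hq|b]; first exact: coprimep1.
    by rewrite coprimepMr hp hq.
  rewrite mem_rem_uniq // inE => /andP[ba bs].
  apply: coprimep_expl; apply: coprimep_expr.
  rewrite coprimep_XsubC root_XsubC; apply: contraNneq ba => /ki -> //.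
- exact: hn.
- have -> : y a = - \sum_(b <- rem a s) y b.
    by move: hs; rewrite (big_rem a) //= => /eqP; rewrite addr_eq0 => /eqP.
  rewrite pactN pact_sum big1_seq ?oppr0 // => b /= bs.
  rewrite (big_rem b) //= mulrC pactM hn ?linear0 //.
  by move: bs; rewrite mem_rem_uniq // inE => /andP[].
Qed.

(** The iterates of [f] on [v] up to the dimension are linearly dependent. *)
Lemma exists_annihilator (S : set V) (b : seq V) v :
  (forall u, S u -> exists c : 'I_(size b) -> K, u = \sum_(i < size b) c i *: b`_i) ->
  (forall u, S u -> S (f u)) -> S v -> exists2 p : {poly K}, p != 0 & pact p v = 0.
Proof.
move=> hb hf Sv; set n := size b.
have Si i : S (iter i f v) by elim: i => //= i; exact: hf.
have [c hc] : exists c : nat -> 'I_n -> K, forall i, iter i f v = \sum_(j < n) c i j *: b`_j.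
  by have [c hc] := choice (fun i => hb _ (Si i)); exists c.
pose M := \matrix_(i < n.+1, j < n) c i j.
have : kermx M != 0.
  by rewrite -mxrank_eq0 mxrank_ker -lt0n subn_gt0 ltnS rank_leq_col.
move=> /rowV0Pn[x /sub_kermxP xM x0].
exists (\poly_(i < n.+1) x 0 (inord i)).
  apply: contraNneq x0 => e; apply/eqP/rowP => i; rewrite mxE.
  by have := congr1 (fun p : {poly K} => p`_i) e; rewrite coef_poly ltn_ord inord_val coef0.
rewrite (@pactE n.+1) ?size_poly //.
rewrite (eq_bigr (fun i : 'I_n.+1 => \sum_(j < n) (x 0 i * M i j) *: b`_j)); last first.
  move=> i _; rewrite coef_poly ltn_ord inord_val hc scaler_sumr.
  by apply: eq_bigr => j _; rewrite scalerA mxE.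
rewrite exchange_big /= big1 // => j _; rewrite -scaler_suml.
by have := congr1 (fun A : 'rV_n => A 0 j) xM; rewrite !mxE => ->; rewrite scale0r.
Qed.

End PolyAction.

(** A Bezout relation splits off the full multiplicity of a root of [p], until [p] is
    constant; thus generalized eigenvectors generate the kernel of [p]. *)
Lemma pact_split_ind (K : closedFieldType) (V : lmodType K) (f : {linear V -> V})
    (S Q : V -> Prop) :
  (forall p v, S v -> S (pact f p v)) ->
  Q 0 -> (forall u v, Q u -> Q v -> Q (u + v)) ->
  (forall a v, S v -> gen_eigenspace f a v -> Q v) ->
  forall p v, p != 0 -> S v -> pact f p v = 0 -> Q v.
Proof.
move=> hS Q0 QD Qe p; have [n] := ubnP (size p); elim: n p => // n IH p.
rewrite ltnS => sp v p0 Sv pv.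
have [sz|sz] := leqP (size p) 1.
  have : v = 0; last by move=> ->.
  move: pv p0; rewrite (size1_polyC sz) pactC polyC_eq0 => /eqP.
  by rewrite scaler_eq0 => /orP[->|/eqP].
have [a pa] : exists a, root p a by apply/closed_rootP; rewrite gtn_eqF.
have [m [q]] := multiplicity_XsubC p a; rewrite p0 /= => qa pE.
have m0 : (0 < m)%N.
  by rewrite lt0n; apply: contraNneq qa => m0; rewrite -[q]mulr1 -(expr0 ('X - a%:P)) -m0 -pE.
have q0 : q != 0 by apply: contraNneq p0 => q0; rewrite pE q0 mul0r.
have sq : (size q < n)%N.
  apply: leq_trans sp; rewrite pE size_Mmonic ?monic_exp ?monicXsubC //.
  by rewrite size_exp_XsubC addnS /= -{1}[size q]addn0 ltn_add2l.
have cop : coprimep (('X - a%:P) ^+ m) q.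
  by apply: coprimep_expl; rewrite coprimep_sym coprimep_XsubC.
have [[x y] /= e] := Bezout_eq1_coprimepP _ _ cop.
rewrite -[v](scale1r) -(pactC f) polyC1 -e pactD; apply: QD.
  apply: (IH q) => //; first exact: hS.
  by rewrite -pactM mulrC -mulrA [_ * q]mulrC -pE pactM pv linear0.
apply: (Qe a); first exact: hS.
apply/gen_eigenspaceP; exists m.
by rewrite -pactM (_ : _ * (y * q) = y * p) ?pactM ?pv ?linear0 // pE; ring.
Qed.

Section Functionals.
Variables (K : fieldType) (V : lmodType K).

(** By Zorn's lemma there is a subspace maximal among those that avoid [v0]. Together with
    [v0] it spans [V], so the coefficient of [v0] is a linear functional. *)
Lemma exists_functional (v0 : V) : v0 != 0 -> exists phi : {scalar V}, phi v0 != 0.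
Proof.
move=> v00.
pose P (U : set V) := (forall a, {in U &, forall u v, U (a *: u + v)}) /\ ~ U v0.
have [F FP tot|A [[Alin Av] Amax]] := @Zorn_bigcup V P.
  split; last by move=> [U FU Uv]; have [_] := FP U FU; apply.
  move=> a u v; rewrite !inE => -[U FU Uu] [U' FU' Uv].
  have [s|s] := tot U U' FU FU'.
    exists U' => //; have [h _] := FP _ FU'; apply: h; rewrite inE //; exact: s.
  exists U => //; have [h _] := FP _ FU; apply: h; rewrite inE //; exact: s.
have Al a u v : A u -> A v -> A (a *: u + v) by move=> Au Av'; apply: Alin; rewrite inE.
have A0 : A 0.
  have [[u Au]|nA] := pselect (exists u, A u).
    by rewrite -(addNr u) -scaleN1r; exact: Al.
  exfalso; apply: (Amax [set 0]).
    split; first by move=> u Au; case: nA; exists u.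
    by move=> /(_ 0 erefl) h; case: nA; exists 0.
  split; last by move=> /= h; move: v00; rewrite h eqxx.
  by move=> a u v; rewrite !inE => -> ->; rewrite scaler0 addr0.
have AD u v : A u -> A v -> A (u + v) by move=> hu hv; rewrite -[u]scale1r; exact: Al.
have AZ a u : A u -> A (a *: u) by move=> hu; rewrite -[_ *: _]addr0; exact: Al.
have AB u v : A u -> A v -> A (u - v).
  by move=> hu hv; apply: AD => //; rewrite -scaleN1r; exact: AZ.
have key x : exists c, A (x - c *: v0).
  have [Ax|nAx] := pselect (A x); first by exists 0; rewrite scale0r subr0.
  pose B := [set y | exists c, A (y - c *: x)].
  have AB' : A `<` B.
    split; first by move=> y Ay; exists 0; rewrite scale0r subr0.
    by move=> /(_ x) h; apply: nAx; apply: h; exists 1; rewrite scale1r subrr.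
  have : B v0.
    apply: contrapT => nB; apply: (Amax B AB'); split => // a u v.
    rewrite !inE => -[c hu] [d hv]; exists (a * c + d).
    rewrite scalerDl -scalerA opprD addrACA -scalerN -scalerDr; exact: Al.
  move=> [c hc]; have c0 : c != 0.
    by apply/eqP => c0; apply: Av; move: hc; rewrite c0 scale0r subr0.
  exists c^-1; have := AZ (- c^-1) _ hc.
  by rewrite scalerBr scalerA mulNr mulVf // scaleN1r opprK scaleNr addrC.
have [phi hphi] := choice key.
have uniq c d x : A (x - c *: v0) -> A (x - d *: v0) -> c = d.
  move=> h1 h2; apply/eqP; rewrite -subr_eq0; apply/negPn/negP => cd; apply: Av.
  have := AZ (c - d)^-1 _ (AB _ _ h2 h1).
  have -> : x - d *: v0 - (x - c *: v0) = (c - d) *: v0.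
    by rewrite opprB [LHS]addrC addrA subrK scalerBl.
  by rewrite scalerA mulVf // scale1r.
have phil : scalar phi.
  move=> a u v; apply: (@uniq _ _ (a *: u + v)); first exact: hphi.
  rewrite scalerDl -scalerA opprD addrACA -scalerN -scalerDr.
  by apply: Al; exact: hphi.
pose p : {scalar V} := HB.pack phi (GRing.isLinear.Build K V K *%R phi phil).
exists p; rewrite /= (_ : phi v0 = 1) ?oner_eq0 //.
by apply: (@uniq _ _ v0) => //; rewrite scale1r subrr.
Qed.

End Functionals.

Section FiniteSums.
Variables (V : nmodType) (I : choiceType).
Implicit Types (f g : I -> V) (A : set I).

Lemma fsumE f (r : seq I) : uniq r -> (forall i, f i != 0 -> i \in r) ->
  \sum_(i \in [set: I]) f i = \sum_(i <- r) f i.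
Proof. by move=> ur h; apply: fsum_seq => // i _; exact: h. Qed.

Lemma finite_supp_seq f : finite_set [set i | f i != 0] ->
  exists2 r : seq I, uniq r & forall i, f i != 0 -> i \in r.
Proof.
move=> fin; exists (fset_set [set i | f i != 0]); first exact: fset_uniq.
by move=> i h; rewrite in_fset_set // inE.
Qed.

Lemma seq_finite_supp f (r : seq I) : (forall i, f i != 0 -> i \in r) ->
  finite_set [set i | f i != 0].
Proof. by move=> h; apply: sub_finite_set (finite_seq r) => i /=; exact: h. Qed.

Lemma fsumD f g : finite_set [set i | f i != 0] -> finite_set [set i | g i != 0] ->
  \sum_(i \in [set: I]) (f i + g i) =
  \sum_(i \in [set: I]) f i + \sum_(i \in [set: I]) g i.
Proof.
move=> /finite_supp_seq[r ur hr] /finite_supp_seq[r' ur' hr'].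
have h1 i : f i != 0 -> i \in undup (r ++ r') by move=> /hr; rewrite mem_undup mem_cat => ->.
have h2 i : g i != 0 -> i \in undup (r ++ r').
  by move=> /hr'; rewrite mem_undup mem_cat orbC => ->.
rewrite !(@fsumE _ (undup (r ++ r'))) ?undup_uniq ?big_split //.
move=> i; have [->|/h1//] := eqVneq (f i) 0; by rewrite add0r => /h2.
Qed.

Lemma finite_suppD f g : finite_set [set i | f i != 0] -> finite_set [set i | g i != 0] ->
  finite_set [set i | f i + g i != 0].
Proof.
move=> h1 h2; apply: (@sub_finite_set _ _ ([set i | f i != 0] `|` [set i | g i != 0])).
  by move=> i /=; have [->|h] := eqVneq (f i) 0; [rewrite add0r; right|left].
by rewrite finite_setU.
Qed.

End FiniteSums.

Section Gradings.
Variables (K : fieldType) (V : lmodType K) (I : choiceType) (gr : I -> set V).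
Hypothesis sub : forall i, gr i 0 /\ forall a, {in gr i &, forall u v, gr i (a *: u + v)}.

Lemma gr_linear i a u v : gr i u -> gr i v -> gr i (a *: u + v).
Proof. by move=> hu hv; have [_ h] := sub i; apply: h; rewrite inE. Qed.

Lemma gr0 i : gr i 0.
Proof. by have [] := sub i. Qed.

Lemma grD i u v : gr i u -> gr i v -> gr i (u + v).
Proof. by rewrite -{2}[u]scale1r; exact: gr_linear. Qed.

Lemma grZ i a u : gr i u -> gr i (a *: u).
Proof. by move=> h; rewrite -[_ *: _]addr0; apply: gr_linear h (gr0 i). Qed.

Lemma decomposes_linear a u v f g : decomposes gr u f -> decomposes gr v g ->
  decomposes gr (a *: u + v) (fun i => a *: f i + g i).
Proof.
move=> [ff fgr ->] [gf ggr ->].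
have af : finite_set [set i | a *: f i != 0].
  by apply: sub_finite_set ff => i /=; apply: contraNneq => ->; rewrite scaler0.
split; first exact: finite_suppD.
  by move=> i; apply: gr_linear.
rewrite fsumD //; congr (_ + _).
have [r ur hr] := finite_supp_seq ff.
rewrite !(@fsumE _ _ _ r) //; first by rewrite scaler_sumr.
by move=> i; have [->|/hr//] := eqVneq (f i) 0; rewrite scaler0 eqxx.
Qed.

Lemma decomposes1 i v : gr i v -> decomposes gr v (fun j => if j == i then v else 0).
Proof.
move=> h; split.
- apply: (@seq_finite_supp _ _ _ [:: i]) => j; rewrite inE.
  by have [//|_] := eqVneq j i; rewrite eqxx.
- by move=> j; case: eqP => [->|_] //; exact: gr0.
- rewrite (@fsumE _ _ _ [:: i]) ?big_seq1 ?eqxx // => j; rewrite inE.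
  by have [//|_] := eqVneq j i; rewrite eqxx.
Qed.

End Gradings.

Section DirectSums.
Variables (K : fieldType) (V : lmodType K) (I : choiceType) (gr : I -> set V).
Hypothesis ds : is_direct_sum gr.

Definition proj (i : I) (v : V) : V := projT1 (cid (ds.2 v)) i.

Lemma proj_decomposes v : decomposes gr v (fun i => proj i v).
Proof. exact: (projT2 (cid (ds.2 v))).1. Qed.

Lemma proj_uniq v f : decomposes gr v f -> forall i, proj i v = f i.
Proof.
by move=> /((projT2 (cid (ds.2 v))).2) e i; rewrite /proj e.
Qed.

Lemma proj_linear i : linear (proj i).
Proof.
move=> a u v.
exact: (proj_uniq (decomposes_linear ds.1 a (proj_decomposes u) (proj_decomposes v))).
Qed.

HB.instance Definition _ i := GRing.isLinear.Build K V V *:%R (proj i) (proj_linear i).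

Lemma proj_gr i v : gr i (proj i v).
Proof. by have [_ h _] := proj_decomposes v; exact: h. Qed.

Lemma proj_of_gr i j v : gr i v -> proj j v = if j == i then v else 0.
Proof. by move=> /(decomposes1 ds.1)/proj_uniq ->. Qed.

Lemma proj_seq v : exists2 r : seq I, uniq r &
  (forall i, proj i v != 0 -> i \in r) /\ v = \sum_(i <- r) proj i v.
Proof.
have [/finite_supp_seq[r ur hr] _ e] := proj_decomposes v; exists r => //; split => //.
by rewrite {1}e (@fsumE _ _ _ r).
Qed.

Lemma proj_eq0 v : (forall i, proj i v = 0) -> v = 0.
Proof. by move=> h; have [r _ [_ ->]] := proj_seq v; rewrite big1. Qed.

Lemma gr_of_proj k v : (forall i, i != k -> proj i v = 0) -> gr k v.
Proof.
move=> h; have -> : v = proj k v; last exact: proj_gr.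
apply/eqP; rewrite -subr_eq0; apply/eqP/proj_eq0 => i.
rewrite linearB /= (proj_of_gr _ (proj_gr k v)); case: eqVneq => [->|/h ->];
  by rewrite subrr.
Qed.

Lemma gr_ind (Q : V -> Prop) : Q 0 -> (forall u v, Q u -> Q v -> Q (u + v)) ->
  forall v, (forall i, Q (proj i v)) -> Q v.
Proof.
move=> Q0 QD v h; have [r _ [_ ->]] := proj_seq v.
by elim/big_ind: _.
Qed.

Lemma subsumP D v : subsum gr D v <-> forall i, ~ D i -> proj i v = 0.
Proof.
split; first by move=> [f hf h] i /h; rewrite (proj_uniq hf).
by move=> h; exists (fun i => proj i v) => //; exact: proj_decomposes.
Qed.

Lemma graded_dual_homogeneous i0 (w' : {scalar V}) :
  (forall i v, gr i v -> i != i0 -> w' v = 0) -> graded_dual gr w'.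
Proof.
move=> h; apply: sub_finite_set (finite_set1 i0) => i /= [v hv nz].
by apply/eqP; apply: contraNT nz => /(h _ _ hv) ->.
Qed.

(** A functional composed with the projection to one homogeneous subspace. Besides being
    in the graded dual, it selects a single weight. *)
Lemma graded_separation v : v != 0 -> exists i0 (w' : {scalar V}),
  (forall i u, gr i u -> i != i0 -> w' u = 0) /\ w' v != 0.
Proof.
move=> v0; have [i0 hi] : exists i, proj i v != 0.
  apply: contrapT => h; move: v0; rewrite (proj_eq0 (v := v)) ?eqxx // => i.
  by apply/eqP/negPn/negP => hi; apply: h; exists i.
have [phi hphi] := exists_functional hi.
have lin : scalar (fun u => phi (proj i0 u)) by move=> a u u'; rewrite !linearP.
pose w' : {scalar V} := HB.pack (fun u => phi (proj i0 u))
  (GRing.isLinear.Build K V K *%R _ lin).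
exists i0, w'; split => // i u hu ne.
by rewrite /= (proj_of_gr _ hu) eq_sym (negbTE ne) linear0.
Qed.

End DirectSums.

(** * The logarithm of the unipotent part of an automorphism *)

Section Logarithm.
Variables (R : realType) (V : lmodType R[i]) (A : vertex_superalgebra V).
Variable (g : {linear V -> V}).
Hypothesis hg : is_automorphism A g.
Local Notation C := R[i].
Local Notation wt := (vsa_wt A).
Local Notation eig := (eig_gr g).
Implicit Types (u v : V) (al : C) (h k : int).

Let dsV := vsa_grading A.

Lemma eig_sub al : eig al 0 /\ forall a, {in eig al &, forall u v, eig al (a *: u + v)}.
Proof.
split.
  by rewrite /eig_gr /=; case: ifP => // _; exact: gen_eigenspace0.
move=> a u v; rewrite !inE /eig_gr /=; case: ifP => _.
  exact: gen_eigenspace_linear.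
by move=> -> ->; rewrite scaler0 addr0.
Qed.

Lemma eig_strip al u : u != 0 -> eig al u -> 0 <= complex.Re al < 1.
Proof. by rewrite /eig_gr /=; case: ifP => // _ /eqP u0 /u0. Qed.

Lemma eig_gen al u : eig al u -> gen_eigenspace g (cexp (twopii R * al)) u.
Proof.
by rewrite /eig_gr /=; case: ifP => // _ ->; exact: gen_eigenspace0.
Qed.

Lemma gen_eig al u : 0 <= complex.Re al < 1 ->
  gen_eigenspace g (cexp (twopii R * al)) u -> eig al u.
Proof. by rewrite /eig_gr /= => ->. Qed.

Lemma eig_pact al p u : eig al u -> eig al (pact g p u).
Proof.
rewrite /eig_gr /=; case: ifP => _; first exact: gen_eigenspace_pact.
by move=> ->; rewrite linear0.
Qed.

Lemma g_wt k u : wt k u -> wt k (g u).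
Proof. by have [_ h _] := hg; exact: h. Qed.

Lemma pact_wt k p u : wt k u -> wt k (pact g p u).
Proof.
move=> hu; rewrite /pact; elim/big_ind: _ => [|x y|i _].
- exact: (gr0 dsV.1).
- exact: (grD dsV.1).
- by apply: (grZ dsV.1); elim: (nat_of_ord i) => //= n; exact: g_wt.
Qed.

(** The weight spaces are finite-dimensional and g-stable, so [exists_annihilator] and
    [pact_split_ind] apply; 0 is not an eigenvalue because [g] is injective. *)
Lemma eig_ind k (Q : V -> Prop) : Q 0 -> (forall u v, Q u -> Q v -> Q (u + v)) ->
  (forall al u, wt k u -> eig al u -> Q u) -> forall u, wt k u -> Q u.
Proof.
move=> Q0 QD Qe u hu; have [b hb] := vsa_findim A k.
have [p p0 pu] := exists_annihilator hb (@g_wt k) hu.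
apply: (@pact_split_ind _ _ g (wt k) Q _ Q0 QD _ p) => //.
  by move=> q v; exact: pact_wt.
move=> a v hv hav; have [a0|a0] := eqVneq a 0.
  suff -> : v = 0 by [].
  have [/bij_inj ginj _ _] := hg.
  move: hav => [n]; elim: n v {hv} => [//|n IH] v.
  rewrite iterSr a0 scale0r subr0 => h.
  have gv : g v = 0 by apply: IH; rewrite a0.
  by apply: ginj; rewrite gv linear0.
have [al hal ea] := clog_strip a0.
by apply: (Qe al) => //; apply: gen_eig => //; rewrite ea.
Qed.

Lemma eig_decomposes0 f : decomposes eig 0 f -> f = fun=> 0.
Proof.
move=> [/finite_supp_seq[r ur hr] fe e0].
pose r' := [seq al <- r | f al != 0].
have hr' al : al \in r' = (f al != 0).
  by rewrite mem_filter; apply/andP/idP => [[]//|h]; split => //; exact: hr.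
have ur' : uniq r' by exact: filter_uniq.
have hs al : al \in r' -> 0 <= complex.Re al < 1.
  by rewrite hr' => /eig_strip; apply; exact: fe.
have h0 : forall al, al \in r' -> f al = 0.
  apply: (@gen_eigenspace_indep _ _ g _ r' (fun al => cexp (twopii R * al))) => //.
  - by move=> a b /hs ha /hs hb; exact: Re_strip_inj.
  - by move=> al _; apply: eig_gen.
  - by rewrite [in RHS]e0 (@fsumE _ _ _ r') // => al; rewrite hr'.
apply/funext => al; have [//|h] := eqVneq (f al) 0.
by apply: h0; rewrite hr'.
Qed.

(** Existence is checked on the weight spaces ([eig_ind]); uniqueness holds because
    [al |-> e ^ (2 pi i al)] is injective on the strip. *)
Lemma eig_direct_sum : is_direct_sum eig.
Proof.
split; first exact: eig_sub.
move=> v.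
have [f hf] : exists f, decomposes eig v f.
  apply: (gr_ind (ds := dsV) (Q := fun v => exists f, decomposes eig v f)).
  - exists (fun=> 0); split.
    + by apply: (@seq_finite_supp _ _ _ [::]) => i; rewrite eqxx.
    + by move=> al; have [] := eig_sub al.
    + by rewrite (@fsumE _ _ _ [::]) ?big_nil // => i; rewrite eqxx.
  - move=> u w [f hf] [f' hf']; exists (fun al => 1 *: f al + f' al).
    by rewrite -[u]scale1r; exact: (decomposes_linear eig_sub).
  - move=> k; apply: (@eig_ind k (fun v => exists f, decomposes eig v f)).
    + exists (fun=> 0); split.
      * by apply: (@seq_finite_supp _ _ _ [::]) => i; rewrite eqxx.
      * by move=> al; have [] := eig_sub al.
      * by rewrite (@fsumE _ _ _ [::]) ?big_nil // => i; rewrite eqxx.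
    + move=> u w [f hf] [f' hf']; exists (fun al => 1 *: f al + f' al).
      by rewrite -[u]scale1r; exact: (decomposes_linear eig_sub).
    + by move=> al u _ hu; exists (fun j => if j == al then u else 0); exact: (decomposes1 eig_sub).
    + exact: proj_gr.
exists f; split => // f' hf'.
have h0 := eig_decomposes0 (f := fun al => -1 *: f al + f' al).
apply/funext => al; have /h0 /(congr1 (@^~ al)) /eqP : decomposes eig 0 (fun al => -1 *: f al + f' al).
  have := decomposes_linear eig_sub (-1) hf hf'.
  by rewrite scaleN1r addNr.
by rewrite /= scaleN1r addrC subr_eq0 => /eqP.
Qed.

Lemma eig_compE v f : decomposes eig v f -> eig_comp g v = f.
Proof.
move=> hf; rewrite /eig_comp; case: xgetP => [f' _ hf'|/(_ f)//].
have [f0 [_ u]] := eig_direct_sum.2 v.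
by rewrite -(u _ hf) -(u _ hf').
Qed.

Lemma eig_comp_proj v al : eig_comp g v al = proj eig_direct_sum al v.
Proof. by rewrite (eig_compE (proj_decomposes eig_direct_sum v)). Qed.

Lemma exp_Sg_eig c al u : eig al u -> exp_Sg g c u = cexp (c * al) *: u.
Proof.
move=> hu; rewrite /exp_Sg (@fsumE _ _ _ [:: al]) //.
  by rewrite big_seq1 eig_comp_proj (proj_of_gr _ _ hu) eqxx.
move=> b; rewrite eig_comp_proj (proj_of_gr _ _ hu) inE.
by case: ifP => // _; rewrite scaler0 eqxx.
Qed.

(** The polynomials in [g] that act on [V^[al]] as the unipotent part minus 1 and,
    when its n-th power vanishes, as its logarithm divided by [2 pi i]. *)
Definition unip al : {poly C} := (cexp (twopii R * al))^-1 *: 'X - 1.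

Definition logp al n : {poly C} :=
  (twopii R)^-1 *: \sum_(k < n) ((-1) ^+ k / k.+1%:R) *: unip al ^+ k.+1.

Lemma pact_unip al u : pact g (unip al) u = (cexp (twopii R * al))^-1 *: g u - u.
Proof.
by rewrite /unip pactD -polyC1 -polyCN pactC -mul_polyC pactMX pactC scaleN1r.
Qed.

Lemma unip_nilpotent al u : eig al u -> exists n, pact g (unip al ^+ n) u = 0.
Proof.
move=> /eig_gen /gen_eigenspaceP[n h]; exists n.
have l0 := cexp_neq0 (twopii R * al).
have -> : unip al = (cexp (twopii R * al))^-1 *: ('X - (cexp (twopii R * al))%:P).
  rewrite /unip scalerBr; congr (_ - _).
  by rewrite -[RHS]mul_polyC -polyCM mulVf.
by rewrite exprZn -mul_polyC pactM h linear0.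
Qed.

(** On [V^[al]] the operator [e ^ (- 2 pi i S_g) g] is a multiple of [g], so [N_g] is
    there a polynomial in [g]. In particular it preserves weights and eigenspaces. *)
Lemma NgE al n u : eig al u -> pact g (unip al ^+ n) u = 0 -> Ng g u = pact g (logp al n) u.
Proof.
move=> hu hn; rewrite /Ng /logp -mul_polyC pactM pactC; congr (_ *: _).
have it (k : nat) : iter k (fun x => exp_Sg g (- twopii R) (g x) - x) u = pact g (unip al ^+ k) u.
  elim: k => [|k IH]; first by rewrite expr0 -polyC1 pactC scale1r.
  rewrite iterS IH exprS pactM pact_unip (@exp_Sg_eig _ al) ?mulNr ?cexpN //.
  rewrite -pactf.
  have -> : g u = pact g 'X u by rewrite -[X in pact g X](mul1r) pactMX -polyC1 pactC scale1r.
  by rewrite -pactM; exact: eig_pact.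
rewrite (@fsumE _ _ _ (iota 0 n)) ?iota_uniq //; last first.
  move=> k; rewrite mem_iota /= add0n; apply: contraNT; rewrite -leqNgt => hk.
  have /= -> := it k.+1.
  by rewrite -(subnK (leqW hk)) exprD pactM hn linear0 scaler0.
have -> : iota 0 n = index_iota 0 n by rewrite /index_iota subn0.
rewrite big_mkord.
elim: n {hn} => [|n IH]; first by rewrite !big_ord0 -polyC0 pactC scale0r.
have /= itn := it n.+1; by rewrite !big_ord_recr /= pactD IH itn -mul_polyC pactM pactC.
Qed.

Lemma logp_dvd al n : exists q, logp al n = q * unip al.
Proof.
exists ((twopii R)^-1 *: \sum_(k < n) ((-1) ^+ k / k.+1%:R) *: unip al ^+ k).
rewrite /logp -scalerAl mulr_suml; congr (_ *: _); apply: eq_bigr => k _.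
by rewrite -scalerAl -exprSr.
Qed.

Lemma iter_Ng al n u q : eig al u -> pact g (unip al ^+ n) u = 0 ->
  iter q (Ng g) u = pact g (logp al n ^+ q) u.
Proof.
move=> hu hn; elim: q => [|q IH]; first by rewrite expr0 -polyC1 pactC scale1r.
rewrite iterS IH (@NgE al n) ?exprS ?pactM //; first exact: eig_pact.
by rewrite -pactM mulrC pactM hn linear0.
Qed.

Lemma Ng_eig al u : eig al u -> eig al (Ng g u).
Proof. by move=> hu; have [n hn] := unip_nilpotent hu; rewrite (NgE hu hn); exact: eig_pact. Qed.

Lemma Ng_wt al k u : eig al u -> wt k u -> wt k (Ng g u).
Proof. by move=> hu; have [n hn] := unip_nilpotent hu; rewrite (NgE hu hn); exact: pact_wt. Qed.

Lemma iter_Ng_eig al u q : eig al u -> eig al (iter q (Ng g) u).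
Proof. by move=> hu; elim: q => //= q; exact: Ng_eig. Qed.

Lemma iter_Ng_wt al k u q : eig al u -> wt k u -> wt k (iter q (Ng g) u).
Proof.
move=> hu hk; elim: q => [//|q IH]; rewrite iterS.
exact: (Ng_wt (iter_Ng_eig q hu) IH).
Qed.

Lemma Ng_nilpotent al u : eig al u -> exists n, forall q, (n <= q)%N -> iter q (Ng g) u = 0.
Proof.
move=> hu; have [n hn] := unip_nilpotent hu; exists n => q nq.
have [p hp] := logp_dvd al n.
by rewrite (iter_Ng _ hu hn) hp exprMn -(subnK nq) [unip al ^+ _]exprD mulrA pactM hn linear0.
Qed.

(** The logarithmic series is cut off at an order that depends on the vector; linearity
    comes from a cut-off that serves both vectors. *)
Lemma iter_Ng_linear al q a u v : eig al u -> eig al v ->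
  iter q (Ng g) (a *: u + v) = a *: iter q (Ng g) u + iter q (Ng g) v.
Proof.
move=> hu hv; have [n hn] := unip_nilpotent hu; have [m hm] := unip_nilpotent hv.
have hn' : pact g (unip al ^+ (n + m)) u = 0 by rewrite addnC exprD pactM hn linear0.
have hm' : pact g (unip al ^+ (n + m)) v = 0 by rewrite exprD pactM hm linear0.
rewrite (iter_Ng q hu hn') (iter_Ng q hv hm').
rewrite (@iter_Ng al (n + m)) ?pact_linear ?hn' ?hm' ?scaler0 ?addr0 //.
by apply: (gr_linear eig_sub).
Qed.

End Logarithm.

(** * Weights and monodromy of the twisted operators *)

Section UnbundledLinear.
Variables (K : nzRingType) (U V : lmodType K) (f : U -> V).
Hypothesis lf : linear f.

Lemma linf0 : f 0 = 0.
Proof. by have := lf (-1) 0 0; rewrite scaler0 addr0 scaleN1r addNr. Qed.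

Lemma linfD x y : f (x + y) = f x + f y.
Proof. by rewrite -{1}[x]scale1r lf scale1r. Qed.

Lemma linfZ a x : f (a *: x) = a *: f x.
Proof. by rewrite -[_ *: x]addr0 lf linf0 addr0. Qed.

Lemma linfB x y : f (x - y) = f x - f y.
Proof. by rewrite -scaleN1r linfD linfZ scaleN1r. Qed.

Lemma linf_sum (I : Type) (s : seq I) (P : pred I) (F : I -> U) :
  f (\sum_(i <- s | P i) F i) = \sum_(i <- s | P i) f (F i).
Proof. by elim/big_rec2: _ => [|i y x _ <-]; rewrite ?linf0 ?linfD. Qed.

End UnbundledLinear.

Section NewtonSeries.
Variable R : realType.
Local Notation C := R[i].
Implicit Types (q : {poly C}) (c t : C).

(** Up to the scalar [c], the effect of a change of branch on polynomials in [log x]. *)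
Definition transl_fun c t q : {poly C} := c *: (q \Po ('X + t%:P)).

Lemma transl_linear c t : linear (transl_fun c t).
Proof. by move=> a p q; rewrite /transl_fun linearP scalerDr !scalerA mulrC. Qed.

HB.instance Definition _ c t :=
  GRing.isLinear.Build C {poly C} {poly C} *:%R (transl_fun c t) (transl_linear c t).

Definition transl c t : {linear {poly C} -> {poly C}} := transl_fun c t.

Lemma translE c t q : transl c t q = c *: (q \Po ('X + t%:P)).
Proof. by []. Qed.

Lemma transl_iter t q n x : (iter n (transl 1 t) q).[x] = q.[x + n%:R * t].
Proof.
elim: n x => [|n IH] x; first by rewrite mul0r addr0.
rewrite iterS translE scale1r horner_comp IH !hornerE; congr (q.[_]).
by rewrite -natr1; ring.
Qed.

(** Compare leading coefficients. *)
Lemma transl_inj c t q : c != 1 -> transl c t q = q -> q = 0.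
Proof.
move=> c1 h; apply/eqP; rewrite -lead_coef_eq0; apply/eqP.
have : lead_coef (transl c t q) = c * lead_coef q.
  rewrite translE lead_coefZ lead_coef_comp ?lead_coefXaddC ?expr1n ?mulr1 //.
  by rewrite size_XaddC.
rewrite h => /eqP; rewrite -subr_eq0 -{1}[lead_coef q]mul1r -mulrBl mulf_eq0 subr_eq0.
by rewrite eq_sym (negbTE c1) => /eqP.
Qed.

(** Binomial coefficients as polynomials in the upper argument. *)
Definition binp (k : nat) : {poly C} := (k`!%:R)^-1 *: \prod_(j < k) ('X - j%:R%:P).

Lemma binp_nat k n : (binp k).[n%:R] = ('C(n, k))%:R.
Proof.
rewrite /binp hornerZ horner_prod.
under eq_bigr do rewrite hornerXsubC.
have f0 : (k`!%:R : C) != 0 by rewrite pnatr_eq0 -lt0n fact_gt0.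
apply: (mulfI f0); rewrite mulrA divff // mul1r -natrM mulnC bin_ffact.
elim: k {f0} => [|k IH]; first by rewrite big_ord0 ffactn0.
rewrite big_ord_recr /= IH ffactnSr natrM.
have [kn|nk] := leqP k n; first by rewrite natrB.
by rewrite ffact_small // !mul0r.
Qed.

Lemma binp_deriv0 k : (binp k.+1)^`().[0] = (-1) ^+ k / k.+1%:R.
Proof.
rewrite /binp derivZ hornerZ big_ord_recl subr0 derivM derivX mul1r !hornerE.
rewrite horner_prod.
have -> : \prod_(i < k) ('X - (lift ord0 i)%:R%:P : {poly C}).[0] = (-1) ^+ k * k`!%:R.
  elim: k => [|k IH]; first by rewrite big_ord0 expr0 mul1r.
  rewrite big_ord_recr /= IH hornerXsubC sub0r exprS factS natrM /bump /=.
  by rewrite add1n; ring.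
have f0 : (k`!%:R : C) != 0 by rewrite pnatr_eq0 -lt0n fact_gt0.
have k0 : (k.+1%:R : C) != 0 by rewrite pnatr_eq0.
by rewrite factS natrM; field; rewrite f0 addrC natr1 k0.
Qed.

(** Newton's formula: [q(x + y t)] is the sum of the [binp k (y)] times the k-th difference
    of [q] at [x] for every natural [y], hence identically in [y]. Its derivative at
    [y = 0] is the logarithmic series of the translation. *)
Lemma newton_log t q n : pact (transl 1 t) (('X - 1) ^+ n) q = 0 ->
  pact (transl 1 t) (\sum_(k < n) ((-1) ^+ k / k.+1%:R) *: ('X - 1) ^+ k.+1) q =
  t *: q^`().
Proof.
move=> hn; pose D k := pact (transl 1 t) (('X - 1) ^+ k) q.
have D0 k : (n <= k)%N -> D k = 0.
  by move=> nk; rewrite /D -(subnK nk) exprD pactM hn linear0.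
have itE m : iter m (transl 1 t) q = \sum_(k < n) 'C(m, k)%:R *: D k.
  have -> : iter m (transl 1 t) q = pact (transl 1 t) (('X - 1 + 1) ^+ m) q.
    rewrite subrK -[X in _ = pact _ (X ^+ _) _]subr0 -polyC0 pactXsubC_exp.
    by elim: m => //= m <-; rewrite scale0r subr0.
  have e : (('X - 1 + 1) ^+ m : {poly C}) = \sum_(k < m.+1) 'C(m, k)%:R *: ('X - 1) ^+ k.
    rewrite addrC exprDn; apply: eq_bigr => k _.
    by rewrite expr1n mul1r scaler_nat.
  rewrite e.
  have -> : pact (transl 1 t) (\sum_(k < m.+1) 'C(m, k)%:R *: ('X - 1) ^+ k) q =
      \sum_(k < m.+1) 'C(m, k)%:R *: D k.
    elim: m.+1 => [|j IH]; first by rewrite !big_ord0 -polyC0 pactC scale0r.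
    by rewrite !big_ord_recr /= pactD IH -mul_polyC pactM pactC.
  rewrite (big_ord_widen (m.+1 + n) (fun k => 'C(m, k)%:R *: D k)) ?leq_addr //.
  rewrite [RHS](big_ord_widen (m.+1 + n) (fun k => 'C(m, k)%:R *: D k)) ?leq_addl //.
  rewrite big_mkcond [RHS]big_mkcond; apply: eq_bigr => k _.
  case: ltnP => hk; case: ltnP => hk' //; first by rewrite D0 ?scaler0.
  by rewrite bin_small ?scale0r.
suff H x : (pact (transl 1 t) (\sum_(k < n) ((-1) ^+ k / k.+1%:R) *: ('X - 1) ^+ k.+1) q).[x]
    = (t *: q^`()).[x].
  apply/eqP; rewrite -subr_eq0; apply/eqP.
  apply: (@poly0_inj_roots _ (fun k => k%:R)) => [a b /eqP|k]; last first.
    by rewrite hornerD hornerN H subrr.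
  by rewrite eqr_nat => /eqP.
pose F := q \Po (x%:P + t *: 'X).
pose G := \sum_(k < n.+1) (D k).[x] *: binp k.
have FG : F = G.
  apply/eqP; rewrite -subr_eq0; apply/eqP.
  apply: (@poly0_inj_roots _ (fun k => k%:R)) => [a b /eqP|m].
    by rewrite eqr_nat => /eqP.
  apply/eqP; rewrite hornerD hornerN subr_eq0; apply/eqP.
  rewrite /F horner_comp !hornerE -[t * _]mulrC -transl_iter itE /G.
  rewrite !horner_sum big_ord_recr /= D0 // horner0 scale0r horner0 addr0.
  by apply: eq_bigr => k _; rewrite [LHS]hornerZ [RHS]hornerZ binp_nat mulrC.
have lF : F^`().[0] = (t *: q^`()).[x].
  rewrite /F deriv_comp hornerM horner_comp derivD derivZ derivX derivC add0r.
  by rewrite hornerD hornerC !hornerZ hornerX hornerC mulr0 addr0 mulr1 mulrC.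
have := congr1 (fun p : {poly C} => p^`().[0]) FG => /=.
rewrite lF /G.
have dsum (E : 'I_n.+1 -> {poly C}) : (\sum_k E k)^`() = \sum_k (E k)^`().
  exact: raddf_sum.
rewrite dsum horner_sum big_ord_recl.
have -> : binp 0 = 1%:P by rewrite /binp big_ord0 fact0 invr1 scale1r polyC1.
rewrite derivZ derivC scaler0 horner0 add0r => ->.
have -> : pact (transl 1 t) (\sum_(k < n) ((-1) ^+ k / k.+1%:R) *: ('X - 1) ^+ k.+1) q =
    \sum_(k < n) ((-1) ^+ k / k.+1%:R) *: D k.+1.
  elim: (n) => [|j IH]; first by rewrite !big_ord0 -polyC0 pactC scale0r.
  by rewrite !big_ord_recr /= pactD IH -mul_polyC pactM pactC.
rewrite horner_sum; apply: eq_bigr => k _.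
by rewrite derivZ !hornerZ -binp_deriv0 mulrC /binp derivZ hornerZ.
Qed.

End NewtonSeries.

Section Weights.
Variables (R : realType) (V : lmodType R[i]) (A : vertex_superalgebra V).
Local Notation C := R[i].
Local Notation wt := (vsa_wt A).
Implicit Types (u v : V) (h k n : int).

Let dsV := vsa_grading A.

Lemma halfD h k n : (h%:~R / 2%:R + k%:~R / 2%:R + n%:~R : C) = (h + k + 2 * n)%:~R / 2%:R.
Proof. by rewrite !rmorphD rmorphM /=; field. Qed.

Lemma half_inj h k : (h%:~R / 2%:R : C) = k%:~R / 2%:R -> h = k.
Proof.
by move=> /(mulIf _); rewrite invr_eq0 pnatr_eq0 => /(_ isT) /eqP; rewrite eqr_int => /eqP.
Qed.

(** The homogeneous components of an eigenvector of [L(0)] have its eigenvalue. *)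
Lemma wt_Y h k n u v : wt h u -> wt k v -> wt (h + k + 2 * n) (vsa_Y A u v n).
Proof.
move=> hu hv; set x := vsa_Y A u v n; set m := h + k + 2 * n.
have Lx : vsa_L0 A x = (m%:~R / 2%:R) *: x.
  have := vsa_L0_comm A u v n; rewrite (vsa_L0E hu) (vsa_L0E hv).
  rewrite (linfZ (vsa_Y_linr A u n)) (linfZ (vsa_Y_linl A v n)) => /eqP.
  by rewrite subr_eq -!scalerDl => /eqP ->; rewrite -halfD; congr (_ *: _); ring.
have Lp j y : vsa_L0 A (proj dsV j y) = (j%:~R / 2%:R) *: proj dsV j y.
  by rewrite (vsa_L0E (proj_gr dsV j y)).
apply: (gr_of_proj (ds := dsV)) => j jm.
have e : proj dsV j (vsa_L0 A x) = (j%:~R / 2%:R) *: proj dsV j x.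
  have [r ur [hr e]] := proj_seq dsV x.
  rewrite {1}e !linear_sum /=.
  rewrite (eq_bigr (fun i => if i == j then (j%:~R / 2%:R) *: proj dsV j x else 0)); last first.
    move=> i _; rewrite Lp linearZ /= (proj_of_gr dsV j (proj_gr dsV i x)) eq_sym.
    by case: eqP => [->//|_]; rewrite scaler0.
  rewrite -big_mkcond big_const_seq /=.
  have [jr|nr] := boolP (j \in r).
    by rewrite (count_uniq_mem _ ur) jr /= addr0.
  rewrite (count_uniq_mem _ ur) (negbTE nr) /=.
  by rewrite (_ : proj dsV j x = 0) ?scaler0 //; apply/eqP; apply: contraNT nr; exact: hr.
move: e; rewrite Lx linearZ /= => /eqP; rewrite -subr_eq0 -scalerBl scaler_eq0 subr_eq0.
by case/orP => [/eqP/half_inj e|/eqP//]; rewrite e eqxx in jm.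
Qed.

Lemma wt_parity h u : wt h u -> vsa_parity A (half_parity h) u.
Proof.
move=> hu; apply/(subsumP dsV) => i ni; rewrite (proj_of_gr dsV i hu).
by case: eqP ni => // -> [].
Qed.

End Weights.

Section TwistedWeights.
Variables (R : realType) (V : lmodType R[i]) (A : vertex_superalgebra V).
Variables (g : {linear V -> V}) (hg : is_automorphism A g).
Variables (W : lmodType R[i]) (M : twisted_module A g W).
Local Notation C := R[i].
Local Notation wt := (vsa_wt A).
Local Notation Y := (tw_Y M).
Local Notation gen := (gen_eigenspace (tw_L0 M)).
Implicit Types (u v : V) (w : W) (mu n : C) (k : nat) (h : int).

Let dsW := tw_grading M.

Lemma gr_gen i w : tw_gr M i w -> gen i.1.1 w.
Proof.
move=> hw; apply: (tw_L0_nilp (t := M)); apply/(subsumP dsW) => j nj.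
by rewrite (proj_of_gr dsW j hw); case: eqP nj => // -> [].
Qed.

(** The components of [w] are generalized eigenvectors of [L(0)] for their weights, and
    those for distinct weights are independent. *)
Lemma gen_proj mu w i : gen mu w -> i.1.1 != mu -> proj dsW i w = 0.
Proof.
move=> hw ne; have [r ur [hr e]] := proj_seq dsW w.
have [//|nz] := eqVneq (proj dsW i w) 0.
pose keys := undup (mu :: [seq j.1.1 | j <- r]).
pose y (n : C) := \sum_(j <- r | j.1.1 == n) proj dsW j w - (if n == mu then w else 0).
have hy (n : C) : gen n (y n).
  apply: gen_eigenspaceD.
    apply: gen_eigenspace_sum => j /eqP <-; apply: gr_gen; exact: proj_gr.
  rewrite -scaleN1r; apply: gen_eigenspaceZ.
  by case: eqP => [->|_] //; exact: gen_eigenspace0.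
have ysum : \sum_(n <- keys) y n = 0.
  rewrite sumrB; apply/eqP; rewrite subr_eq0; apply/eqP.
  rewrite -[RHS]big_mkcond /= (exchange_big_dep xpredT) //=.
  rewrite -[RHS]big_filter.
  rewrite [RHS](_ : _ = w); last first.
    rewrite big_filter big_mkcond (bigD1_seq mu) ?undup_uniq ?mem_undup ?mem_head //= eqxx.
    by rewrite big1 ?addr0 // => n /negbTE ->.
  rewrite [RHS]e; apply: eq_big_seq => j jr.
  rewrite big_mkcond (bigD1_seq j.1.1) ?undup_uniq //=; last first.
    by rewrite mem_undup inE (map_f (fun j : C * bool * C => j.1.1) jr) orbT.
  by rewrite eqxx big1 ?addr0 // => n; rewrite eq_sym => /negbTE ->.
have y0 : y i.1.1 = 0.
  apply: (@gen_eigenspace_indep _ _ (tw_L0 M) _ keys id) => //; first exact: undup_uniq.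
  by rewrite mem_undup inE (map_f (fun j : C * bool * C => j.1.1) (hr _ nz)) orbT.
have := congr1 (proj dsW i) y0.
rewrite /y (negbTE ne) subr0 linear_sum linear0 /=.
rewrite big_mkcond (bigD1_seq i) //=; last exact: hr.
rewrite eqxx big1 ?addr0 => [|j ji].
  by rewrite (proj_of_gr dsW i (proj_gr dsW i w)) eqxx.
case: ifP => // _; rewrite (proj_of_gr dsW i (proj_gr dsW j w)).
by rewrite eq_sym (negbTE ji).
Qed.

Lemma gen_lower_bounded B mu w :
  (forall n w, complex.Re n < B -> tw_weight M n w -> w = 0) ->
  complex.Re mu < B -> gen mu w -> w = 0.
Proof.
move=> hB hmu hw; apply: (hB mu) => //; apply/(subsumP dsW) => i /eqP.
exact: gen_proj.
Qed.

(** Induction on the nilpotency of [L(0) - mu] on [w] and, downwards, on the power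
    of the logarithm. *)
Lemma tw_Y_gen h mu n k u w : wt h u -> gen mu w ->
  gen (n + h%:~R / 2%:R + mu) (Y u w (n, k)).
Proof.
move=> hu [N]; elim: N w k => [|N IH] w k.
  by move=> /= ->; rewrite (linf0 (tw_Y_linr M u _)); exact: gen_eigenspace0.
rewrite iterSr => hN.
set c := _ + mu.
have step k' : gen c (Y u w (n, k'.+1)) -> gen c (Y u w (n, k')).
  move=> hk; suff [m hm] : gen c (tw_L0 M (Y u w (n, k')) - c *: Y u w (n, k')).
    by exists m.+1; rewrite iterSr.
  have -> : tw_L0 M (Y u w (n, k')) - c *: Y u w (n, k') =
      Y u (tw_L0 M w - mu *: w) (n, k') + k'.+1%:R *: Y u w (n, k'.+1).
    have /eqP := tw_L0_comm M u w (n, k').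
    rewrite subr_eq (vsa_L0E hu) (linfZ (tw_Y_linl M w _)) /xderiv /= => /eqP ->.
    rewrite (linfB (tw_Y_linr M u _)) (linfZ (tw_Y_linr M u _)) /c !scalerDl.
    have H (a b d x z : W) : a + b + d + x - (a + d + z) = x - z + b.
      rewrite [a + b + d]addrAC -[a + d + b + x]addrA opprD addrACA subrr add0r.
      by rewrite -addrA addrC.
    exact: H.
  apply: gen_eigenspaceD; first exact: IH.
  exact: gen_eigenspaceZ.
have [K hK] := tw_Y_log M u w.
have [m] := ubnP (K.+1 - k); elim: m k => // m IHm k hm.
have [kK|Kk] := leqP k K; last by rewrite hK //; exact: gen_eigenspace0.
by apply: step; apply: IHm; lia.
Qed.

Section Homogeneous.
Variables (i0 : C * bool * C) (w' : {scalar W}).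
Hypothesis hw' : forall i w, tw_gr M i w -> i != i0 -> w' w = 0.

Lemma homogeneous_gen mu w : gen mu w -> mu != i0.1.1 -> w' w = 0.
Proof.
move=> hw ne; have [r ur [hr e]] := proj_seq dsW w.
rewrite e linear_sum big1 // => i _.
have [ii|/hw'->//] := eqVneq i i0; last exact: proj_gr.
by rewrite (gen_proj hw) ?linear0 // ii eq_sym.
Qed.

Lemma homogeneous_graded_dual : graded_dual (tw_gr M) w'.
Proof. exact: (graded_dual_homogeneous (i0 := i0)). Qed.

Lemma homogeneous_Y h mu n k u w : wt h u -> gen mu w ->
  n != i0.1.1 - h%:~R / 2%:R - mu -> w' (Y u w (n, k)) = 0.
Proof.
move=> hu hw ne; apply: (homogeneous_gen (tw_Y_gen n k hu hw)).
by apply: contraNneq ne => <-; apply/eqP; ring.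
Qed.

End Homogeneous.

(** The polynomial with the given coefficients, when almost all of them vanish. *)
Definition logpoly (c : nat -> C) : {poly C} := xget 0 [set p : {poly C} | forall k, p`_k = c k].

Lemma logpolyE K (c : nat -> C) : (forall k, (K < k)%N -> c k = 0) ->
  logpoly c = \poly_(k < K.+1) c k.
Proof.
move=> hc; have h : forall k, (\poly_(k < K.+1) c k)`_k = c k.
  by move=> k; rewrite coef_poly ltnS; case: leqP => // /hc.
rewrite /logpoly; case: xgetP => [p _ hp|/(_ _ h)//].
by apply/polyP => k; rewrite hp h.
Qed.

Section Monodromy.
Variables (i0 : C * bool * C) (w' : {scalar W}).
Hypothesis hw' : forall i w, tw_gr M i w -> i != i0 -> w' w = 0.
Variables (w : W) (mu n : C).
Hypothesis hw : gen mu w.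

(** The polynomial in [log x] that multiplies [x ^ n]. *)
Definition log_part u : {poly C} := logpoly (fun k => w' (Y u w (n, k))).

Lemma log_part_poly u : exists K, forall K', (K <= K')%N ->
  log_part u = \poly_(k < K'.+1) w' (Y u w (n, k)).
Proof.
have [K hK] := tw_Y_log M u w; exists K => K' KK'.
by apply: logpolyE => k hk; rewrite hK ?linear0 // (leq_ltn_trans KK').
Qed.

Lemma log_part_coef u k : (log_part u)`_k = w' (Y u w (n, k)).
Proof.
have [K hK] := log_part_poly u; rewrite (hK (K + k)%N) ?leq_addr //.
by rewrite coef_poly ltnS leq_addl.
Qed.

Lemma log_part_linear : linear log_part.
Proof.
move=> a x y; apply/polyP => k; rewrite coefD coefZ !log_part_coef.
by rewrite (tw_Y_linl M) linearP.
Qed.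

(** The equivariance property at [z = 1] on every branch: two polynomials that agree
    at all multiples of [2 pi i] are equal. *)
Lemma log_part_g h u : wt h u ->
  log_part (g u) = transl (cexp (- (twopii R * n))) (- twopii R) (log_part u).
Proof.
move=> hu; have hgu : wt h (g u) by exact: g_wt.
have [e|ne] := eqVneq n (i0.1.1 - h%:~R / 2%:R - mu); last first.
  have z v : wt h v -> log_part v = 0.
    move=> hv; apply/polyP => k; rewrite log_part_coef coef0.
    exact: (homogeneous_Y hw' k hv hw ne).
  by rewrite (z _ hu) (z _ hgu) translE comp_poly0 scaler0.
have [K1 hK1] := log_part_poly u; have [K2 hK2] := log_part_poly (g u).
pose K := maxn K1 K2.
suff H : log_part u = cexp (twopii R * n) *: (log_part (g u) \Po ('X + (twopii R)%:P)).
  rewrite [in RHS]H translE comp_polyZ scalerA cexpN mulVf ?cexp_neq0 // scale1r.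
  rewrite -comp_polyA comp_polyD comp_polyX comp_polyC -addrA -polyCD addNr addr0.
  by rewrite comp_polyXr.
apply/eqP; rewrite -subr_eq0; apply/eqP.
apply: (@poly0_inj_roots _ (fun k => twopii R * k%:R)).
  by move=> a b /(mulfI (twopii_neq0 R)) /eqP; rewrite eqr_nat => /eqP.
move=> p; have := tw_equivariance p%:Z u w (oner_neq0 _) (homogeneous_graded_dual hw').
have lb (q : int) : lbr q (1 : C) = twopii R * q%:~R.
  by rewrite -[1]/(1%:C%C) lbr_real // ln1 addr0.
have ev v (q : int) (K' : nat) : wt h v -> log_part v = \poly_(k < K'.+1) w' (Y v w (n, k)) ->
    \sum_(e \in [set: C * nat]) w' (Y v w e) * mon_at q 1 e =
    cexp (n * (twopii R * q%:~R)) * (log_part v).[twopii R * q%:~R].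
  move=> hv hK'; rewrite (@fsumE _ _ _ [seq (n, k) | k <- iota 0 K'.+1]); last first.
  - move=> [a k]; apply: contraNT => nm; rewrite /=.
    have [an|na] := eqVneq a n; last first.
      by rewrite (homogeneous_Y hw' k hv hw) ?mul0r // -e.
    rewrite an; move: nm; rewrite an mem_map; last by move=> x y [].
    rewrite mem_iota /= add0n ltnS -ltnNge => kK.
    by rewrite -log_part_coef hK' coef_poly ltnS leqNgt kK mul0r.
  - by rewrite map_inj_uniq ?iota_uniq // => x y [].
  rewrite big_map hK' horner_poly mulr_sumr -[iota 0 _]/(index_iota 0 K'.+1) big_mkord.
  by apply: eq_bigr => k _; rewrite /mon_at lb /=; ring.
rewrite (ev _ _ K) ?(ev u _ K) ?(hK1 K) ?(hK2 K) ?leq_maxl ?leq_maxr //.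
rewrite -(hK1 K) ?leq_maxl // -(hK2 K) ?leq_maxr // => E.
rewrite hornerD hornerN hornerZ horner_comp !hornerE.
apply/eqP; rewrite subr_eq0; apply/eqP.
apply: (mulfI (cexp_neq0 (n * (twopii R * p%:Z%:~R)))).
rewrite -E [RHS]mulrA -cexpD rmorphD /=; congr (cexp _ * _.[_]); ring.
Qed.

Lemma log_part_pact h p u : wt h u -> log_part (pact g p u) =
  pact (transl (cexp (- (twopii R * n))) (- twopii R)) p (log_part u).
Proof.
elim/poly_ind: p u => [|p c IH] u hu.
  by rewrite -polyC0 !pactC !scale0r (linf0 log_part_linear).
rewrite !pactD !pactMX !pactC (linfD log_part_linear) (linfZ log_part_linear).
by rewrite -(log_part_g hu) IH //; exact: g_wt.
Qed.

End Monodromy.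

Lemma pact_transl_unip al n q :
  let T := transl (cexp (- (twopii R * n))) (- twopii R) in
  pact T (unip al) q = transl (cexp (- (twopii R * (n + al)))) (- twopii R) q - q.
Proof.
rewrite /= pact_unip !translE scalerA -cexpN -cexpD; congr (cexp _ *: _ - _).
by ring.
Qed.

(** The unipotent part of [g] acts on [log_part] as a translation times
    [e ^ (- 2 pi i (n + al))]. If this scalar is not 1, the difference with the identity is
    injective, so it can be nilpotent only on 0. *)
Lemma tw_exponent0 h mu al n k u w : wt h u -> eig_gr g al u -> gen mu w ->
  cexp (twopii R * (n + al)) != 1 -> Y u w (n, k) = 0.
Proof.
move=> hu hal hw ne; have [//|nz] := eqVneq (Y u w (n, k)) 0.
have [i0 [w' [hw' /eqP[]]]] := graded_separation dsW nz.
have [m hm] := unip_nilpotent hal.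
rewrite -log_part_coef (_ : log_part w' w n u = 0) ?coef0 //.
have := log_part_pact hw' n hw (unip al ^+ m) hu.
rewrite hm (linf0 (log_part_linear w' w n)).
elim: m {hm} => [|m IH]; first by rewrite expr0 -polyC1 pactC scale1r.
rewrite exprS pactM pact_transl_unip // => /esym/eqP; rewrite subr_eq0 => /eqP.
move=> /transl_inj h0; apply: IH; apply/esym/h0.
by rewrite cexpN invr_eq1.
Qed.

(** By equivariance, the unipotent part of [g] acts on the polynomial in [log x] as the
    translation by [- 2 pi i], and the logarithm of this translation is
    [- 2 pi i d / d (log x)] ([newton_log]). *)
Lemma tw_Ng0 h mu al n k u w : wt h u -> eig_gr g al u -> gen mu w ->
  Y (Ng g u) w (n, k) = - (k.+1%:R *: Y u w (n, k.+1)).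
Proof.
move=> hu hal hw; have [e|ne] := eqVneq (cexp (twopii R * (n + al))) 1; last first.
  rewrite (tw_exponent0 _ (Ng_wt hg hal hu) (Ng_eig hg hal) hw ne).
  by rewrite (tw_exponent0 _ hu hal hw ne) scaler0 oppr0.
apply/eqP; rewrite -addr_eq0; apply: contrapT => /negP nz.
have [i0 [w' [hw' /eqP[]]]] := graded_separation dsW nz.
rewrite linearD linearZ /= -!(log_part_coef w' w n).
have [m hm] := unip_nilpotent hal.
rewrite (NgE hg hal hm) (log_part_pact hw' n hw _ hu).
set T := transl _ _.
have pw j q : pact T (unip al ^+ j) q = pact (transl 1 (- twopii R)) (('X - 1) ^+ j) q.
  elim: j => [|j IH]; first by rewrite !expr0 -polyC1 !pactC.
  rewrite [in LHS]exprS [in RHS]exprS !pactM IH pact_transl_unip // cexpN e invr1.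
  set y := pact _ (_ ^+ j) _.
  have -> : ('X - 1 : {poly C}) = 'X - 1%:P by rewrite polyC1.
  by rewrite pactXsubC scale1r.
have hn : pact (transl 1 (- twopii R)) (('X - 1) ^+ m) (log_part w' w n u) = 0.
  by rewrite -pw -(log_part_pact hw' n hw _ hu) hm (linf0 (log_part_linear w' w n)).
have -> : pact T (logp al m) (log_part w' w n u) = - (log_part w' w n u)^`().
  rewrite /logp -mul_polyC pactM pactC.
  have -> : pact T (\sum_(k < m) ((-1) ^+ k / k.+1%:R) *: unip al ^+ k.+1) (log_part w' w n u)
     = pact (transl 1 (- twopii R)) (\sum_(k < m) ((-1) ^+ k / k.+1%:R) *: ('X - 1) ^+ k.+1)
        (log_part w' w n u).
    elim: (m) => [|j IH]; first by rewrite !big_ord0 -polyC0 !pactC.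
    by rewrite !big_ord_recr /= !pactD IH -!mul_polyC !pactM !pactC pw.
  by rewrite newton_log // scalerA mulrN mulVf ?twopii_neq0 // scaleN1r.
by rewrite coefN coef_deriv mulr_natl addNr.
Qed.

Lemma tw_exponent h al n k u w : wt h u -> eig_gr g al u ->
  Y u w (n, k) != 0 -> exists m : int, n = m%:~R - al.
Proof.
move=> hu hal; apply: contraPP => nm; apply/negP/negPn/eqP.
apply: (gr_ind (ds := dsW) (Q := fun w => Y u w (n, k) = 0)) => [|x y hx hy|i].
- exact: (linf0 (tw_Y_linr M u _)).
- by rewrite (linfD (tw_Y_linr M u _)) hx hy addr0.
apply: (tw_exponent0 _ hu hal (gr_gen (proj_gr dsW i w))).
apply/eqP => /cexp_eq1[m e]; apply: nm; exists m.
by apply/eqP; rewrite eq_sym subr_eq eq_sym; apply/eqP/(mulfI (twopii_neq0 R)).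
Qed.

Lemma tw_Ng h al n k u w : wt h u -> eig_gr g al u ->
  Y (Ng g u) w (n, k) = - (k.+1%:R *: Y u w (n, k.+1)).
Proof.
move=> hu hal.
apply: (gr_ind (ds := dsW) (Q := fun w => Y (Ng g u) w (n, k) = - (k.+1%:R *: Y u w (n, k.+1))))
  => [|x y hx hy|i].
- by rewrite !(linf0 (tw_Y_linr M _ _)) scaler0 oppr0.
- by rewrite !(linfD (tw_Y_linr M _ _)) hx hy scalerDr opprD.
exact: (tw_Ng0 _ _ hu hal (gr_gen (proj_gr dsW i w))).
Qed.

(** All logarithms come from [N_g]: [Y(u, x)] is the sum of the [x ^ n] with coefficient
    the log-free part of [Y(x ^ (- N_g) u, x)]. *)
Lemma tw_Y_logE h al n k u w : wt h u -> eig_gr g al u ->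
  Y u w (n, k) = ((-1) ^+ k / k`!%:R) *: Y (iter k (Ng g) u) w (n, 0%N).
Proof.
elim: k u => [|k IH] u hu hal; first by rewrite fact0 divr1 scale1r.
have := tw_Ng n k w hu hal; rewrite (IH _ (Ng_wt hg hal hu) (Ng_eig hg hal)) -iterSr => e.
have k0 : (k.+1%:R : C) != 0 by rewrite pnatr_eq0.
have f0 : (k`!%:R : C) != 0 by rewrite pnatr_eq0 -lt0n fact_gt0.
apply: (scalerI k0); apply: oppr_inj; rewrite -e scalerA -scaleNr; congr (_ *: _).
rewrite exprS factS natrM; field; rewrite f0 addrC natr1 k0 //.
Qed.

End TwistedWeights.

(** * From expansions to residues *)

Section ExponentialSums.
Variable R : realType.
Local Notation C := R[i].
Implicit Types (c : C * nat -> C) (l a : C).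

Definition fsupp c := finite_set [set e | c e != 0].

Definition esum_expo l c : C := \sum_(e \in [set: C * nat]) c e * expo l e.

Lemma esum_seq l c (s : seq (C * nat)) : uniq s -> (forall e, c e != 0 -> e \in s) ->
  esum_expo l c = \sum_(e <- s) c e * expo l e.
Proof.
move=> us hs; apply: fsumE => // e; apply: contraNT => /negP h.
by have [->|/hs//] := eqVneq (c e) 0; rewrite mul0r.
Qed.

Lemma asym_esum sg l0 c : fsupp c ->
  asym sg l0 (fun t => esum_expo (l0 + (sg * t)%:C%C) c) c.
Proof.
move=> /finite_supp_seq[s us hs]; apply: asym_eq (asym_fin sg l0 us hs) => t _.
by rewrite (esum_seq _ us hs).
Qed.

Lemma esum_mulzB1 l c : fsupp c -> fsupp (mulzB1e c) /\
  esum_expo l (mulzB1e c) = (cexp l - 1) * esum_expo l c.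
Proof.
move=> /finite_supp_seq[s us hs].
pose f (e : C * nat) := (e.1 + 1, e.2).
have fi : injective f by move=> -[x k] [y j] [/addIr -> ->].
pose s' := undup (s ++ map f s).
have us' : uniq s' by exact: undup_uniq.
have hf e : mulze c e != 0 -> e \in map f s.
  move=> /hs h; apply/mapP; exists (e.1 - 1, e.2) => //.
  by rewrite /f /= subrK -surjective_pairing.
have h1 e : mulze c e != 0 -> e \in s'.
  by move=> /hf h; rewrite mem_undup mem_cat h orbT.
have h2 e : c e != 0 -> e \in s' by move=> /hs h; rewrite mem_undup mem_cat h.
have h3 e : mulzB1e c e != 0 -> e \in s'.
  by have [e0|/h1//] := eqVneq (mulze c e) 0; rewrite /mulzB1e e0 sub0r oppr_eq0; exact: h2.
split; first exact: seq_finite_supp h3.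
rewrite (esum_seq l us' h3) mulrBl mul1r (esum_seq l us' h2).
rewrite -(esum_seq l us' h2) (esum_seq l us hs) mulr_sumr.
have -> : \sum_(e <- s) cexp l * (c e * expo l e) = \sum_(e <- s') mulze c e * expo l e.
  rewrite -(esum_seq l us' h1) (esum_seq l (s := map f s)) ?map_inj_uniq // big_map.
  by apply: eq_bigr => e _; rewrite /mulze /f /= addrK expo_shift -surjective_pairing mulrCA.
rewrite -(esum_seq l us hs) (esum_seq l us' h2) -sumrB.
by apply: eq_bigr => e _; rewrite -mulrBl.
Qed.

Lemma esum_iter l c n : fsupp c -> fsupp (iter n (@mulzB1e R) c) /\
  esum_expo l (iter n (@mulzB1e R) c) = (cexp l - 1) ^+ n * esum_expo l c.
Proof.
move=> hc; elim: n => [|n [IH1 IH2]]; first by rewrite expr0 mul1r.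
have [h1 h2] := esum_mulzB1 l IH1; split; first by rewrite iterS.
by rewrite iterS h2 IH2 exprS mulrA.
Qed.

Lemma esum_ord (I : finType) (E : I -> C * nat) (f : I -> C) :
  let c e := \sum_(i | E i == e) f i in
  fsupp c /\ forall l, \sum_i f i * expo l (E i) = esum_expo l c.
Proof.
move=> c; pose s := undup (map E (enum I)).
have us : uniq s by exact: undup_uniq.
have hE i : E i \in s by rewrite mem_undup map_f // mem_enum.
have hs e : c e != 0 -> e \in s.
  apply: contraNT => h; rewrite /c big1 // => i /eqP e'.
  by move: h; rewrite -e' hE.
split; first exact: seq_finite_supp hs.
move=> l; rewrite (esum_seq l us hs).
rewrite (eq_bigr (fun e => \sum_(i | E i == e) f i * expo l (E i))); last first.
  by move=> e _; rewrite /c mulr_suml; apply: eq_bigr => i /eqP ->.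
rewrite (exchange_big_dep xpredT) //=; apply: eq_bigr => i _.
under eq_bigl do rewrite eq_sym.
by rewrite sum_pred1_seq.
Qed.

Lemma iter_mulzB1e_slice c c' k k' (r : C) n :
  (forall a, c (a, k) = r * c' (a, k')) ->
  forall a, iter n (@mulzB1e R) c (a, k) = r * iter n (@mulzB1e R) c' (a, k').
Proof.
move=> h; elim: n => [//|n IH] a.
by rewrite !iterS /mulzB1e /mulze /= !IH mulrBr.
Qed.

Lemma iter_mulzB1e_int c k al n (m : int) :
  iter n (@mulzB1e R) c (m%:~R - al, k) = iter n (@mulzB1 R) (fun m => c (m%:~R - al, k)) m.
Proof.
elim: n m => [//|n IH] m; rewrite !iterS /mulzB1e /mulze /mulzB1 /= -!IH.
by congr (iter n _ c (_, _) - _); rewrite rmorphB /=; ring.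
Qed.

Lemma iter_mulzB1e_supp c al n :
  (forall e, c e != 0 -> exists m : int, e.1 = m%:~R - al) ->
  forall e, iter n (@mulzB1e R) c e != 0 -> exists m : int, e.1 = m%:~R - al.
Proof.
move=> h; elim: n => [//|n IH] e; rewrite iterS /mulzB1e /mulze.
have [->|/IH[m /= hm] _] := eqVneq (iter n (@mulzB1e R) c (e.1 - 1, e.2)) 0.
  by rewrite sub0r oppr_eq0; exact: IH.
by exists (m + 1); rewrite rmorphD /= -[e.1](subrK 1) hm; ring.
Qed.

(** [e ^ (l N) e ^ (- l N) = 1] for a nilpotent [N]. *)
Lemma exp_inverse (l : C) (K : nat) (E : nat -> C) : (forall q, (K <= q)%N -> E q = 0) ->
  \sum_(j < K) \sum_(k < K) l ^+ j / j`!%:R * ((- l) ^+ k / k`!%:R) * E (j + k)%N = E 0%N.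
Proof.
move=> hE.
have f0 j : (j`!%:R : C) != 0 by rewrite pnatr_eq0 -lt0n fact_gt0.
pose G j k := l ^+ j / j`!%:R * ((- l) ^+ k / k`!%:R) * E (j + k)%N.
have e1 j : (j < K)%N -> \sum_(k < K) G j k = \sum_(j <= q < K) G j (q - j)%N.
  move=> jK; rewrite -(big_mkord xpredT (fun k => G j k)).
  rewrite (@big_cat_nat _ _ _ (K - j)%N) ?leq_subr //= [X in _ + X]big_nat_cond.
  rewrite [X in _ + X]big1 ?addr0; last first.
    by move=> k; rewrite andbT => /andP[hk _]; rewrite /G hE ?mulr0 // -leq_subLR.
  have := big_addn 0 K j xpredT (fun q => G j (q - j)%N); rewrite add0n => ->.
  by apply: eq_bigr => k _; rewrite addnK.
rewrite (eq_bigr (fun j : 'I_K => \sum_(j <= q < K) G j (q - j)%N)); last first.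
  by move=> j _; exact: e1.
rewrite -(big_mkord xpredT (fun j => \sum_(j <= q < K) G j (q - j)%N)).
have -> : \sum_(0 <= j < K) \sum_(j <= q < K) G j (q - j)%N =
    \sum_(0 <= q < K) \sum_(0 <= j < q.+1) G j (q - j)%N.
  rewrite big_nat; under eq_bigr => j /andP[_ hj].
    rewrite (big_nat_widenl j 0) //; over.
  rewrite -big_nat (exchange_big_dep_nat xpredT) //= big_nat [RHS]big_nat.
  apply: eq_bigr => q /andP[_ hq].
  rewrite (big_nat_widen 0 q.+1 K) //.
have e2 q : \sum_(0 <= j < q.+1) G j (q - j)%N = (q == 0%N)%:R * E q.
  have -> : \sum_(0 <= j < q.+1) G j (q - j)%N =
     (q`!%:R)^-1 * (\sum_(j < q.+1) (- l) ^+ (q - j) * l ^+ j *+ 'C(q, j)) * E q.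
    rewrite big_mkord mulr_sumr mulr_suml; apply: eq_bigr => -[j /= jq] _; rewrite /G subnKC //.
    rewrite -mulr_natr; congr (_ * _).
    have := bin_fact (jq : (j <= q)%N) => /(congr1 (fun n => n%:R : C)); rewrite !natrM => <-.
    have b0 : ('C(q, j)%:R : C) != 0 by rewrite pnatr_eq0 -lt0n bin_gt0.
    field; rewrite !f0 b0 //.
  rewrite -exprDn addNr expr0n.
  by case: q => [|q]; rewrite ?mulr0 ?mul0r // fact0 invr1 !mul1r.
under eq_bigr do rewrite e2.
case: K hE {e1} => [|K] hE; first by rewrite big_nil hE.
rewrite big_nat_recl // mul1r big1 ?addr0 // => q _; rewrite mul0r //.
Qed.

End ExponentialSums.

Section AsymptoticSums.
Variable R : realType.
Local Notation C := R[i].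
Implicit Types (g : R -> C) (c : nat -> C).

Lemma asym0_ext g g' c c' : (forall x, 0 < x <= 2^-1 -> g x = g' x) ->
  (forall k, c k = c' k) -> asym0 g c -> asym0 g' c'.
Proof. by move=> h h' hg K; apply: asym0_at_eq (hg K). Qed.

Lemma asym0Z g c a : asym0 g c -> asym0 (fun x => a * g x) (fun k => a * c k).
Proof. by move=> h K; apply: asym0_atZ (h K). Qed.

Lemma asym0_sum (I : Type) (s : seq I) (g : I -> R -> C) (c : I -> nat -> C) :
  (forall i, asym0 (g i) (c i)) ->
  asym0 (fun x => \sum_(i <- s) g i x) (fun k => \sum_(i <- s) c i k).
Proof.
move=> h; elim: s => [|i s IH].
  move=> K; exists 0 => x _; rewrite big_nil big1 ?subrr ?Normc.normc0 ?mul0r // => k _.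
  by rewrite big_nil mul0r.
move=> K; apply: asym0_at_eq (asym0_atD (h i K) (IH K)) => [x _|k]; by rewrite big_cons.
Qed.

End AsymptoticSums.

Section AnalyticCore.
Variable R : realType.
Local Notation C := R[i].
Variables (p : int) (al : C).
Local Notation lam := (twopii R * p%:~R).

(** The data that the duality property provides for one vector, when [T] is large:
    [c] and [c'] are the coefficients at infinity and at 0 of the same function of
    [z] with a pole of order at most [T] at 1, where its expansion is [J]. *)
Definition same_function (c c' : C * nat -> C) (J : int -> C) (T : nat) :=
  [/\ fsupp (iter T (@mulzB1e R) c),
      iter T (@mulzB1e R) c = iter T (@mulzB1e R) c',
      asym0 (fun x => esum_expo (lam + ln1p x) (iter T (@mulzB1e R) c))
            (fun k => J (k%:Z - T%:Z))
    & vanish_below J (- T%:Z)].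

Variables (c c' : nat -> C * nat -> C) (J : nat -> int -> C) (K : nat).
Hypothesis c_log : forall q a k, c q (a, k) = (-1) ^+ k / k`!%:R * c (q + k)%N (a, 0%N).
Hypothesis c_int : forall q e, c q e != 0 -> exists m : int, e.1 = m%:~R - al.
Hypothesis c_nilp : forall q, (K <= q)%N -> c q = fun=> 0.
Hypothesis same : forall q, exists T0, forall T, (T0 <= T)%N -> same_function (c q) (c' q) (J q) T.

(** [(1 + x) ^ (alpha + N) e ^ (lambda N)] applied to the expansions [J q] of the
    vectors [N ^ q u]. *)
Definition twisted_iterate (n : int) : C := cexp (al * lam) * \sum_(j < K) \sum_(r < j.+1)
  lam ^+ (j - r) / ((j - r)`!%:R * r`!%:R) * conv (cauchy (cbin al) (logpow R r)) (J j) n.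

Lemma conv_cauchy b (f : int -> C) (T k : nat) : vanish_below f (- T%:Z) ->
  conv b f (k%:Z - T%:Z) = cauchy b (fun k => f (k%:Z - T%:Z)) k.
Proof.
move=> hf; rewrite (@convE _ b f (- T%:Z) _ k.+1) //; last lia.
by apply: eq_bigr => -[i /= ik] _; congr (_ * f _); lia.
Qed.

Lemma conv_below b (f : int -> C) (n0 M : int) : vanish_below f n0 -> M < n0 -> conv b f M = 0.
Proof. by move=> hf hM; rewrite (@convE _ b f n0 M 0) ?big_ord0 //; lia. Qed.

(** The functions of the vectors [N ^ q u] are combined as [z ^ (alpha + N)] prescribes.
    The logarithms cancel ([exp_inverse]) and the exponents become integers, so the
    combination is a Laurent polynomial divided by [(z - 1) ^ T], and the residue theorem
    applies. *)
Lemma expansions_residue m0 m1 :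
  vanish_below (fun j => c 0%N ((- j)%:~R - al, 0%N)) m0 ->
  vanish_below (fun j => c' 0%N (j%:~R - al, 0%N)) m1 ->
  residue_thm (fun m => c 0%N (m%:~R - al, 0%N)) (fun m => c' 0%N (m%:~R - al, 0%N))
    twisted_iterate.
Proof.
move=> hc hc'.
have [T hT] : exists T, forall q, (q <= K)%N -> same_function (c q) (c' q) (J q) T.
  have [T0 hT0] := choice same; exists (\max_(q < K.+1) T0 q) => q qK; apply: hT0.
  exact: (leq_bigmax (Ordinal (qK : (q < K.+1)%N))).
pose cP q := iter T (@mulzB1e R) (c q).
have cP0 q : (K <= q)%N -> cP q = fun=> 0.
  move=> /c_nilp h; rewrite /cP h; elim: T {cP hT} => [//|T IH].
  by rewrite iterS IH /mulzB1e /mulze; apply/funext => e; rewrite subr0.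
have fs q : fsupp (cP q).
  have [qK|/cP0 ->] := ltnP q K; first by have [] := hT q (ltnW qK).
  by apply: (@seq_finite_supp _ _ _ [::]) => e; rewrite eqxx.
have [sm usm hsm] : exists2 sm : seq int, uniq sm &
    forall q (m : int) k, cP q (m%:~R - al, k) != 0 -> m \in sm.
  have H q : exists s : seq int, forall (m : int) k, cP q (m%:~R - al, k) != 0 -> m \in s.
    have [s us hs] := finite_supp_seq (fs q).
    have [f hf] : exists f : C * nat -> int, forall e (m : int), e.1 = m%:~R - al -> f e = m.
      have G (e : C * nat) : exists m0 : int, forall m : int, e.1 = m%:~R - al -> m0 = m.
        case: (pselect (exists m : int, e.1 = m%:~R - al)) => [[m hm]|h].
          exists m => m'; rewrite hm => /addIr /eqP; rewrite eqr_int => /eqP //.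
        by exists 0 => m hm; case: h; exists m.
      by have [f hf] := choice G; exists f.
    by exists (map f s) => m k /hs h; apply/mapP; exists (m%:~R - al, k) => //; rewrite (hf _ m).
  have [s hs] := choice H.
  exists (undup (flatten [seq s q | q <- iota 0 K])); first exact: undup_uniq.
  move=> q m k h; rewrite mem_undup; apply/flattenP.
  have qK : (q < K)%N by rewrite ltnNge; apply/negP => /cP0 h'; move: h; rewrite h' eqxx.
  by exists (s q); [apply/mapP; exists q => //; rewrite mem_iota|exact: hs h].
have cPlog q a k : cP q (a, k) = (-1) ^+ k / k`!%:R * cP (q + k)%N (a, 0%N).
  by apply: iter_mulzB1e_slice => b; exact: c_log.
have cPint q e : cP q e != 0 -> exists m : int, e.1 = m%:~R - al.
  by apply: iter_mulzB1e_supp; exact: c_int.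
pose D q (m : int) := cP q (m%:~R - al, 0%N).
pose E l q := \sum_(m <- sm) D q m * cexp (m%:~R * l).
(* At [z = e ^ l], the function of [N ^ q u] is [z ^ (- alpha) e ^ (- l N)] applied to the
   Laurent polynomials [E]. *)
have esumE l q : cexp (al * l) * esum_expo l (cP q) =
    \sum_(k < K) (- l) ^+ k / k`!%:R * E l (q + k)%N.
  pose s := [seq (m%:~R - al, k) | m <- sm, k <- iota 0 K].
  have us : uniq s.
    apply: allpairs_uniq => //; first exact: iota_uniq.
    by move=> [m k] [m' k'] _ _ [/addIr /eqP]; rewrite eqr_int => /eqP /= -> ->.
  rewrite (esum_seq l us); last first.
    move=> [a k] h; have [m /= am] := cPint q _ h; apply/allpairsP; exists (m, k) => /=.
    rewrite mem_iota add0n /= am; split => //; first by apply: (hsm q m k); rewrite -am.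
    rewrite ltnNge; apply/negP => Kk; move: h.
    by rewrite cPlog cP0 ?mulr0 ?eqxx // (leq_trans Kk) ?leq_addl.
  rewrite /s (_ : iota 0 K = index_iota 0 K); last by rewrite /index_iota subn0.
  rewrite big_allpairs_dep exchange_big /= big_mkord mulr_sumr; apply: eq_bigr => k _.
  rewrite /E !mulr_sumr; apply: eq_bigr => m _.
  rewrite cPlog -/(D _ _) /expo /= [(- l) ^+ k]exprNn mulrBl cexpD cexpN.
  by field; rewrite cexp_neq0 pnatr_eq0 -lt0n fact_gt0.
have main l : cexp (al * l) * \sum_(j < K) l ^+ j / j`!%:R * esum_expo l (cP j) = E l 0%N.
  have E0 q : (K <= q)%N -> E l q = 0.
    by move=> qK; rewrite /E big1 // => m _; rewrite /D cP0 // mul0r.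
  rewrite -[RHS](exp_inverse l E0) mulr_sumr; apply: eq_bigr => j _.
  rewrite mulrCA esumE mulr_sumr; apply: eq_bigr => k _; ring.
have Dsum q : iter T (@mulzB1 R) (fun m => c q (m%:~R - al, 0%N)) =
    (fun m => \sum_(i <- sm) D q i * (m == i)%:R).
  apply/funext => m; rewrite -iter_mulzB1e_int -/(cP q) -/(D q m).
  have [msm|nm] := boolP (m \in sm).
    rewrite (bigD1_seq m) //= eqxx mulr1 big1 ?addr0 // => i.
    by rewrite eq_sym => /negbTE ->; rewrite mulr0.
  rewrite big1_seq => [|i /= ism].
    by apply/eqP; apply: contraNT nm; exact: hsm.
  by case: eqVneq nm ism => [->/negbTE ->//|]; rewrite mulr0.
have vJ (j : 'I_K) : vanish_below (J j) (- T%:Z) by have [] := hT j (ltnW (ltn_ord j)).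
(* The two expansions at [x = 0] of the Laurent polynomial at [z = 1 + x]. *)
have key k : twisted_iterate (k%:Z - T%:Z) = \sum_(m <- sm) D 0%N m * cbin m%:~R k.
  have A1 : asym0 (fun x => E (lam + ln1p x) 0%N) (fun k => \sum_(m <- sm) D 0%N m * cbin m%:~R k).
    apply: (@asym0_ext _ (fun x => \sum_(m <- sm) D 0%N m * pow1p m%:~R x)
        _ (fun k => \sum_(m <- sm) D 0%N m * cbin m%:~R k)) => //.
      move=> x _; apply: eq_bigr => m _; congr (_ * _).
      by rewrite mulrDr cexpD mulrCA -intrM cexp_twopii_int mul1r.
    by apply: asym0_sum => m; apply: asym0Z; exact: asym0_pow1p.
  have A2 : asym0 (fun x => E (lam + ln1p x) 0%N) (fun k => twisted_iterate (k%:Z - T%:Z)).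
    pose co (j r : nat) := lam ^+ (j - r) / ((j - r)`!%:R * r`!%:R).
    apply: (@asym0_ext _ (fun x => cexp (al * lam) * \sum_(j < K) \sum_(r < j.+1) co j r *
        (pow1p al x * ln1p x ^+ r * esum_expo (lam + ln1p x) (cP j))) _ (fun k =>
        cexp (al * lam) * \sum_(j < K) \sum_(r < j.+1) co j r *
        cauchy (cauchy (cbin al) (logpow R r)) (fun k => J j (k%:Z - T%:Z)) k)).
    - move=> x _; rewrite -main mulrDr cexpD -/(pow1p al x) -mulrA; congr (_ * _).
      rewrite mulr_sumr; apply: eq_bigr => j _; rewrite exprDn !mulr_suml mulr_sumr.
      apply: eq_bigr => -[r /= rj] _; rewrite /co -mulr_natr.
      have := bin_fact (rj : (r <= j)%N) => /(congr1 (fun n => n%:R : C)).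
      rewrite !natrM => <-.
      have b0 : ('C(j, r)%:R : C) != 0 by rewrite pnatr_eq0 -lt0n bin_gt0.
      have f0 i : (i`!%:R : C) != 0 by rewrite pnatr_eq0 -lt0n fact_gt0.
      by field; rewrite !f0 b0.
    - move=> n; rewrite /twisted_iterate; congr (_ * _); apply: eq_bigr => j _.
      by apply: eq_bigr => r _; rewrite (conv_cauchy _ n (vJ j)).
    apply: asym0Z; apply: asym0_sum => j; apply: asym0_sum => r; apply: asym0Z.
    have [_ _ hj _] := hT j (ltnW (ltn_ord j)).
    exact: asym0M (asym0M (asym0_pow1p al) (asym0_ln1pX R r)) hj.
  exact: (congr1 (@^~ k) (asym0_unique A2 A1)).
apply: (@residue_theorem _ _ _ _ T sm (D 0%N) m0 m1 (- T%:Z)) => //.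
- move=> n hn; rewrite /twisted_iterate big1 ?mulr0 // => j _; rewrite big1 // => r _.
  by rewrite (conv_below _ (vJ j) hn) mulr0.
- rewrite -(Dsum 0%N); apply/funext => m; rewrite -!iter_mulzB1e_int.
  by have [_ -> _ _] := hT 0%N (leq0n K).
- apply/funext => n; have -> : iter T (@mulz R) twisted_iterate n = twisted_iterate (n - T%:Z).
    elim: T n {hT cP cP0 fs hsm cPlog cPint D E esumE main Dsum key vJ} => [|T IH] n.
      by rewrite subr0.
    by rewrite iterS /mulz IH; congr twisted_iterate; lia.
  have [n0|n0] := leP 0 n; first by rewrite -{1}(gez0_abs n0) key.
  rewrite [RHS]big1 => [|i _]; last by rewrite mulr0.
  rewrite /twisted_iterate big1 ?mulr0 // => j _; rewrite big1 // => r _.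
  by rewrite (conv_below _ (vJ j)) ?mulr0 //; lia.
Qed.

End AnalyticCore.

(** * The Jacobi identity for matrix coefficients *)

(** Supplies the finite sets of terms that [asym_of_sum] and [asym0_of_sum] require. *)
Lemma box_seq (I : choiceType) (f : int -> nat -> nat -> I) (m1 m2 : int) (K : nat)
    (L : int -> nat) : exists2 F : seq I, uniq F &
  forall m k l, m1 <= m <= m2 -> (k < K)%N -> (l < L m)%N -> f m k l \in F.
Proof.
exists (undup (flatten [seq flatten [seq [seq f (j%:Z + m1) k l | l <- iota 0 (L (j%:Z + m1))]
  | k <- iota 0 K] | j <- iota 0 (absz (m2 - m1)%R).+1])); first exact: undup_uniq.
move=> m k l hm hk hl; rewrite mem_undup; have em : (absz (m - m1)%R)%:Z + m1 = m by lia.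
apply/flattenP; eexists; first by apply/mapP; exists (absz (m - m1)%R); rewrite ?mem_iota //; lia.
rewrite em; apply/flattenP; eexists; first by apply/mapP; exists k; rewrite ?mem_iota.
by apply/mapP; exists l; rewrite ?mem_iota.
Qed.

Section RealToComplex.
Variable R : realType.

Lemma ltc1 (x : R) : ((x%:C%C : R[i]) < 1) = (x < 1).
Proof. exact: (ltcR x 1). Qed.

Lemma gtc1 (x : R) : (1 < (x%:C%C : R[i])) = (1 < x).
Proof. exact: (ltcR 1 x). Qed.

Lemma gtc0 (x : R) : (0 < (x%:C%C : R[i])) = (0 < x).
Proof. exact: (ltcR 0 x). Qed.

End RealToComplex.

Section ConvSums.
Variable R : realType.
Local Notation C := R[i].
Implicit Types (c : nat -> C) (b : int -> C) (N : int).

Lemma conv_local c b b' N : (forall y, y <= N -> b y = b' y) -> conv c b N = conv c b' N.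
Proof. by move=> e; apply: eq_fsbigr => k _; rewrite e //; lia. Qed.

Lemma conv_vanish c b n0 : vanish_below b n0 -> vanish_below (conv c b) n0.
Proof. by move=> hb n hn; exact: conv_below hn. Qed.

Lemma vanish_sum (I : finType) (F : I -> int -> C) n0 : (forall i, vanish_below (F i) n0) ->
  vanish_below (fun n => \sum_i F i n) n0.
Proof. by move=> h n hn; rewrite big1 // => i _; exact: h. Qed.

Lemma vanishZ a b n0 : vanish_below b n0 -> vanish_below (fun n => a * b n) n0.
Proof. by move=> h n hn; rewrite h ?mulr0. Qed.

Lemma convZ c a b n0 N : vanish_below b n0 -> conv c (fun n => a * b n) N = a * conv c b N.
Proof.
move=> hb; have [L hL] := conv_ex_bound N n0.
rewrite (convE _ (vanishZ a hb) hL) (convE _ hb hL) mulr_sumr.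
by apply: eq_bigr => k _; rewrite mulrCA.
Qed.

Lemma conv_ord_sum (I : finType) c (F : I -> int -> C) n0 N :
  (forall i, vanish_below (F i) n0) ->
  conv c (fun n => \sum_i F i n) N = \sum_i conv c (F i) N.
Proof.
move=> hF; have [L hL] := conv_ex_bound N n0.
rewrite (convE _ (vanish_sum hF) hL).
rewrite (eq_bigr (fun i => \sum_(k < L) c k * F i (N - k%:Z))); last first.
  by move=> i _; rewrite (convE _ (hF i) hL).
by rewrite exchange_big /=; apply: eq_bigr => k _; rewrite mulr_sumr.
Qed.

End ConvSums.

(** By weights, the exponents in a product lie on a line [e1 + e2 = d]; by monodromy, [e1]
    lies in a coset of the integers. So there are finitely many terms up to each order, as
    [asym_of_sum] requires. *)
Lemma asym_line (R : realType) (sg : R) (l0 d al : R[i]) (Ku L : nat) (m0 : R)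
    (a : (R[i] * nat) * (R[i] * nat) -> R[i]) (f : R -> R[i]) :
  `|sg| = 1 -> complex.Re l0 = 0 ->
  (forall t, 1 <= t -> has_abs_sum (fun i => a i * expo (l0 + (sg * t)%:C%C) i.1) (f t)) ->
  (forall i, a i != 0 -> [/\ i.2.1 = d - i.1.1, (i.2.2 < L)%N, (i.1.2 < Ku)%N &
    exists2 m : int, i.1.1 = m%:~R - al & sg * m%:~R <= m0]) ->
  asym sg l0 f (fun e => \sum_(l < L) a (e, (d - e.1, l : nat))).
Proof.
move=> sg1 hl0 hf fib.
have -> : (fun e => \sum_(l < L) a (e, (d - e.1, l : nat))) =
    fun e0 => \sum_(i \in [set i | i.1 = e0]) a i.
  apply/funext => e0.
  rewrite (@fsum_seq _ _ _ [seq (e0, (d - e0.1, l)) | l <- iota 0 L]).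
  - rewrite big_map (_ : iota 0 L = index_iota 0 L); last by rewrite /index_iota subn0.
    by rewrite big_mkord.
  - by rewrite map_inj_uniq ?iota_uniq // => x y [].
  - by move=> i /mapP[l _ ->].
  - case=> [e1 [c l]] /= -> /fib[/= -> hl _ _]; apply/mapP; exists l => //.
    by rewrite mem_iota.
apply: (@asym_of_sum _ _ sg l0 _ a fst Ku) => //.
  by move=> i /fib[_ _ /ltnW].
move=> K; pose X := Num.floor (`|m0| + `|K| + `|complex.Re al|) + 1.
have [F uF hF] := box_seq (fun m k l => (((m%:~R - al, k), (d - (m%:~R - al), l)) :
  (R[i] * nat) * (R[i] * nat))) (- X) X Ku (fun=> L).
exists F => // -[[b k] [c l]] /fib[/= -> hl hk [m -> hm]].
rewrite ReD ReN Re_int => hK; apply: hF => //.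
suff : `|m%:~R : R| <= X%:~R by rewrite ler_norml -rmorphN /= !ler_int.
have := floorD1_gt (`|m0| + `|K| + `|complex.Re al|); rewrite -/X => hX.
have -> : `|m%:~R : R| = `|sg * m%:~R| by rewrite normrM sg1 mul1r.
have h1 : `|sg * complex.Re al| = `|complex.Re al| by rewrite normrM sg1 mul1r.
have h2 := ler_norm (sg * complex.Re al); have h3 := ler_norm (- (sg * complex.Re al)).
have h4 := ler_norm m0; have h5 := ler_norm K.
have h6 := normr_ge0 m0; have h7 := normr_ge0 K.
rewrite normrN in h3; rewrite mulrBr in hK; rewrite ler_norml; apply/andP; split; lra.
Qed.

Section MatrixCoefficients.
Variables (R : realType) (V : lmodType R[i]) (A : vertex_superalgebra V).
Variables (g : {linear V -> V}) (hg : is_automorphism A g).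
Variables (W : lmodType R[i]) (M : twisted_module A g W).
Local Notation C := R[i].
Local Notation wt := (vsa_wt A).
Local Notation Y := (tw_Y M).
Local Notation gen := (gen_eigenspace (tw_L0 M)).
Variable B : R.
Hypothesis hB : forall n w, complex.Re n < B -> tw_weight M n w -> w = 0.
Variables (i0 : C * bool * C) (w' : {scalar W}).
Hypothesis hw' : forall i w, tw_gr M i w -> i != i0 -> w' w = 0.
Variables (h h' : int) (al be mu : C) (v : V) (w : W).
Hypotheses (hv : wt h' v) (vbe : eig_gr g be v) (hw : gen mu w).
Implicit Types (u : V) (x : W).

(** By weights, the exponents of the two variables in a product sum to [d]. *)
Let d : C := i0.1.1 - h%:~R / 2%:R - h'%:~R / 2%:R - mu.
Let sgn : C := (-1) ^+ (half_parity h && half_parity h').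

Lemma tw_log_bound k be' (y : V) : wt k y -> eig_gr g be' y ->
  exists L, forall x n l, (L <= l)%N -> Y y x (n, l) = 0.
Proof.
move=> hy ey; have [L hL] := Ng_nilpotent hg ey; exists L => x n l Ll.
by rewrite (tw_Y_logE hg M n l x hy ey) hL // (linf0 (tw_Y_linl M _ _)) scaler0.
Qed.

Lemma product_weight u e1 e2 : wt h u -> w' (Y u (Y v w e2) e1) != 0 -> e1.1 + e2.1 = d.
Proof.
case: e1 e2 => [a k] [b l] hu; apply: contraNeq => /= ne.
apply/eqP; apply: (homogeneous_Y hw' k hu (tw_Y_gen b l hv hw)).
by apply: contraNneq ne => ->; rewrite /d; apply/eqP; ring.
Qed.

Lemma opposite_product_weight u e1 e2 : wt h u -> w' (Y v (Y u w e1) e2) != 0 -> e1.1 + e2.1 = d.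
Proof.
case: e1 e2 => [a k] [b l] hu; apply: contraNeq => /= ne.
apply/eqP; apply: (homogeneous_Y hw' l hv (tw_Y_gen a k hu hw)).
by apply: contraNneq ne => ->; rewrite /d; apply/eqP; ring.
Qed.

Lemma iterate_weight u n e : wt h u -> w' (Y (vsa_Y A u v n) w e) != 0 -> e.1 = d - n%:~R.
Proof.
case: e => b l hu; apply: contraNeq => /= ne.
apply/eqP; apply: (homogeneous_Y hw' l (wt_Y n hu hv) hw).
apply: contraNneq ne => ->; rewrite -halfD /d; apply/eqP; ring.
Qed.

(** The weight of the coefficient of [x ^ n] increases with [n], and the weights of [W]
    are bounded below. *)
Lemma tw_lower k (y : V) mu' x (c : C) : wt k y -> gen mu' x ->
  exists m0 : int, forall (m : int) l, m < m0 -> Y y x (c + m%:~R, l) = 0.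
Proof.
move=> hy hx.
exists (Num.floor (B - complex.Re (c + k%:~R / 2%:R + mu'))) => m l hm.
apply: (gen_lower_bounded hB _ (tw_Y_gen (c + m%:~R) l hy hx)).
rewrite (_ : c + _ + _ + _ = c + k%:~R / 2%:R + mu' + m%:~R); last by ring.
rewrite ReD Re_int -ltrBrDl.
by apply: lt_le_trans (floor_le _); rewrite ltr_int.
Qed.

Lemma vsa_lower : exists m0 : int, forall u n, wt h u -> n < m0 -> vsa_Y A u v n = 0.
Proof.
have [k0 hk] := vsa_truncated A.
exists (- `|k0|%N%:Z - `|h|%N%:Z - `|h'|%N%:Z) => u n hu hn.
by apply: (hk (h + h' + 2 * n)); [lia|exact: wt_Y].
Qed.

Section Branch.
Variable p : int.
Local Notation lam := (twopii R * p%:~R).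

Lemma lbr1 : lbr p (1 : C) = lam.
Proof. by rewrite -[1]/(1%:C%C) lbr_real // ln1 addr0. Qed.

Lemma mon_at1 e : mon_at p 1 e = cexp (e.1 * lam) * lam ^+ e.2.
Proof. by rewrite /mon_at lbr1. Qed.

Lemma lbr_expR (x : R) : lbr p ((expR x)%:C%C : C) = lam + x%:C%C.
Proof. by rewrite lbr_real ?expR_gt0 // expRK. Qed.

Lemma Re_lam : complex.Re lam = 0.
Proof. by rewrite intC ReM_real /twopii /= mul0r. Qed.

Lemma cexp_lam_int (m : int) : cexp (m%:~R * lam) = 1.
Proof. by rewrite mulrCA -intrM cexp_twopii_int. Qed.

Variable L : nat.
Hypothesis hL : forall x n l, (L <= l)%N -> Y v x (n, l) = 0.

(** The coefficients of the three series of the duality property at [z_2 = 1] on the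
    branch [p]: the first two as functions of the exponent of [z_1] and [log z_1], the
    third of the exponent of [z_1 - 1]. *)
Definition product_coef u (e : C * nat) : C :=
  \sum_(l < L) w' (Y u (Y v w (d - e.1, l : nat)) e) * mon_at p 1 (d - e.1, l : nat).

Definition opposite_coef u (e : C * nat) : C :=
  \sum_(l < L) sgn * (w' (Y v (Y u w e) (d - e.1, l : nat)) * mon_at p 1 (d - e.1, l : nat)).

Definition iterate_coef u (n : int) : C :=
  \sum_(l \in [set: nat]) w' (Y (vsa_Y A u v n) w (d - n%:~R, l)) * mon_at p 1 (d - n%:~R, l).

Lemma asym_product u (f : C -> C) : wt h u -> eig_gr g al u ->
  (forall z, 1 < `|z| -> has_abs_sum (fun e : (C * nat) * (C * nat) =>
     w' (Y u (Y v w e.2) e.1) * mon_at p z e.1 * mon_at p 1 e.2) (f z)) ->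
  asym 1 lam (fun t => f (expR (1 * t))%:C%C) (product_coef u).
Proof.
move=> hu ual hf; have [Ku hKu] := tw_log_bound hu ual.
have [m0 hm0] := tw_lower (d + al) hv hw.
apply: (@asym_line _ 1 lam d al Ku L (- m0%:~R)
  (fun i => w' (Y u (Y v w i.2) i.1) * mon_at p 1 i.2)).
- by rewrite normr1.
- exact: Re_lam.
- move=> t t1; have := hf (expR (1 * t))%:C%C.
  rewrite (_ : (fun e => _) = fun i => w' (Y u (Y v w i.2) i.1) * mon_at p 1 i.2 *
    expo (lam + (1 * t)%:C%C) i.1); last first.
    by apply/funext => e; rewrite /expo -lbr_expR /mon_at; ring.
  apply; rewrite normcE normc_real gtr0_norm ?expR_gt0 // gtc1.
  by rewrite -[ltLHS]expR0 ltr_expR mul1r; apply: lt_le_trans t1.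
move=> [[b k] [c l]] /= nz0.
have nz : w' (Y u (Y v w (c, l)) (b, k)) != 0.
  by apply: contraNneq nz0 => ->; rewrite mul0r.
have ec := product_weight hu nz; rewrite /= in ec.
have e2 : c = d - b by rewrite -ec addrC addKr.
have hl : (l < L)%N.
  by rewrite ltnNge; apply: contraNN nz => Ll; rewrite hL // (linf0 (tw_Y_linr M _ _)) linear0.
have hk : (k < Ku)%N by rewrite ltnNge; apply: contraNN nz => Kk; rewrite hKu // linear0.
have [m em] : exists m : int, b = m%:~R - al.
  apply: (tw_exponent (M := M) hg (k := k) (w := Y v w (c, l)) hu ual).
  by apply: contraNneq nz => ->; rewrite linear0.
split=> //; exists m => //; rewrite mul1r -rmorphN ler_int leNgt; apply: contraNN nz => hm.
rewrite e2 em (_ : d - (m%:~R - al) = d + al + (- m)%:~R); last by rewrite rmorphN /=; ring.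
by rewrite hm0 ?(linf0 (tw_Y_linr M _ _)) ?linear0 //; lia.
Qed.

Lemma asym_opposite u (f : C -> C) : wt h u -> eig_gr g al u ->
  (forall z, 0 < `|z| < 1 -> has_abs_sum (fun e : (C * nat) * (C * nat) =>
     sgn * (w' (Y v (Y u w e.1) e.2) * mon_at p z e.1 * mon_at p 1 e.2)) (f z)) ->
  asym (- 1) lam (fun t => f (expR (- 1 * t))%:C%C) (opposite_coef u).
Proof.
move=> hu ual hf; have [Ku hKu] := tw_log_bound hu ual.
have [m0 hm0] := tw_lower (- al) hu hw.
apply: (@asym_line _ (- 1) lam d al Ku L (- m0%:~R)
  (fun i => sgn * (w' (Y v (Y u w i.1) i.2) * mon_at p 1 i.2))).
- by rewrite normrN1.
- exact: Re_lam.
- move=> t t1; have := hf (expR (- 1 * t))%:C%C.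
  rewrite (_ : (fun e => _) = fun i => sgn * (w' (Y v (Y u w i.1) i.2) * mon_at p 1 i.2) *
    expo (lam + (- 1 * t)%:C%C) i.1); last first.
    by apply/funext => e; rewrite /expo -lbr_expR /mon_at; ring.
  apply; rewrite normcE normc_real gtr0_norm ?expR_gt0 // gtc0 ltc1 expR_gt0.
  by rewrite -[ltRHS]expR0 ltr_expR mulN1r oppr_lt0; apply: lt_le_trans t1.
move=> [[b k] [c l]] /= nz0.
have nz : w' (Y v (Y u w (b, k)) (c, l)) != 0.
  by apply: contraNneq nz0 => ->; rewrite mul0r mulr0.
have ec := opposite_product_weight hu nz; rewrite /= in ec.
have e2 : c = d - b by rewrite -ec addrC addKr.
have hl : (l < L)%N by rewrite ltnNge; apply: contraNN nz => Ll; rewrite hL // linear0.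
have nzu : Y u w (b, k) != 0.
  by apply: contraNneq nz => ->; rewrite (linf0 (tw_Y_linr M _ _)) linear0.
have hk : (k < Ku)%N by rewrite ltnNge; apply: contraNN nzu => Kk; rewrite hKu.
have [m em] := tw_exponent (M := M) hg hu ual nzu.
split=> //; exists m => //; rewrite mulN1r lerN2 ler_int leNgt; apply: contraNN nzu => hm.
by rewrite em addrC hm0.
Qed.

(** For real [z > 1] both arguments are 0, so the condition on arguments in the duality
    property holds for all of the [z] that are used. *)
Lemma iterate_coef_asym u (f : C -> C) : wt h u ->
  (forall z, 0 < `|z - 1| < 1 -> carg z = 0 -> has_abs_sum (fun e : int * (C * nat) =>
     w' (Y (vsa_Y A u v e.1) w e.2) * (z - 1) ^ e.1 * mon_at p 1 e.2) (f z)) ->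
  exists T0 : nat, forall T, (T0 <= T)%N ->
    asym0 (fun x : R => x%:C%C ^+ T * f (1 + x)%:C%C) (fun k => iterate_coef u (k%:Z - T%:Z)) /\
    vanish_below (iterate_coef u) (- T%:Z).
Proof.
move=> hu hf; have [m0 hm0] := vsa_lower; exists `|m0|%N => T hT.
have low n e : n < - T%:Z -> w' (Y (vsa_Y A u v n) w e) = 0.
  by move=> hn; rewrite (hm0 _ _ hu) ?(linf0 (tw_Y_linl M _ _)) ?linear0 //; lia.
split; last first.
  by move=> n hn; rewrite /iterate_coef (@fsumE _ _ _ [::]) ?big_nil // => l; rewrite low ?mul0r ?eqxx.
pose a (i : int * (C * nat)) := w' (Y (vsa_Y A u v i.1) w i.2) * mon_at p 1 i.2.
have [L' hL'] : exists L' : int -> nat, forall n l, (L' n <= l)%N ->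
    Y (vsa_Y A u v n) w (d - n%:~R, l) = 0.
  have H n : exists L', forall l, (L' <= l)%N -> Y (vsa_Y A u v n) w (d - n%:~R, l) = 0.
    by have [K hK] := tw_Y_log M (vsa_Y A u v n) w; exists K.+1 => l; exact: hK.
  by have [L' hL'] := choice H; exists L'.
have fib i : a i != 0 -> [/\ - T%:Z <= i.1, i.2.1 = d - i.1%:~R & (i.2.2 < L' i.1)%N].
  case: i => [n [b l]] nz0.
  have nz : w' (Y (vsa_Y A u v n) w (b, l)) != 0.
    by apply: contraNneq nz0 => h0; rewrite /a /= h0 mul0r.
  have /= eb := iterate_weight hu nz; split => //=.
    by rewrite leNgt; apply: contraNN nz => hn; rewrite low.
  by rewrite ltnNge; apply: contraNN nz => hl; rewrite eb hL' // linear0.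
have -> : (fun k : nat => iterate_coef u (k%:Z - T%:Z)) =
    fun k => \sum_(i \in [set i | i.1 = k%:Z - T%:Z]) a i.
  apply/funext => k; set n := k%:Z - T%:Z.
  rewrite (@fsum_seq _ _ _ [seq (n, (d - n%:~R, l)) | l <- iota 0 (L' n)]).
  - rewrite big_map /iterate_coef (@fsumE _ _ _ (iota 0 (L' n))) ?iota_uniq // => l.
    rewrite mem_iota /= add0n; apply: contraNT; rewrite -leqNgt => hl.
    by rewrite hL' // linear0 mul0r.
  - by rewrite map_inj_uniq ?iota_uniq // => x y [].
  - by move=> i /mapP[l _ ->].
  - case=> [n' [c l]] /= -> /fib[/= _ -> hl]; apply/mapP; exists l => //.
    by rewrite mem_iota.
apply: (@asym0_of_sum _ _ (fun x : R => f (1 + x)%:C%C) a fst T).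
- move=> x /andP[x0 x1].
  have z1 : ((1 + x)%:C%C - 1 : C) = x%:C%C by rewrite rmorphD addrC addKr.
  have := hf (1 + x)%:C%C; rewrite z1.
  rewrite (_ : (fun e => _) = fun i => a i * x%:C%C ^ i.1); last first.
    by apply/funext => e; rewrite /a; ring.
  apply; last by rewrite carg_real //; lra.
  by rewrite normcE normc_real gtr0_norm // gtc0 ltc1 x0 /=; lra.
- by move=> i /fib[].
- move=> K; have [F uF hF] := box_seq (fun n (_ : nat) l => (n, (d - n%:~R, l)) : int * (C * nat))
    (- T%:Z) K 1 L'.
  exists F => // -[n [b l]] /fib[/= h1 -> hl] hn.
  by apply: (hF n 0%N l) => //; rewrite h1 ltW.
Qed.

(** Multiplied by [(z - 1) ^ t0], the common function is a finite sum of generalized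
    monomials. By uniqueness, this sum is also the expansion at infinity and at 0. *)
Lemma duality_same_function u : wt h u -> eig_gr g al u -> exists T0, forall T, (T0 <= T)%N ->
  same_function p (product_coef u) (opposite_coef u) (iterate_coef u) T.
Proof.
move=> hu ual.
have gd : graded_dual (tw_gr M) w' := homogeneous_graded_dual hw'.
have [N [a [m [n [t0 [_ dual]]]]]] := tw_duality w (wt_parity hu) (wt_parity hv) gd.
pose I := (('I_N.+1 * 'I_N.+1) * 'I_N.+1 * 'I_N.+1)%type.
pose co (i : I) := a i.1.1.1 i.1.1.2 i.1.2 i.2 * mon_at p 1 (n i.1.1.2, i.2 : nat).
pose E (i : I) := (m i.1.1.1, i.1.2 : nat).
have [fc ec] := esum_ord E co; set cP := (fun e => _) in fc ec.
pose f z := esum_expo (lbr p z) cP * (z - 1) ^- t0.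
have fE z : \sum_i \sum_j \sum_k \sum_l a i j k l * mon_at p z (m i, k : nat) *
    mon_at p 1 (n j, l : nat) * (z - 1) ^- t0 = f z.
  rewrite /f -ec mulr_suml pair_big pair_big pair_big /=.
  by apply: eq_bigr => i _; rewrite /co /E [mon_at p z _]/mon_at -/(expo _ _); ring.
have norm1 : `|(1 : C)| = 1 by exact: normr1.
have A1 := @asym_product u f hu ual.
have {}A1 : asym 1 lam (fun t => f (expR (1 * t))%:C%C) (product_coef u).
  apply: A1 => z hz; have [h1 _ _ _] := dual p z 1; rewrite -fE.
  by apply: h1; rewrite norm1 ltr01.
have A2 : asym (- 1) lam (fun t => f (expR (- 1 * t))%:C%C) (opposite_coef u).
  apply: asym_opposite => // z hz; have [_ h2 _ _] := dual p z 1; rewrite -fE.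
  by apply: h2; rewrite norm1.
have [T1 hT1] : exists T0 : nat, forall T, (T0 <= T)%N ->
    asym0 (fun x : R => x%:C%C ^+ T * f (1 + x)%:C%C) (fun k => iterate_coef u (k%:Z - T%:Z)) /\
    vanish_below (iterate_coef u) (- T%:Z).
  apply: iterate_coef_asym => // z hz cz; have [_ _ _ h4] := dual p z 1; rewrite -fE.
  apply: h4; first by rewrite norm1.
  by rewrite cz (carg_real ltr01) subr0 normr0 divr_gt0 // pi_gt0.
have key (sg : R) c : `|sg| = 1 -> asym sg lam (fun t => f (expR (sg * t))%:C%C) c ->
    iter t0 (@mulzB1e R) c = cP.
  move=> sg1 hc; have sg0 : sg != 0 by rewrite -normr_eq0 sg1 oner_neq0.
  apply: (asym_unique sg0 (asym_mulzB1 t0 hc)).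
  apply: asym_eq (asym_esum sg lam fc) => t t1.
  rewrite /f lbr_expR cexpD cexp_twopii_int mul1r cexp_real mulrCA divff ?mulr1 //.
  rewrite expf_neq0 // subr_eq0 eq_complex /= negb_and; apply/orP; left.
  rewrite -[X in _ == X]expR0 (inj_eq (@expR_inj R)) mulf_neq0 // gt_eqF //.
  exact: lt_le_trans t1.
have e1 := key 1 _ (normr1 _) A1; have e2 := key (-1) _ (normrN1 _) A2.
exists (maxn t0 T1) => T; rewrite geq_max => /andP[tT TT].
have iT c : iter t0 (@mulzB1e R) c = cP ->
    iter T (@mulzB1e R) c = iter (T - t0) (@mulzB1e R) cP.
  by move=> <-; rewrite -iterD subnK.
rewrite /same_function (iT _ e1) (iT _ e2).
have [hT2 hT3] := hT1 T TT; split => //.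
  by have [] := esum_iter 0 (T - t0) fc.
apply: asym0_ext hT2 => // x /andP[x0 x1].
have [_ ->] := esum_iter (lam + ln1p x) (T - t0) fc.
have z1 : ((1 + x)%:C%C - 1 : C) = x%:C%C by rewrite rmorphD addrC addKr.
have xp : 0 < 1 + x by apply: ltr_wpDr => //; exact: ltW.
rewrite cexpD cexp_twopii_int mul1r cexp_real lnK // /f lbr_real // z1.
rewrite -{1}(subnK tT) exprD -mulrA; congr (_ * _); rewrite mulrCA divff ?mulr1 //.
by rewrite expf_neq0 // eq_complex /= negb_and gt_eqF.
Qed.

Lemma branch_residue u K : wt h u -> eig_gr g al u ->
  (forall q, (K <= q)%N -> iter q (Ng g) u = 0) ->
  residue_thm (fun m => product_coef u (m%:~R - al, 0%N))
    (fun m => opposite_coef u (m%:~R - al, 0%N))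
    (twisted_iterate p al (fun q => iterate_coef (iter q (Ng g) u)) K).
Proof.
move=> hu ual hK.
have uq q : wt h (iter q (Ng g) u) := iter_Ng_wt hg q ual hu.
have eq q : eig_gr g al (iter q (Ng g) u) := iter_Ng_eig hg q ual.
have [m0 hm0] := tw_lower (d + al) hv hw; have [m1 hm1] := tw_lower (- al) hu hw.
apply: (@expansions_residue _ p al (fun q => product_coef (iter q (Ng g) u))
  (fun q => opposite_coef (iter q (Ng g) u)) _ K _ _ _ _ m0 m1).
- move=> q a k; rewrite /product_coef mulr_sumr; apply: eq_bigr => l _.
  by rewrite (tw_Y_logE hg M a k _ (uq q) (eq q)) linearZ /= addnC iterD -!mulrA.
- move=> q [a k] /=; rewrite /product_coef /= => nz.
  suff [l nl] : exists l, w' (Y (iter q (Ng g) u) (Y v w (d - a, l)) (a, k)) != 0.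
    apply: (tw_exponent (M := M) hg (k := k) (w := Y v w (d - a, l)) (uq q) (eq q)).
    by apply: contraNneq nl => ->; rewrite linear0.
  apply: contrapT => nl; move: nz; rewrite big1 ?eqxx // => l _.
  have [->|h0] := eqVneq (w' (Y (iter q (Ng g) u) (Y v w (d - a, l : nat)) (a, k))) 0.
    by rewrite mul0r.
  by case: nl; exists l.
- move=> q qK; apply/funext => e; rewrite /product_coef big1 // => l _.
  by rewrite hK // (linf0 (tw_Y_linl M _ _)) linear0 mul0r.
- by move=> q; exact: duality_same_function.
- move=> j hj; rewrite /product_coef big1 // => l _ /=.
  rewrite (_ : d - ((- j)%:~R - al) = d + al + j%:~R); last by rewrite rmorphN /=; ring.
  by rewrite hm0 // (linf0 (tw_Y_linr M _ _)) linear0 mul0r.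
- move=> j hj; rewrite /opposite_coef big1 // => l _ /=.
  by rewrite [_ - al]addrC hm1 // (linf0 (tw_Y_linr M _ _)) linear0 mul0r mulr0.
Qed.

End Branch.

(** The coefficients of [(log x_2) ^ l], for the power 0 of [log x_1]; [tw_Y_logE]
    recovers the other powers of [log x_1]. *)
Definition product_mc u l (m : int) : C :=
  w' (Y u (Y v w (d - (m%:~R - al), l)) (m%:~R - al, 0%N)).
Definition opposite_mc u l (m : int) : C :=
  sgn * w' (Y v (Y u w (m%:~R - al, 0%N)) (d - (m%:~R - al), l)).
Definition iterate_mc u l (n : int) : C := w' (Y (vsa_Y A u v n) w (d - n%:~R, l)).

(** Both sides of the residue identity are polynomials in [lambda = 2 pi i p] and
    agree for every [p], so their coefficients agree; these are the coefficients of
    the powers of [log x_2]. *)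
Lemma jacobi_mc u K (n m : int) l : wt h u -> eig_gr g al u ->
  (forall q, (K <= q)%N -> iter q (Ng g) u = 0) ->
  coef_inf n m (product_mc u l) - coef_0 n m (opposite_mc u l) =
  \sum_(q < K) \sum_(r < q.+1) if (q - r <= l)%N
    then ((q - r)`!%:R * r`!%:R)^-1 * coef_1 n m (conv (cauchy (cbin al) (logpow R r))
           (iterate_mc (iter q (Ng g) u) (l - (q - r))%N)) else 0.
Proof.
move=> hu ual hK.
have uq q : wt h (iter q (Ng g) u) := iter_Ng_wt hg q ual hu.
have [L [lL hL]] : exists L, (l < L)%N /\ forall x n l, (L <= l)%N -> Y v x (n, l) = 0.
  have [L0 hL0] := tw_log_bound hv vbe; exists (maxn L0 l.+1); split; first by rewrite leq_maxr.
  by move=> x a k; rewrite geq_max => /andP[hk _]; exact: hL0.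
pose N0 := - n - 1.
have [j0 hj0] : exists j0, forall q k, vanish_below (iterate_mc (iter q (Ng g) u) k) j0.
  have [j0 hj0] := vsa_lower; exists j0 => q k y hy.
  by rewrite /iterate_mc (hj0 _ _ (uq q)) // (linf0 (tw_Y_linl M _ _)) linear0.
have [L' [lL' hL']] : exists L', (l < L')%N /\ forall q (y : int) k, (q < K)%N -> y <= N0 -> (L' <= k)%N ->
    iterate_mc (iter q (Ng g) u) k y = 0.
  have [f hf] : exists f : nat * int -> nat, forall e k, (f e <= k)%N ->
      iterate_mc (iter e.1 (Ng g) u) k e.2 = 0.
    have H (e : nat * int) : exists L0, forall k, (L0 <= k)%N ->
        iterate_mc (iter e.1 (Ng g) u) k e.2 = 0.
      have [L0 hL0] := tw_Y_log M (vsa_Y A (iter e.1 (Ng g) u) v e.2) w.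
      by exists L0.+1 => k hk; rewrite /iterate_mc hL0 ?linear0.
    by have [f hf] := choice H; exists f.
  pose D := (absz (N0 - j0)%R).+1.
  exists (maxn l.+1 (\max_(q < K) \max_(j < D) f (q : nat, (j0 + j%:Z)%R))).
  split; first by rewrite leq_maxl.
  move=> q y k qK hy; rewrite geq_max => /andP[_ hk].
  have [yj|jy] := ltP y j0; first exact: hj0.
  apply: (hf (q, y)); apply: leq_trans hk.
  apply: leq_trans (leq_bigmax (F := fun q : 'I_K => \max_(j < D) f (q : nat, (j0 + j%:Z)%R)) (Ordinal qK)).
  have yD : (absz (y - j0)%R < D)%N by rewrite /D; lia.
  apply: leq_trans (leq_bigmax (F := fun j : 'I_D => f (q, (j0 + j%:Z)%R)) (Ordinal yD)).
  by rewrite /= (_ : j0 + _ = y) //; lia.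
pose X k := coef_inf n m (product_mc u k) - coef_0 n m (opposite_mc u k).
pose Z q r k := coef_1 n m (conv (cauchy (cbin al) (logpow R r))
  (iterate_mc (iter q (Ng g) u) k)) / ((q - r)`!%:R * r`!%:R).
(* The exponents of [x_2] differ from [d + al], or [d], by integers, so the powers of
   [z_2 = 1] on the branch [p] contribute a common nonzero factor. *)
have main (p : int) : let lam := twopii R * p%:~R in \sum_(k < L) lam ^+ k * X k =
    \sum_(q < K) \sum_(r < q.+1) \sum_(k < L') lam ^+ (q - r + k) * Z q r k.
  move=> lam; have := branch_residue p hL hu ual hK n m.
  pose E := cexp ((d + al) * lam).
  have eE (j : int) : cexp ((d - (j%:~R - al)) * lam) = E.
    rewrite (_ : _ * lam = (d + al) * lam + (- j)%:~R * lam); last by rewrite rmorphN /=; ring.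
    by rewrite cexpD cexp_lam_int mulr1.
  have [m0 hm0] := tw_lower (d + al) hv hw; have [m1 hm1] := tw_lower (- al) hu hw.
  have e1 : (fun j : int => product_coef p L u (j%:~R - al, 0%N)) =
      fun j => \sum_(k < L) (E * lam ^+ k) * product_mc u k j.
    apply/funext => j; apply: eq_bigr => k _; rewrite mon_at1 /= eE mulrC //.
  have e2 : (fun j : int => opposite_coef p L u (j%:~R - al, 0%N)) =
      fun j => \sum_(k < L) (E * lam ^+ k) * opposite_mc u k j.
    apply/funext => j; apply: eq_bigr => k _; rewrite mon_at1 /= eE /opposite_mc; ring.
  have v1 (k : 'I_L) : vanish_below (fun j => product_mc u k (- j)) m0.
    move=> j hj; rewrite /product_mc.
    rewrite (_ : d - ((- j)%:~R - al) = d + al + j%:~R); last by rewrite rmorphN /=; ring.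
    by rewrite hm0 // (linf0 (tw_Y_linr M _ _)) linear0.
  have v2 (k : 'I_L) : vanish_below (opposite_mc u k) m1.
    move=> j hj; rewrite /opposite_mc [_ - al]addrC hm1 //.
    by rewrite (linf0 (tw_Y_linr M _ _)) linear0 mulr0.
  rewrite e1 e2 /coef_inf (conv_ord_sum _ _ (fun k => vanishZ _ (v1 k))).
  rewrite /coef_0 (conv_ord_sum _ _ (fun k => vanishZ _ (v2 k))).
  rewrite -sumrB (eq_bigr (fun k : 'I_L => E * (lam ^+ k * X k))); last first.
    by move=> k _; rewrite (convZ _ _ _ (v1 k)) (convZ _ _ _ (v2 k)) -mulrBr mulrA.
  rewrite -mulr_sumr => e3; apply: (mulfI (cexp_neq0 ((d + al) * lam))); rewrite -/E {}e3.
  rewrite /coef_1 (@conv_local _ _ _ (fun y => \sum_(q < K) \sum_(r < q.+1) \sum_(k < L')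
    (E * lam ^+ (q - r + k) / ((q - r)`!%:R * r`!%:R)) *
    conv (cauchy (cbin al) (logpow R r)) (iterate_mc (iter q (Ng g) u) k) y)); last first.
    move=> y hy; rewrite /twisted_iterate mulr_sumr; apply: eq_bigr => q _.
    rewrite mulr_sumr; apply: eq_bigr => r _.
    rewrite (@conv_local _ _ _ (fun y => \sum_(k < L') (cexp (d * lam) * lam ^+ k) *
      iterate_mc (iter q (Ng g) u) k y)); last first.
      move=> y' hy'; rewrite /iterate_coef (@fsumE _ _ _ (iota 0 L')) ?iota_uniq //; last first.
        move=> k; rewrite mem_iota /= add0n; apply: contraNT; rewrite -leqNgt => hk.
        have := hL' q y' k (ltn_ord q) (le_trans hy' hy) hk; rewrite /iterate_mc => ->.
        by rewrite mul0r.
      rewrite (_ : iota 0 L' = index_iota 0 L'); last by rewrite /index_iota subn0.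
      rewrite big_mkord; apply: eq_bigr => k _; rewrite mon_at1 /= /iterate_mc -/lam.
      rewrite (_ : (d - y'%:~R) * lam = d * lam + (- y')%:~R * lam); last by rewrite rmorphN /=; ring.
      by rewrite cexpD cexp_lam_int mulr1 mulrC.
    rewrite (conv_ord_sum _ _ (fun k : 'I_L' => vanishZ _ (hj0 q k))) !mulr_sumr -/lam.
    apply: eq_bigr => k _; rewrite (convZ _ _ _ (hj0 q k)).
    have -> : E = cexp (d * lam) * cexp (al * lam) by rewrite /E mulrDl cexpD.
    move: (conv _ _ y) (_^-1) => cv f; rewrite exprD.
    move: (cexp _) (cexp _) (lam ^+ (q - r)) (lam ^+ k) => c1 c2 l1 l2; ring.
  have vz (q r k : nat) : vanish_below (fun y => (E * lam ^+ (q - r + k) / ((q - r)`!%:R * r`!%:R)) *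
    conv (cauchy (cbin al) (logpow R r)) (iterate_mc (iter q (Ng g) u) k) y) j0.
    by apply: vanishZ; apply: conv_vanish; exact: hj0.
  rewrite (conv_ord_sum _ _ (fun q : 'I_K => vanish_sum (fun r : 'I_q.+1 =>
    vanish_sum (fun k : 'I_L' => vz q r k)))).
  rewrite mulr_sumr; apply: eq_bigr => q _.
  rewrite (conv_ord_sum _ _ (fun r : 'I_q.+1 => vanish_sum (fun k : 'I_L' => vz q r k))).
  rewrite mulr_sumr; apply: eq_bigr => r _.
  rewrite (conv_ord_sum _ _ (fun k : 'I_L' => vz q r k)) mulr_sumr; apply: eq_bigr => k _.
  rewrite (convZ _ _ _ (conv_vanish _ (hj0 q k))) /Z /coef_1; ring.
pose p1 := \sum_(k < L) X k *: 'X^k : {poly C}.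
pose p2 := \sum_(q < K) \sum_(r < q.+1) \sum_(k < L') Z q r k *: 'X^(q - r + k) : {poly C}.
have p12 : p1 = p2.
  apply/eqP; rewrite -subr_eq0; apply/eqP.
  apply: (@poly0_inj_roots _ (fun k => twopii R * k%:R)).
    by move=> a b /(mulfI (twopii_neq0 R)) /eqP; rewrite eqr_nat => /eqP.
  move=> p; rewrite hornerD hornerN; apply/eqP; rewrite subr_eq0; apply/eqP.
  have := main p%:Z; rewrite /= => E; rewrite /p1 /p2 !horner_sum.
  rewrite (eq_bigr (fun k : 'I_L => (twopii R * p%:R) ^+ k * X k)); last first.
    by move=> k _; rewrite hornerZ hornerXn mulrC.
  rewrite E; apply: eq_bigr => q _; rewrite horner_sum; apply: eq_bigr => r _.
  by rewrite horner_sum; apply: eq_bigr => k _; rewrite hornerZ hornerXn mulrC.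
have := congr1 (fun q : {poly C} => q`_l) p12.
rewrite /p1 /p2 !coef_sum (bigD1 (Ordinal lL)) //= big1 ?addr0; last first.
  move=> k /eqP nk; rewrite coefZ coefXn; case: eqP => [e|_]; last by rewrite mulr0.
  by case: nk; apply/val_inj.
rewrite coefZ coefXn eqxx mulr1 -/(X l) => ->; apply: eq_bigr => q _.
rewrite coef_sum; apply: eq_bigr => r _; rewrite coef_sum.
case: leqP => hl; last first.
  rewrite big1 // => k _; rewrite coefZ coefXn ltn_eqF ?mulr0 //.
  by apply: leq_trans hl _; exact: leq_addr.
have hk : (l - (q - r) < L')%N by apply: leq_ltn_trans lL'; exact: leq_subr.
rewrite (bigD1 (Ordinal hk)) //= big1 ?addr0; last first.
  move=> k /eqP nk; rewrite coefZ coefXn; case: eqP => [e|_]; last by rewrite mulr0.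
  by case: nk; apply/val_inj; rewrite /= e addKn.
by rewrite coefZ coefXn subnKC // eqxx mulr1 /Z mulrC.
Qed.

End MatrixCoefficients.

(** * Coefficients of formal series *)

Section Monomials.
Variable R : realType.
Local Notation C := R[i].
Local Notation X := (C * nat)%type.
Implicit Types (m : mono R) (e : X).

Definition mk e0 e1 e2 : mono R :=
  [ffun j => if j == x0 then e0 else if j == x1 then e1 else e2].

Lemma ord3 (j : 'I_3) : [\/ j = x0, j = x1 | j = x2].
Proof.
by case: j => [[|[|[|//]]] h]; [apply: Or31|apply: Or32|apply: Or33]; exact: val_inj.
Qed.

Lemma mkE m : m = mk (m x0) (m x1) (m x2).
Proof. by apply/ffunP => j; rewrite ffunE; case: (ord3 j) => ->. Qed.

Lemma mk_inj e0 e1 e2 f0 f1 f2 : mk e0 e1 e2 = mk f0 f1 f2 -> [/\ e0 = f0, e1 = f1 & e2 = f2].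
Proof.
move=> h; have := congr1 (fun m : mono R => (m x0, m x1, m x2)) h.
by rewrite !ffunE /= => -[-> -> ->].
Qed.

Lemma mkD e0 e1 e2 f0 f1 f2 : mk e0 e1 e2 + mk f0 f1 f2 = mk (e0 + f0) (e1 + f1) (e2 + f2).
Proof. by apply/ffunP => j; rewrite !ffunE; case: (ord3 j) => ->. Qed.

Lemma mono_at0 e : mono_at x0 e = mk e 0 0.
Proof. by apply/ffunP => j; rewrite !ffunE; case: (ord3 j) => ->. Qed.

Lemma mono_at1 e : mono_at x1 e = mk 0 e 0.
Proof. by apply/ffunP => j; rewrite !ffunE; case: (ord3 j) => ->. Qed.

Lemma mono_at2 e : mono_at x2 e = mk 0 0 e.
Proof. by apply/ffunP => j; rewrite !ffunE; case: (ord3 j) => ->. Qed.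

Lemma pairD (a b : C) (k l : nat) : ((a, k) : X) + (b, l) = (a + b, (k + l)%N).
Proof. by []. Qed.

Lemma pair0 : (0 : X) = (0, 0%N).
Proof. by []. Qed.

Lemma mono_at_inj i : injective (@mono_at R i).
Proof. by move=> e f /ffunP /(_ i); rewrite !ffunE eqxx. Qed.

Lemma fseries_at (T : nmodType) (I : choiceType) (c : I -> T) (mo : I -> mono R) i :
  injective mo -> fseries c mo (mo i) = c i.
Proof.
move=> mi; rewrite /fseries (@fsum_seq _ _ _ [:: i]) ?big_seq1 // => j.
  by rewrite inE => /eqP ->.
by move=> /mi -> _; rewrite inE.
Qed.

Lemma fseries_out (T : nmodType) (I : choiceType) (c : I -> T) (mo : I -> mono R) m :
  (forall i, mo i <> m) -> fseries c mo m = 0.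
Proof. by move=> h; rewrite /fseries fsbig1 // => i /h. Qed.

Lemma fseries_supp (T : nmodType) (I : choiceType) (c : I -> T) (mo : I -> mono R) m :
  fseries c mo m != 0 -> exists i, mo i = m.
Proof.
by move=> nz; apply: contrapT => h; move: nz; rewrite fseries_out ?eqxx // => i e; apply: h; exists i.
Qed.

Section Apply.
Variables (T U : nmodType) (F : T -> mono R -> U) (S : mono R -> T) (m : mono R).

(** Coefficients are computed by listing, without repetition, the pairs of monomials
    that contribute. *)
Lemma fapply_reindex (J : choiceType) (h : J -> mono R * mono R) : injective h ->
  (forall j, (h j).1 + (h j).2 = m) ->
  (forall p, p.1 + p.2 = m -> F (S p.1) p.2 != 0 -> exists j, h j = p) ->
  fapply F S m = \sum_(j \in [set: J]) F (S (h j).1) (h j).2.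
Proof.
move=> hi hm hp.
rewrite -(@fsbig_image _ _ _ _ _ [set: J] h (fun p => F (S p.1) p.2)); last by move=> x y _ _ /hi.
rewrite /fapply; apply/esym/fsbig_widen => [p [j _ <-]|p [/= pm np]]; first exact: hm.
apply/eqP/negPn/negP => nz; have [j e] := hp p pm nz.
by apply: np; exists j.
Qed.

Lemma fapply_eq0 : (forall p, p.1 + p.2 = m -> F (S p.1) p.2 = 0) -> fapply F S m = 0.
Proof. by move=> h; rewrite /fapply fsbig1. Qed.

Lemma fapply_finite (J : choiceType) (h : J -> mono R * mono R) :
  (forall p, p.1 + p.2 = m -> F (S p.1) p.2 != 0 -> exists j, h j = p) ->
  finite_set [set j | F (S (h j).1) (h j).2 != 0] ->
  finite_set [set p : mono R * mono R | p.1 + p.2 = m /\ F (S p.1) p.2 != 0].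
Proof.
move=> hp fin; apply: sub_finite_set (finite_image h fin) => p [pm nz].
by have [j e] := hp p pm nz; exists j => //=; rewrite e.
Qed.

End Apply.

(** Stated for three maps and three series, since a summand of [u] or [v] changes both
    the coefficients and the map that is applied to them. *)
Lemma fapply_add (T U : nmodType) (T1 T2 : nmodType) (F : T -> mono R -> U) S
    (F1 : T1 -> mono R -> U) S1 (F2 : T2 -> mono R -> U) S2 :
  (forall m m', F (S m) m' = F1 (S1 m) m' + F2 (S2 m) m') ->
  fapply_ok F1 S1 -> fapply_ok F2 S2 ->
  fapply_ok F S /\ fapply F S = fapply F1 S1 + fapply F2 S2.
Proof.
move=> e ok1 ok2; have ok : fapply_ok F S.
  move=> m; apply: (@sub_finite_set _ _ ([set p | p.1 + p.2 = m /\ F1 (S1 p.1) p.2 != 0] `|`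
    [set p | p.1 + p.2 = m /\ F2 (S2 p.1) p.2 != 0])); last by rewrite finite_setU.
  move=> p /= [pm]; rewrite e; have [->|nz] := eqVneq (F1 (S1 p.1) p.2) 0; last by left.
  by rewrite add0r; right.
split => //; apply/funext => m; rewrite -[RHS]/(fapply F1 S1 m + fapply F2 S2 m) /fapply.
pose A := ([set p | p.1 + p.2 = m /\ F1 (S1 p.1) p.2 != 0] `|`
    [set p : mono R * mono R | p.1 + p.2 = m /\ F2 (S2 p.1) p.2 != 0]).
have finA : finite_set A by rewrite finite_setU.
have wd (G : mono R * mono R -> U) : (forall p, ~ A p -> p.1 + p.2 = m -> G p = 0) ->
    \sum_(p \in [set p | p.1 + p.2 = m]) G p = \sum_(p \in A) G p.
  move=> hG; apply/esym/fsbig_widen => [p [[]|[]] //|p [/= pm np]]; exact: hG.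
have n1 p : ~ A p -> p.1 + p.2 = m -> F1 (S1 p.1) p.2 = 0.
  by move=> np pm; apply/eqP/negPn/negP => nz; apply: np; left.
have n2 p : ~ A p -> p.1 + p.2 = m -> F2 (S2 p.1) p.2 = 0.
  by move=> np pm; apply/eqP/negPn/negP => nz; apply: np; right.
have E1 := wd _ n1; have E2 := wd _ n2; rewrite E1 E2 wd; last by move=> p np pm; rewrite e n1 // n2 // addr0.
by rewrite -fsbig_split //; apply: eq_fsbigr => p _; rewrite e.
Qed.

Implicit Type r : nat.

(** The monomials [x_0 ^ i x_2 ^ (- i) (log x_1) ^ a (log x_2) ^ b]. *)
Definition mlog (i a b : nat) : mono R := mk (i%:R, 0%N) (0, a) (- i%:R, b).

Lemma mlog_inj i a b i' a' b' : mlog i a b = mlog i' a' b' -> [/\ i = i', a = a' & b = b'].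
Proof.
move=> /mk_inj[h1 h2 h3]; have := congr1 fst h1; move/eqP; rewrite /= eqr_nat => /eqP ->.
by have /= -> := congr1 snd h2; have /= -> := congr1 snd h3.
Qed.

Lemma mlogD i a b i' a' b' : mlog i a b + mlog i' a' b' = mlog (i + i')%N (a + a')%N (b + b')%N.
Proof. by rewrite /mlog mkD !pairD addr0 !natrD opprD. Qed.

(** [log ((x_2 + x_0) / x_1)] *)
Definition log_ratio : mono R -> C := flog x2 x0 - fmono (xlog R x1).

Lemma log_ratio_mlog i a b : log_ratio (mlog i a b) =
  if (a, b) == (0, 0)%N then logco R i
  else if (i, a, b) == (0, 0, 1)%N then 1
  else if (i, a, b) == (0, 1, 0)%N then - 1 else 0.
Proof.
have e1 : xlog R x1 = mlog 0 1 0 by rewrite /xlog mono_at1 /mlog oppr0.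
have e2 : xlog R x2 = mlog 0 0 1 by rewrite /xlog mono_at2 /mlog oppr0.
pose mo (k : nat) : mono R := xpow x2 (- k.+1%:R) + xpow x0 k.+1%:R.
have e3 k : mo k = mlog k.+1 0 0.
  by rewrite /mo /xpow mono_at2 mono_at0 mkD !addr0 !add0r.
have moi : injective mo by move=> x y; rewrite !e3 => /mlog_inj[[]].
have fm i' a' b' : fmono (mlog i' a' b') (mlog i a b) = ((i, a, b) == (i', a', b'))%:R.
  congr (_%:R); congr nat_of_bool; apply/eqP/eqP => [/mlog_inj[-> -> ->]//|[-> -> ->]//].
rewrite -[LHS]/(fmono (xlog R x2) (mlog i a b) + fseries _ mo (mlog i a b)
  - fmono (xlog R x1) (mlog i a b)) e1 e2 !fm.
have out : (forall k, mo k <> mlog i a b) ->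
    fseries (fun k : nat => (-1) ^+ k / k.+1%:R : C) mo (mlog i a b) = 0.
  exact: fseries_out.
case: i fm out => [|i] fm out.
  rewrite out; last by move=> k; rewrite e3 => /mlog_inj[].
  by case: a b {fm out} => [|[|a]] [|[|b]]; rewrite /= ?addr0 ?add0r ?subr0 ?oppr0.
case: (eqVneq (a, b) (0, 0)%N) => [[-> ->]|ab].
  by rewrite -e3 fseries_at // /= add0r subr0.
rewrite out ?addr0 ?subrr //.
by move=> k; rewrite e3 => /mlog_inj[_ e4 e5]; move: ab; rewrite -e4 -e5.
Qed.

Lemma log_ratio_supp m : log_ratio m != 0 -> exists i a b, m = mlog i a b.
Proof.
pose mo (k : nat) : mono R := xpow x2 (- k.+1%:R) + xpow x0 k.+1%:R.
rewrite -[log_ratio m]/(fmono (xlog R x2) m + fseries _ mo m - fmono (xlog R x1) m).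
rewrite /fmono; have [->|n2] := eqVneq m (xlog R x2).
  by move=> _; exists 0%N, 0%N, 1%N; rewrite /xlog mono_at2 /mlog oppr0.
have [->|n1] := eqVneq m (xlog R x1).
  by move=> _; exists 0%N, 1%N, 0%N; rewrite /xlog mono_at1 /mlog oppr0.
rewrite add0r subr0 => /fseries_supp[k <-]; exists k.+1, 0%N, 0%N.
by rewrite /mo /xpow mono_at2 mono_at0 mkD !addr0 !add0r.
Qed.

(** [q!] times the coefficient in the exponential series of
    [- log x_1 + log x_2 + log (1 + x_0 / x_2)]. *)
Definition multinom_log (q i a b : nat) : C :=
  if (a + b <= q)%N then
    q`!%:R / (a`!%:R * b`!%:R * (q - (a + b))`!%:R) * (-1) ^+ a * logpow R (q - (a + b)) i
  else 0.

(** One more factor raises the exponent of [x_0], of [log x_2] or of [log x_1]. *)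
Lemma multinom_logS q i a b : multinom_log q.+1 i a b =
  \sum_(j < i.+1) logco R j * multinom_log q (i - j) a b
  + (if b is b'.+1 then multinom_log q i a b' else 0)
  - (if a is a'.+1 then multinom_log q i a' b else 0).
Proof.
have f0 j : (j`!%:R : C) != 0 by rewrite pnatr_eq0 -lt0n fact_gt0.
have n0 j : (j.+1%:R : C) != 0 by rewrite pnatr_eq0.
pose L := logpow R (q.+1 - (a + b)) i.
have eb : (if b is b'.+1 then multinom_log q i a b' else 0) =
    if (a + b <= q.+1)%N then b%:R * (q`!%:R / (a`!%:R * b`!%:R * (q.+1 - (a + b))`!%:R)
      * (-1) ^+ a * L) else 0.
  rewrite /L; case: (b) => [|b']; first by rewrite mul0r; case: ifP.
  rewrite /multinom_log addnS ltnS subSS; case: ifP => // _.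
  by rewrite factS natrM; field; rewrite !f0 addrC natr1 n0.
have ea : (if a is a'.+1 then multinom_log q i a' b else 0) =
    if (a + b <= q.+1)%N then - (a%:R * (q`!%:R / (a`!%:R * b`!%:R * (q.+1 - (a + b))`!%:R)
      * (-1) ^+ a * L)) else 0.
  rewrite /L; case: (a) => [|a']; first by rewrite mul0r oppr0; case: ifP.
  rewrite /multinom_log addSn ltnS subSS; case: ifP => // _.
  by rewrite factS natrM exprS; field; rewrite !f0 addrC natr1 n0.
have er : \sum_(j < i.+1) logco R j * multinom_log q (i - j) a b =
    if (a + b <= q.+1)%N then (q.+1 - (a + b))%:R *
      (q`!%:R / (a`!%:R * b`!%:R * (q.+1 - (a + b))`!%:R) * (-1) ^+ a * L) else 0.
  have [hq|hq] := leqP (a + b) q; last first.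
    rewrite big1; last by move=> j _; rewrite /multinom_log leqNgt hq mulr0.
    by case: ifP => // hq'; rewrite (_ : q.+1 - (a + b) = 0)%N ?mul0r //; lia.
  rewrite leqW // /L subSn // -[logpow R _.+1 i]/(cauchy (logco R) (logpow R (q - (a + b))) i).
  rewrite /cauchy !mulr_sumr; apply: eq_bigr => j _; rewrite /multinom_log hq factS natrM.
  by field; rewrite !f0 addrC natr1 n0.
rewrite er eb ea /multinom_log; case: ifP => hq; last by rewrite subr0 addr0.
rewrite opprK -!mulrDl -!natrD.
rewrite (_ : (q.+1 - (a + b) + b + a = q.+1)%N); last by rewrite -addnA [(b + a)%N]addnC subnK.
by rewrite factS natrM /L; ring.
Qed.

Lemma fpow_log_ratio q : (forall i a b, fpow log_ratio q (mlog i a b) = multinom_log q i a b) /\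
  (forall m, fpow log_ratio q m != 0 -> exists i a b, m = mlog i a b).
Proof.
elim: q => [|q [IH1 IH2]].
  have e0 : (0 : mono R) = mlog 0 0 0.
    by apply/ffunP => j; rewrite !ffunE oppr0; case: (ord3 j) => ->.
  split=> [i a b|m].
    rewrite /fpow /= /fmono e0 /multinom_log leqn0 addn_eq0.
    have -> : (mlog i a b == mlog 0 0 0) = [&& a == 0, b == 0 & i == 0]%N.
      apply/eqP/and3P => [/mlog_inj[-> -> ->]//|[/eqP -> /eqP -> /eqP ->] //].
    case: a => [|a] //; case: b => [|b] //=; rewrite /logpow /=.
    by rewrite !fact0 !mul1r invr1 mulr1 mul1r.
  have [->|ne] := eqVneq m 0; first by exists 0%N, 0%N, 0%N.
  by rewrite -[fpow _ 0 m]/(fmono 0 m) /fmono (negbTE ne) eqxx.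
have supp m p : p.1 + p.2 = m -> log_ratio p.1 *: (fpow log_ratio q p.2 : C^o) != 0 ->
    exists i a b i' a' b', p = (mlog i a b, mlog i' a' b').
  case: p => p1 p2 /= _ nz.
  have [|i [a [b ->]]] := @log_ratio_supp p1.
    by apply: contraNneq nz => ->; rewrite scale0r.
  have [|i' [a' [b' ->]]] := IH2 p2.
    by apply: contraNneq nz => ->; rewrite scaler0.
  by exists i, a, b, i', a', b'.
split=> [i a b|m]; rewrite /fpow iterS -/(fpow _ _) /fmul; last first.
  move=> nz; apply: contrapT => nm; move: nz; rewrite fapply_eq0 ?eqxx // => p pm.
  apply/eqP/negPn/negP => nz; apply: nm.
  have [i [a [b [i' [a' [b' e]]]]]] := supp m p pm nz.
  by exists (i + i')%N, (a + a')%N, (b + b')%N; rewrite -pm e mlogD.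
pose r1 := [seq (mlog j 0 0, mlog (i - j) a b) | j <- iota 0 i.+1].
pose r2 := if b is b'.+1 then [:: (mlog 0 0 1, mlog i a b')] else [::].
pose r3 := if a is a'.+1 then [:: (mlog 0 1 0, mlog i a' b)] else [::].
have lr0 j : log_ratio (mlog j 0 0) = logco R j by rewrite log_ratio_mlog.
rewrite /fapply (@fsum_seq _ _ _ (r1 ++ r2 ++ r3)).
- rewrite !big_cat multinom_logS -addrA; congr (_ + _); last congr (_ + _).
  + rewrite big_map (_ : iota 0 i.+1 = index_iota 0 i.+1); last by rewrite /index_iota subn0.
    by rewrite big_mkord; apply: eq_bigr => j _; rewrite lr0 IH1.
  + rewrite /r2; case: (b) => [|b']; first by rewrite big_nil.
    by rewrite big_seq1 log_ratio_mlog IH1 /= scale1r.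
  + rewrite /r3; case: (a) => [|a']; first by rewrite big_nil oppr0.
    by rewrite big_seq1 log_ratio_mlog IH1 /= scaleN1r.
- rewrite !cat_uniq map_inj_uniq ?iota_uniq; last by move=> j j' [/mlog_inj[]].
  have h1 p : p \in r1 -> exists j, p.1 = mlog j 0 0 by move=> /mapP[j _ ->]; exists j.
  have h2 p : p \in r2 -> p.1 = mlog 0 0 1 by rewrite /r2; case: (b) => [|b'] //; rewrite inE => /eqP ->.
  have h3 p : p \in r3 -> p.1 = mlog 0 1 0 by rewrite /r3; case: (a) => [|a'] //; rewrite inE => /eqP ->.
  rewrite (_ : uniq r2); last by rewrite /r2; case: (b).
  rewrite (_ : uniq r3); last by rewrite /r3; case: (a).
  apply/and5P; split=> //; apply/hasPn => p.
    rewrite mem_cat => /orP[/h2|/h3] e; apply/negP => /h1[j]; rewrite e => /mlog_inj[] //.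
  by move=> /h3 e; apply/negP => /h2; rewrite e => /mlog_inj[].
- move=> p; rewrite !mem_cat => /or3P[/mapP[j]|hp|hp].
  + by rewrite mem_iota /= => hj -> /=; rewrite mlogD !add0n subnKC.
  + by move: hp; rewrite /r2; case: (b) => [|b'] //; rewrite inE => /eqP -> /=; rewrite mlogD !add0n add1n.
  + by move: hp; rewrite /r3; case: (a) => [|a'] //; rewrite inE => /eqP -> /=; rewrite mlogD !add0n add1n.
- move=> p pm nz; have [j [k [l [j' [k' [l' e]]]]]] := supp _ p pm nz.
  rewrite !mem_cat; move: pm nz; rewrite e -[_ _ (_, _)]/(mlog j k l + mlog j' k' l' = _) mlogD.
  move=> /mlog_inj[ei ea eb]; rewrite log_ratio_mlog.
  case: ((k, l) =P (0, 0)%N) => [[ek el] _|_].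
    apply/or3P; apply: Or31; apply/mapP; exists j; first by rewrite mem_iota /= add0n ltnS -ei leq_addr.
    by rewrite -ei -ea -eb ek el addKn.
  case: ((j, k, l) =P (0, 0, 1)%N) => [[ej ek el] _|_].
    by apply/or3P; apply: Or32; rewrite /r2 -ei -ea -eb ej ek el !add0n add1n inE.
  case: ((j, k, l) =P (0, 1, 0)%N) => [[ej ek el] _|_]; last by rewrite scale0r eqxx.
  by apply/or3P; apply: Or33; rewrite /r3 -ei -ea -eb ej ek el !add0n add1n inE.
Qed.

End Monomials.

Section PowerOfLogarithm.
Variables (R : realType) (V : lmodType R[i]) (A : vertex_superalgebra V).
Variable (g : {linear V -> V}).
Hypothesis hg : is_automorphism A g.
Local Notation C := R[i].
Local Notation N := (Ng g).
Implicit Types (u : V) (al : C) (m : mono R).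

Lemma fexp_mlog u K i a b : (forall q, (K <= q)%N -> iter q N u = 0) ->
  fexp (@log_ratio R) N u (mlog R i a b) = ((-1) ^+ a / (a`!%:R * b`!%:R)) *:
    \sum_(r < K) (logpow R r i / r`!%:R) *: iter (r + (a + b)) N u.
Proof.
move=> hK; have f0 j : (j`!%:R : C) != 0 by rewrite pnatr_eq0 -lt0n fact_gt0.
have hpow q := (fpow_log_ratio R q).1.
rewrite /fexp (@fsumE _ _ _ (index_iota 0 (K + (a + b)))) ?iota_uniq //; last first.
  move=> q; rewrite mem_index_iota /=; apply: contraNT; rewrite -leqNgt => hq.
  by rewrite hK ?scaler0 // (leq_trans _ hq) // leq_addr.
rewrite (@big_cat_nat _ _ _ (a + b)) ?leq_addl //= big_nat_cond big1 ?add0r; last first.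
  move=> q; rewrite andbT => /andP[_ hq].
  by rewrite hpow /multinom_log leqNgt hq mul0r scale0r.
have := big_addn 0 (K + (a + b)) (a + b) xpredT
  (fun q => (fpow (@log_ratio R) q (mlog R i a b) / q`!%:R) *: iter q N u).
rewrite add0n addnK => ->; rewrite big_mkord scaler_sumr; apply: eq_bigr => r _.
rewrite hpow /multinom_log leq_addl addnK scalerA; congr (_ *: _).
by field; rewrite !f0.
Qed.

Lemma fexp_supp u m : fexp (@log_ratio R) N u m != 0 -> exists i a b, m = mlog R i a b.
Proof.
move=> nz; apply: contrapT => h; move: nz; rewrite /fexp fsbig1 ?eqxx // => q _.
have [->|nq] := eqVneq (fpow (@log_ratio R) q m) 0; first by rewrite mul0r scale0r.
by case: h; have [_ h] := fpow_log_ratio R q; exact: h.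
Qed.

(** The monomials of [((x_2 + x_0) / x_1) ^ L_g u] for [u] in [V^[al]]. *)
Definition mpow al (i a b : nat) : mono R := mk (i%:R, 0%N) (- al, a) (al - i%:R, b).

Lemma mpow_inj al al' i a b i' a' b' : mpow al i a b = mpow al' i' a' b' ->
  [/\ al = al', i = i', a = a' & b = b'].
Proof.
move=> /mk_inj[h1 h2 h3]; have := congr1 fst h1; move/eqP; rewrite /= eqr_nat => /eqP ->.
have /= /oppr_inj -> := congr1 fst h2.
by have /= -> := congr1 snd h2; have /= -> := congr1 snd h3.
Qed.

Lemma mpowD al n i a b : mpow al n 0 0 + mlog R i a b = mpow al (n + i) a b.
Proof.
by rewrite /mpow /mlog mkD !pairD addr0 natrD opprD addrA !add0n.
Qed.

Local Notation prefix al :=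
  (@fmul R R[i]^o (fbinomial x2 x0 al) (fmono (xpow x1 (- al)))).

Lemma prefix_mpow al n : prefix al (mpow al n 0 0) = cbin al n.
Proof.
pose mo (k : nat) : mono R := xpow x2 (al - k%:R) + xpow x0 k%:R.
have moE k : mo k = mk (k%:R, 0%N) 0 (al - k%:R, 0%N).
  by rewrite /mo /xpow mono_at2 mono_at0 mkD !addr0 !add0r.
have moi : injective mo by move=> k l; rewrite !moE => /mk_inj[[/eqP]]; rewrite eqr_nat => /eqP.
have mE k : mo k + xpow x1 (- al) = mpow al k 0 0.
  by rewrite moE /xpow mono_at1 mkD !addr0 !add0r.
rewrite /fmul (@fapply_reindex _ _ _ _ _ _ unit (fun=> (mo n, xpow x1 (- al)))).
- rewrite (@fsumE _ _ _ [:: tt]) ?big_seq1 //=.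
  have -> : fbinomial x2 x0 al (mo n) = cbin al n := fseries_at (fun k => cbin al k) n moi.
  by rewrite /fmono eqxx; exact: mulr1.
- by move=> [] [].
- by move=> _ /=; exact: mE.
- move=> [p1 p2] /= pm nz; exists tt.
  have [k hk] : exists k, mo k = p1.
    by apply: (@fseries_supp R C _ (fun k => cbin al k)); apply: contraNneq nz => h0;
      rewrite /fbinomial h0 scale0r.
  have e2 : p2 = xpow x1 (- al).
    apply/eqP; apply: contraNT nz => h0; rewrite /fmono (negbTE h0); exact/eqP/mulr0.
  by move: pm; rewrite -hk e2 mE => /mpow_inj[_ -> _ _].
Qed.

Lemma prefix_supp al m : prefix al m != 0 -> exists n, m = mpow al n 0 0.
Proof.
move=> nz; apply: contrapT => nm; move: nz; rewrite /fmul fapply_eq0 ?eqxx // => -[p1 p2] /= pm.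
apply/eqP/negPn/negP => nz; apply: nm.
pose mo (k : nat) : mono R := xpow x2 (al - k%:R) + xpow x0 k%:R.
have [k hk] : exists k, mo k = p1.
  by apply: (@fseries_supp R C _ (fun k => cbin al k)); apply: contraNneq nz => h0;
    rewrite /fbinomial h0 scale0r.
have e2 : p2 = xpow x1 (- al).
  apply/eqP; apply: contraNT nz => h0; rewrite /fmono (negbTE h0); exact/eqP/mulr0.
exists k; rewrite -pm -hk e2 /mo /xpow mono_at2 mono_at0 mono_at1 !mkD !addr0 !add0r //.
Qed.

(** Here [N ^ K u = 0] is intended, so that the sum over [r] is the whole series. *)
Definition power_coef al K (i a b : nat) u : V := ((-1) ^+ a / (a`!%:R * b`!%:R)) *:
  \sum_(r < K) (cauchy (cbin al) (logpow R r) i / r`!%:R) *: iter (r + (a + b)) N u.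

Lemma power_at al K u i a b : (forall q, (K <= q)%N -> iter q N u = 0) ->
  fmul (prefix al) (fexp (@log_ratio R) N u) (mpow al i a b) = power_coef al K i a b u.
Proof.
move=> hK; move: (prefix_mpow al) (@prefix_supp al); set P := prefix al => hP hS.
rewrite /fmul (@fapply_reindex _ _ _ _ _ _ 'I_i.+1
  (fun n : 'I_i.+1 => (mpow al n 0 0, mlog R (i - n) a b))).
- rewrite (@fsumE _ _ _ (index_enum 'I_i.+1)) ?index_enum_uniq //=; last first.
    by move=> n _; rewrite mem_index_enum.
  rewrite (eq_bigr (fun n : 'I_i.+1 => ((-1) ^+ a / (a`!%:R * b`!%:R)) *: \sum_(r < K)
     (cbin al n * logpow R r (i - n) / r`!%:R) *: iter (r + (a + b)) N u)); last first.
    move=> n _; rewrite hP (fexp_mlog _ _ _ hK) !scaler_sumr; apply: eq_bigr => r _.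
    rewrite !scalerA; congr (_ *: _); ring.
  rewrite -scaler_sumr /power_coef; congr (_ *: _); rewrite exchange_big /=.
  apply: eq_bigr => r _; rewrite -scaler_suml; congr (_ *: _).
  by rewrite /cauchy mulr_suml.
- by move=> n n' [/mpow_inj[_ /val_inj]].
- by move=> n /=; rewrite mpowD subnKC // -ltnS.
- move=> [p1 p2] /= pm nz.
  have [n en] : exists n, p1 = mpow al n 0 0.
    by apply: hS; apply: contraNneq nz => ->; rewrite scale0r.
  have [j [a' [b' ej]]] : exists j a b, p2 = mlog R j a b.
    by apply: (@fexp_supp u); apply: contraNneq nz => ->; rewrite scaler0.
  move: pm; rewrite en ej mpowD => /mpow_inj[_ <- <- <-].
  have hn : (n < (n + j).+1)%N by rewrite ltnS leq_addr.
  by exists (Ordinal hn); rewrite /= addKn.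
Qed.

Lemma power_supp al u m : fmul (prefix al) (fexp (@log_ratio R) N u) m != 0 ->
  exists i a b, m = mpow al i a b.
Proof.
move: (@prefix_supp al); set P := prefix al => hS.
move=> nz; apply: contrapT => nm; move: nz; rewrite /fmul fapply_eq0 ?eqxx // => -[p1 p2] /= pm.
apply/eqP/negPn/negP => nz; apply: nm.
have [n en] : exists n, p1 = mpow al n 0 0.
  by apply: hS; apply: contraNneq nz => ->; rewrite scale0r.
have [j [a [b ej]]] : exists j a b, p2 = mlog R j a b.
  by apply: (@fexp_supp u); apply: contraNneq nz => ->; rewrite scaler0.
by exists (n + j)%N, a, b; rewrite -pm en ej mpowD.
Qed.

Lemma eig_comp_eig u al : eig_gr g al (eig_comp g u al).
Proof. by rewrite (eig_comp_proj hg); exact: proj_gr. Qed.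

(** A monomial of [((x_2 + x_0) / x_1) ^ L_g u] determines the eigenvalue that it
    comes from. *)
Lemma pow_Lg_at al K u i a b : (forall q, (K <= q)%N -> iter q N (eig_comp g u al) = 0) ->
  pow_Lg g u (mpow al i a b) = power_coef al K i a b (eig_comp g u al).
Proof.
move=> hK; rewrite /pow_Lg (@fsumE _ _ _ [:: al]) //; last first.
  move=> al' nz; rewrite inE; have [i' [a' [b' e]]] := power_supp nz.
  by have [-> _ _ _] := mpow_inj e.
by rewrite big_seq1; exact: power_at.
Qed.

Lemma pow_Lg_supp u m : pow_Lg g u m != 0 -> exists al i a b, m = mpow al i a b.
Proof.
move=> nz; apply: contrapT => nm; move: nz; rewrite /pow_Lg fsbig1 ?eqxx // => al _.
apply/eqP/negPn/negP => /power_supp[i [a [b e]]].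
by apply: nm; exists al, i, a, b.
Qed.

Lemma pow_LgD u u' m : pow_Lg g (u + u') m = pow_Lg g u m + pow_Lg g u' m.
Proof.
have z x : (forall al i a b, m <> mpow al i a b) -> pow_Lg g x m = 0.
  move=> h; apply/eqP/negPn/negP => /pow_Lg_supp[al [i [a [b e]]]]; exact: (h al i a b).
case: (pselect (exists al i a b, m = mpow al i a b)) => [[al [i [a [b ->]]]]|h]; last first.
  have h' al i a b : m <> mpow al i a b by move=> e; apply: h; exists al, i, a, b.
  by rewrite !z // addr0.
have [K1 h1] := Ng_nilpotent hg (eig_comp_eig u al).
have [K2 h2] := Ng_nilpotent hg (eig_comp_eig u' al).
have cD : eig_comp g (u + u') al = 1 *: eig_comp g u al + eig_comp g u' al.
  by rewrite scale1r !(eig_comp_proj hg) linearD.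
have it q : iter q N (eig_comp g (u + u') al) =
    iter q N (eig_comp g u al) + iter q N (eig_comp g u' al).
  by rewrite cD (iter_Ng_linear hg _ _ (eig_comp_eig u al) (eig_comp_eig u' al)) scale1r.
pose K := maxn K1 K2.
have h1' q : (K <= q)%N -> iter q N (eig_comp g u al) = 0.
  by rewrite geq_max => /andP[hq _]; exact: h1.
have h2' q : (K <= q)%N -> iter q N (eig_comp g u' al) = 0.
  by rewrite geq_max => /andP[_ hq]; exact: h2.
rewrite (pow_Lg_at (K := K) i a b h1') (pow_Lg_at (K := K) i a b h2') (pow_Lg_at (K := K)).
  rewrite /power_coef -scalerDr -big_split; congr (_ *: _); apply: eq_bigr => r _.
  by rewrite it scalerDr.
by move=> q hq; rewrite it h1' // h2' // addr0.
Qed.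

Lemma eig_comp_eigen al be u : eig_gr g al u -> eig_comp g u be = if be == al then u else 0.
Proof. by move=> hu; rewrite (eig_comp_proj hg) (proj_of_gr _ _ hu). Qed.

Lemma pow_Lg_eigen al K u : eig_gr g al u -> (forall q, (K <= q)%N -> iter q N u = 0) ->
  (forall i a b, pow_Lg g u (mpow al i a b) = power_coef al K i a b u) /\
  (forall m, pow_Lg g u m != 0 -> exists i a b, m = mpow al i a b).
Proof.
move=> hu hK; split=> [i a b|m nz].
  by rewrite (pow_Lg_at (K := K)) (eig_comp_eigen _ hu) eqxx.
have [be [i [a [b e]]]] := pow_Lg_supp nz; exists i, a, b.
have [<- //|ne] := eqVneq be al; move: nz.
have e0 : eig_comp g u be = 0 by rewrite (eig_comp_eigen _ hu) (negbTE ne).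
have [n0 hn0] := Ng_nilpotent hg (eig_comp_eig u be).
rewrite e (pow_Lg_at (K := n0)) // /power_coef e0.
have z q : iter q N 0 = 0.
  have := iter_Ng_linear hg q (-1) (gr0 (eig_sub g) al) (gr0 (eig_sub g) al).
  by rewrite scaler0 addr0 scaleN1r addNr.
by rewrite big1 ?scaler0 ?eqxx // => r _; rewrite z scaler0.
Qed.

End PowerOfLogarithm.

(** * The series in the Jacobi identity *)

Section Evaluation.
Variables (R : realType) (V : lmodType R[i]) (A : vertex_superalgebra V).
Variables (g : {linear V -> V}).
Variables (W : lmodType R[i]) (M : twisted_module A g W).
Local Notation C := R[i].
Local Notation wt := (vsa_wt A).
Local Notation Y := (tw_Y M).
Implicit Types (u v : V) (w : W) (m : mono R) (e : (C * nat)%type).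

Lemma fsum_nat (T : nmodType) (F : nat -> T) B : (forall k, (B <= k)%N -> F k = 0) ->
  \sum_(k \in [set: nat]) F k = \sum_(k < B) F k.
Proof.
move=> h; rewrite (@fsumE _ _ _ (index_iota 0 B)) ?big_mkord ?iota_uniq // => k.
by rewrite mem_index_iota /=; apply: contraNT; rewrite -leqNgt => /h ->.
Qed.

Lemma fsum_nat_ord (T : nmodType) n (F : nat * 'I_n -> T) B :
  (forall k j, (B <= k)%N -> F (k, j) = 0) ->
  \sum_(p \in [set: nat * 'I_n]) F p = \sum_(k < B) \sum_(j < n) F (k : nat, j).
Proof.
move=> h; rewrite (@fsumE _ _ _ [seq (k, j) | k <- index_iota 0 B, j <- index_enum 'I_n]).
- by rewrite big_allpairs big_mkord.
- apply: allpairs_uniq; [exact: iota_uniq|exact: index_enum_uniq|].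
  by move=> [k j] [k' j'].
- move=> [k j] nz; apply/allpairsP; exists (k, j); split => //=; last exact: mem_index_enum.
  by rewrite mem_index_iota /= ltnNge; apply: contraNN nz => /h ->.
Qed.

Lemma YV_at u v n : YV A x0 u v (mk (n%:~R, 0%N) 0 0) = vsa_Y A u v n.
Proof.
rewrite -mono_at0 -/(xpow x0 n%:~R) /YV (fseries_at _ n) // => k l /mono_at_inj[/eqP].
by rewrite eqr_int => /eqP.
Qed.

Lemma YV_supp u v m : YV A x0 u v m != 0 -> exists n : int, m = mk (n%:~R, 0%N) 0 0.
Proof. by move=> /fseries_supp[n <-]; exists n; rewrite /xpow mono_at0. Qed.

Lemma YW_at i v w e : YW M i v w (mono_at i e) = Y v w e.
Proof. by rewrite /YW (fseries_at _ e (@mono_at_inj R i)). Qed.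

Lemma YW_supp i v w m : YW M i v w m != 0 -> exists e, m = mono_at i e.
Proof. by move=> /fseries_supp[e <-]; exists e. Qed.

Lemma YW_linr i v m : linear (fun w => YW M i v w m).
Proof.
move=> a w w'; case: (pselect (exists e, m = mono_at i e)) => [[e ->]|h].
  by rewrite !YW_at (tw_Y_linr M).
by rewrite /YW !fseries_out ?scaler0 ?addr0 // => e he; apply: h; exists e.
Qed.

Lemma YW_linl i w m : linear (fun v => YW M i v w m).
Proof.
move=> a v v'; case: (pselect (exists e, m = mono_at i e)) => [[e ->]|h].
  by rewrite !YW_at (tw_Y_linl M).
by rewrite /YW !fseries_out ?scaler0 ?addr0 // => e he; apply: h; exists e.
Qed.

Lemma YV_linl v m : linear (fun u => YV A x0 u v m).
Proof.
move=> a u u'; case: (pselect (exists n : int, m = mk (n%:~R, 0%N) 0 0)) => [[n ->]|h].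
  by rewrite !YV_at (vsa_Y_linl A).
by rewrite /YV !fseries_out ?scaler0 ?addr0 // => n; rewrite /xpow mono_at0 => hn; apply: h; exists n.
Qed.

Lemma YV_linr u m : linear (fun v => YV A x0 u v m).
Proof.
move=> a v v'; case: (pselect (exists n : int, m = mk (n%:~R, 0%N) 0 0)) => [[n ->]|h].
  by rewrite !YV_at (vsa_Y_linr A).
by rewrite /YV !fseries_out ?scaler0 ?addr0 // => n; rewrite /xpow mono_at0 => hn; apply: h; exists n.
Qed.

Section Products.
Variables (i j : 'I_3) (ij : i != j) (u v : V) (w : W).

Lemma product_at e e' :
  fapply (YW M i u) (YW M j v w) (mono_at j e' + mono_at i e) = Y u (Y v w e') e.
Proof.
rewrite (@fapply_reindex _ _ _ _ _ _ unit (fun=> (mono_at j e', mono_at i e))) //=.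
- rewrite (@fsumE _ _ _ [:: tt]) ?big_seq1 //= ?YW_at //.
- by move=> [] [].
- move=> [p1 p2] /= pm nz; exists tt.
  have [f' e1] : exists f', p1 = mono_at j f'.
    by apply: (@YW_supp j v w); apply: contraNneq nz => ->; rewrite (linf0 (YW_linr i u p2)).
  have [f e2] := YW_supp nz.
  move: pm; rewrite e1 e2 => h.
  have hj := congr1 (fun m : mono R => m j) h; have hi := congr1 (fun m : mono R => m i) h.
  move: hi hj; rewrite !ffunE !eqxx (negbTE ij) eq_sym (negbTE ij) !add0r !addr0 => -> -> //.
Qed.

Lemma product_supp m : fapply (YW M i u) (YW M j v w) m != 0 ->
  exists e e', m = mono_at j e' + mono_at i e.
Proof.
move=> nz; apply: contrapT => nm; move: nz; rewrite fapply_eq0 ?eqxx // => -[p1 p2] /= pm.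
apply/eqP/negPn/negP => nz; apply: nm.
have [f' e1] : exists f', p1 = mono_at j f'.
  by apply: (@YW_supp j v w); apply: contraNneq nz => ->; rewrite (linf0 (YW_linr i u p2)).
by have [f e2] := YW_supp nz; exists f, f'; rewrite -pm e1 e2.
Qed.

End Products.

Lemma products_at12 u v w e1 e2 :
  fapply (YW M x1 u) (YW M x2 v w) (mk 0 e1 e2) = Y u (Y v w e2) e1.
Proof. by rewrite -(product_at (i := x1) (j := x2)) // mono_at1 mono_at2 mkD !addr0 !add0r. Qed.

Lemma products_at21 u v w e1 e2 :
  fapply (YW M x2 v) (YW M x1 u w) (mk 0 e1 e2) = Y v (Y u w e1) e2.
Proof. by rewrite -(product_at (i := x2) (j := x1)) // mono_at1 mono_at2 mkD !addr0 !add0r. Qed.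

Lemma products_supp12 u v w m : fapply (YW M x1 u) (YW M x2 v w) m != 0 ->
  exists e1 e2, m = mk 0 e1 e2.
Proof.
by move=> /(product_supp (i := x1) (j := x2))[e [e' ->]]; exists e, e';
  rewrite mono_at1 mono_at2 mkD !addr0 !add0r.
Qed.

Lemma products_supp21 u v w m : fapply (YW M x2 v) (YW M x1 u w) m != 0 ->
  exists e1 e2, m = mk 0 e1 e2.
Proof.
by move=> /(product_supp (i := x2) (j := x1))[e [e' ->]]; exists e', e;
  rewrite mono_at1 mono_at2 mkD !addr0 !add0r.
Qed.

End Evaluation.

Section DeltaProducts.
Variable R : realType.
Local Notation C := R[i].
Implicit Types (m : mono R) (e : (C * nat)%type).

Section Series.
Variables (T : lmodType C) (I J : choiceType) (c : I -> C) (mo : I -> mono R).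
Variables (U : mono R -> T) (m : mono R) (f : J -> I) (q : J -> mono R).
Hypotheses (moi : injective mo) (fi : injective f).
Hypothesis fq : forall j, mo (f j) + q j = m.
Hypothesis cover : forall i p, mo i + p = m -> U p != 0 -> exists j, f j = i /\ q j = p.

Let h j := (mo (f j), q j).

Let hi : injective h.
Proof. by move=> j k [/moi/fi]. Qed.

Let hcover p : p.1 + p.2 = m -> fseries c mo p.1 *: U p.2 != 0 -> exists j, h j = p.
Proof.
case: p => [p1 p2] /= pm nz.
have [i ei] : exists i, mo i = p1.
  by apply: (fseries_supp (c := c)); apply: contraNneq nz => ->; rewrite scale0r.
have pm' : mo i + p2 = m by rewrite ei.
have nz' : U p2 != 0 by apply: contraNneq nz => ->; rewrite scaler0.
have [j [e1 e2]] := cover pm' nz'.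
by exists j; rewrite /h e1 e2 ei.
Qed.

(** [f] and [q] list the terms of the two factors that contribute to [m]; for a delta
    function this leaves one free index. *)
Lemma fmul_series : fmul (fseries c mo) U m = \sum_(j \in [set: J]) c (f j) *: U (q j).
Proof.
rewrite /fmul (fapply_reindex hi fq hcover); apply: eq_fsbigr => j _ /=.
by rewrite fseries_at.
Qed.

Lemma fmul_series_finite : finite_set [set j | U (q j) != 0] ->
  finite_set [set p : mono R * mono R | p.1 + p.2 = m /\ fseries c mo p.1 *: U p.2 != 0].
Proof.
move=> fin; apply: (fapply_finite (F := fun a p => a *: U p) hcover).
apply: sub_finite_set fin => j /=; apply: contraNneq => ->; rewrite scaler0 //.
Qed.

End Series.

Lemma no_contributor (T : lmodType C) (I : choiceType) (c : I -> C) (mo : I -> mono R)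
    (U : mono R -> T) m : (forall i p, mo i + p = m -> U p = 0) ->
  fmul (fseries c mo) U m = 0 /\
  finite_set [set p : mono R * mono R | p.1 + p.2 = m /\ fseries c mo p.1 *: U p.2 != 0].
Proof.
move=> h; have z p : p.1 + p.2 = m -> fseries c mo p.1 *: U p.2 = 0.
  case: p => [p1 p2] /= pm; case: (eqVneq (fseries c mo p1) 0) => [->|/fseries_supp[i ei]].
    by rewrite scale0r.
  by rewrite (h i) ?scaler0 // ei.
split; first by rewrite /fmul fapply_eq0.
by apply: sub_finite_set (finite_set0 _) => p [/z -> /eqP].
Qed.

Lemma finite_nat (T : nmodType) (U : nat -> T) B : (forall k, (B <= k)%N -> U k = 0) ->
  finite_set [set k | U k != 0].
Proof.
move=> h; apply: (@seq_finite_supp _ _ _ (iota 0 B)) => k; rewrite mem_iota /=.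
by rewrite ltnNge; apply: contraNN => /h ->.
Qed.

Variable T : lmodType C.
Implicit Type U : mono R -> T.

Section TwoVariables.
Variable U : mono R -> T.
Hypothesis hU : forall p, U p != 0 -> exists e1 e2, p = mk 0 e1 e2.

Let mo012 (nk : int * nat) : mono R :=
  xpow x0 (- nk.1 - 1)%:~R + xpow x1 (nk.1 - nk.2%:Z)%:~R + xpow x2 nk.2%:R.

Let mo012E n k : mo012 (n, k) =
  mk ((- n - 1)%:~R, 0%N) ((n - k%:Z)%:~R, 0%N) (k%:R, 0%N).
Proof. by rewrite /mo012 /xpow mono_at0 mono_at1 mono_at2 !mkD !addr0 !add0r. Qed.

Lemma intr_injN n n' : ((- n - 1)%:~R : C) = (- n' - 1)%:~R -> n = n'.
Proof. by move=> /eqP; rewrite eqr_int => /eqP; lia. Qed.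

Let mo012_inj : injective mo012.
Proof.
move=> [n k] [n' k']; rewrite !mo012E => /mk_inj[h1 _ h3].
have := congr1 fst h3; move/eqP; rewrite /= eqr_nat => /eqP ->.
by have /= /intr_injN -> := congr1 fst h1.
Qed.

Let q012 n e1 e2 (k : nat) : mono R :=
  mk 0 (e1.1 - n%:~R + k%:R, e1.2) (e2.1 - k%:R, e2.2).

Let q012E (n : int) e1 e2 k : mo012 (n, k) + q012 n e1 e2 k = mk ((- n - 1)%:~R, 0%N) e1 e2.
Proof.
case: e1 e2 => [a k1] [b k2]; rewrite mo012E mkD pair0 !pairD /= !add0n addr0 rmorphB /=.
by congr (mk _ (_, _) (_, _)); rewrite ?pmulrn; ring.
Qed.

Let q012_cover n e1 e2 i p : mo012 i + p = mk ((- n - 1)%:~R, 0%N) e1 e2 -> U p != 0 ->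
  exists k, (n, k) = i /\ q012 n e1 e2 k = p.
Proof.
case: i => [n' k] pm /hU[f1 [f2 ep]]; exists k; move: pm; rewrite ep mo012E mkD addr0.
move=> /mk_inj[h1 <- <-]; have /= /intr_injN -> := congr1 fst h1; split => //.
case: f1 f2 {ep} => [a k1] [b k2]; rewrite /q012 !pairD /= !add0n rmorphB /=.
by congr (mk _ (_, _) (_, _)); rewrite ?pmulrn; ring.
Qed.

Lemma delta012_at n e1 e2 : fmul (fdelta x0 1 x1 (- 1) x2) U (mk ((- n - 1)%:~R, 0%N) e1 e2) =
  \sum_(k \in [set: nat]) (cbin n%:~R k * (- 1) ^+ k) *: U (q012 n e1 e2 k).
Proof.
rewrite (fmul_series _ mo012_inj (f := pair n) _ (@q012E n e1 e2) (@q012_cover n e1 e2)).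
  by apply: eq_fsbigr => k _ /=; rewrite exp1rz mulr1.
by move=> k k' [].
Qed.

Lemma delta012_finite n e1 e2 B : (forall k, (B <= k)%N -> U (q012 n e1 e2 k) = 0) ->
  finite_set [set p : mono R * mono R | p.1 + p.2 = mk ((- n - 1)%:~R, 0%N) e1 e2 /\
    fdelta x0 1 x1 (- 1) x2 p.1 *: U p.2 != 0].
Proof.
move=> hB; apply: (fmul_series_finite _ (f := pair n) (@q012_cover n e1 e2)).
exact: finite_nat hB.
Qed.

Lemma delta012_out m : (forall n : int, m x0 <> ((- n - 1)%:~R, 0%N)) ->
  fmul (fdelta x0 1 x1 (- 1) x2) U m = 0 /\ finite_set [set p : mono R * mono R |
    p.1 + p.2 = m /\ fdelta x0 1 x1 (- 1) x2 p.1 *: U p.2 != 0].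
Proof.
move=> hm; apply: no_contributor => -[n k] p pm; apply/eqP/negPn/negP => /hU[e1 [e2 ep]].
apply: (hm n); rewrite -pm ep -/(mo012 (n, k)) mo012E mkD !ffunE /= addr0 //.
Qed.

Let mo021 (nk : int * nat) : mono R :=
  xpow x0 (- nk.1 - 1)%:~R + xpow x2 (nk.1 - nk.2%:Z)%:~R + xpow x1 nk.2%:R.

Let mo021E n k : mo021 (n, k) =
  mk ((- n - 1)%:~R, 0%N) (k%:R, 0%N) ((n - k%:Z)%:~R, 0%N).
Proof. by rewrite /mo021 /xpow mono_at0 mono_at1 mono_at2 !mkD !addr0 !add0r. Qed.

Let mo021_inj : injective mo021.
Proof.
move=> [n k] [n' k']; rewrite !mo021E => /mk_inj[h1 h3 _].
have := congr1 fst h3; move/eqP; rewrite /= eqr_nat => /eqP ->.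
by have /= /intr_injN -> := congr1 fst h1.
Qed.

Let q021 n e1 e2 (k : nat) : mono R :=
  mk 0 (e1.1 - k%:R, e1.2) (e2.1 - n%:~R + k%:R, e2.2).

Let q021E (n : int) e1 e2 k : mo021 (n, k) + q021 n e1 e2 k = mk ((- n - 1)%:~R, 0%N) e1 e2.
Proof.
case: e1 e2 => [a k1] [b k2]; rewrite mo021E mkD pair0 !pairD /= !add0n addr0 rmorphB /=.
by congr (mk _ (_, _) (_, _)); rewrite ?pmulrn; ring.
Qed.

Let q021_cover n e1 e2 i p : mo021 i + p = mk ((- n - 1)%:~R, 0%N) e1 e2 -> U p != 0 ->
  exists k, (n, k) = i /\ q021 n e1 e2 k = p.
Proof.
case: i => [n' k] pm /hU[f1 [f2 ep]]; exists k; move: pm; rewrite ep mo021E mkD addr0.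
move=> /mk_inj[h1 <- <-]; have /= /intr_injN -> := congr1 fst h1; split => //.
case: f1 f2 {ep} => [a k1] [b k2]; rewrite /q021 !pairD /= !add0n rmorphB /=.
by congr (mk _ (_, _) (_, _)); rewrite ?pmulrn; ring.
Qed.

Lemma delta021_at n e1 e2 : fmul (fdelta x0 (- 1) x2 1 x1) U (mk ((- n - 1)%:~R, 0%N) e1 e2) =
  \sum_(k \in [set: nat]) (cbin n%:~R k * (- 1) ^ (n - k%:Z)) *: U (q021 n e1 e2 k).
Proof.
rewrite (fmul_series _ mo021_inj (f := pair n) _ (@q021E n e1 e2) (@q021_cover n e1 e2)).
  by apply: eq_fsbigr => k _ /=; rewrite expr1n mulr1.
by move=> k k' [].
Qed.

Lemma delta021_finite n e1 e2 B : (forall k, (B <= k)%N -> U (q021 n e1 e2 k) = 0) ->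
  finite_set [set p : mono R * mono R | p.1 + p.2 = mk ((- n - 1)%:~R, 0%N) e1 e2 /\
    fdelta x0 (- 1) x2 1 x1 p.1 *: U p.2 != 0].
Proof.
move=> hB; apply: (fmul_series_finite _ (f := pair n) (@q021_cover n e1 e2)).
exact: finite_nat hB.
Qed.

Lemma delta021_out m : (forall n : int, m x0 <> ((- n - 1)%:~R, 0%N)) ->
  fmul (fdelta x0 (- 1) x2 1 x1) U m = 0 /\ finite_set [set p : mono R * mono R |
    p.1 + p.2 = m /\ fdelta x0 (- 1) x2 1 x1 p.1 *: U p.2 != 0].
Proof.
move=> hm; apply: no_contributor => -[n k] p pm; apply/eqP/negPn/negP => /hU[e1 [e2 ep]].
apply: (hm n); rewrite -pm ep -/(mo021 (n, k)) mo021E mkD !ffunE /= addr0 //.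
Qed.

End TwoVariables.

Section ThreeVariables.
Variables (U : mono R -> T) (al : C).
Hypothesis hU : forall p, U p != 0 ->
  exists (y : int) a e, p = mk (y%:~R, 0%N) (- al, a) e.

Let mo120 (nk : int * nat) : mono R :=
  xpow x1 (- nk.1 - 1)%:~R + xpow x2 (nk.1 - nk.2%:Z)%:~R + xpow x0 nk.2%:R.

Let mo120E n k : mo120 (n, k) =
  mk (k%:R, 0%N) ((- n - 1)%:~R, 0%N) ((n - k%:Z)%:~R, 0%N).
Proof. by rewrite /mo120 /xpow mono_at0 mono_at1 mono_at2 !mkD !addr0 !add0r. Qed.

Let mo120_inj : injective mo120.
Proof.
move=> [n k] [n' k']; rewrite !mo120E => /mk_inj[h1 h2 _].
have := congr1 fst h1; move/eqP; rewrite /= eqr_nat => /eqP ->.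
by have /= /intr_injN -> := congr1 fst h2.
Qed.

Let q120 n (y : int) a e (k : nat) : mono R :=
  mk ((y - k%:Z)%:~R, 0%N) (- al, a) (e.1 - n%:~R + k%:R, e.2).

Let q120E (n y : int) a e k :
  mo120 (n, k) + q120 n y a e k = mk (y%:~R, 0%N) ((- n - 1)%:~R - al, a) e.
Proof.
case: e => [b k2]; rewrite mo120E mkD !pairD /= !add0n !rmorphB /=.
by congr (mk (_, _) (_, _) (_, _)); rewrite ?pmulrn; ring.
Qed.

Let q120_cover n y a e i p : mo120 i + p = mk (y%:~R, 0%N) ((- n - 1)%:~R - al, a) e ->
  U p != 0 -> exists k, (n, k) = i /\ q120 n y a e k = p.
Proof.
case: i => [n' k] pm /hU[y' [a' [e' ep]]]; exists k; move: pm; rewrite ep mo120E mkD.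
move=> /mk_inj[h1 h2 <-]; have /= /addIr /intr_injN -> := congr1 fst h2; split => //.
have /= <- := congr1 snd h2; have := congr1 fst h1; rewrite /= => h.
have -> : y = k%:Z + y'.
  by apply/eqP; rewrite -(eqr_int C) -h rmorphD /= pmulrn.
case: e' {ep} => [b k2]; rewrite /q120 !pairD /= !add0n !rmorphB rmorphD /=.
by congr (mk (_, _) (_, _) (_, _)); rewrite ?pmulrn; ring.
Qed.

Lemma delta120_at n y a e :
  fmul (fdelta x1 1 x2 1 x0) U (mk (y%:~R, 0%N) ((- n - 1)%:~R - al, a) e) =
  \sum_(k \in [set: nat]) cbin n%:~R k *: U (q120 n y a e k).
Proof.
rewrite (fmul_series _ mo120_inj (f := pair n) _ (@q120E n y a e) (@q120_cover n y a e)).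
  by apply: eq_fsbigr => k _ /=; rewrite exp1rz expr1n !mulr1.
by move=> k k' [].
Qed.

Lemma delta120_finite n y a e B : (forall k, (B <= k)%N -> U (q120 n y a e k) = 0) ->
  finite_set [set p : mono R * mono R |
    p.1 + p.2 = mk (y%:~R, 0%N) ((- n - 1)%:~R - al, a) e /\
    fdelta x1 1 x2 1 x0 p.1 *: U p.2 != 0].
Proof.
move=> hB; apply: (fmul_series_finite _ (f := pair n) (@q120_cover n y a e)).
exact: finite_nat hB.
Qed.

Lemma delta120_out m : (forall (n y : int) a e,
    m <> mk (y%:~R, 0%N) ((- n - 1)%:~R - al, a) e) ->
  fmul (fdelta x1 1 x2 1 x0) U m = 0 /\ finite_set [set p : mono R * mono R |
    p.1 + p.2 = m /\ fdelta x1 1 x2 1 x0 p.1 *: U p.2 != 0].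
Proof.
move=> hm; apply: no_contributor => -[n k] p pm; apply/eqP/negPn/negP.
move=> /hU[y [a [[b l] ep]]].
apply: (hm n (k%:Z + y) a ((n - k%:Z)%:~R + b, l)).
by rewrite -pm ep -/(mo120 (n, k)) mo120E mkD !pairD [(k%:Z + y)%:~R]rmorphD /= !add0n.
Qed.

End ThreeVariables.

End DeltaProducts.

Section Iterates.
Variables (R : realType) (V : lmodType R[i]) (A : vertex_superalgebra V).
Variables (g : {linear V -> V}) (hg : is_automorphism A g).
Variables (W : lmodType R[i]) (M : twisted_module A g W).
Local Notation C := R[i].
Local Notation Y := (tw_Y M).
Variables (al : C) (K : nat) (u v : V) (w : W).
Hypotheses (ual : eig_gr g al u) (hK : forall q, (K <= q)%N -> iter q (Ng g) u = 0).
Implicit Types (m : mono R) (y : int).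

Local Notation pc := (fun i a b => power_coef g al K i a b u).
Local Notation Yuv := (fapply (fun a => YV A x0 a v) (pow_Lg g u)).
Local Notation YYuv := (fapply (fun a => YW M x2 a w) Yuv).

Let pw_at i a b : pow_Lg g u (mpow al i a b) = pc i a b.
Proof. by have [h _] := pow_Lg_eigen hg ual hK; exact: h. Qed.

Let pw_supp m : pow_Lg g u m != 0 -> exists i a b, m = mpow al i a b.
Proof. by have [_ h] := pow_Lg_eigen hg ual hK; exact: h. Qed.

Lemma intr_int_inj (a b : int) : (a%:~R : C) = b%:~R -> a = b.
Proof. by move=> /eqP; rewrite eqr_int => /eqP. Qed.

Let mIE (i a b : nat) (n : int) : mpow al i a b + mk (n%:~R, 0%N) 0 0 =
  mk ((i%:Z + n)%:~R, 0%N) (- al, a) (al - i%:R, b).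
Proof.
by rewrite /mpow mkD !addr0 pairD addn0 rmorphD.
Qed.

Let cover1 p : YV A x0 (pow_Lg g u p.1) v p.2 != 0 ->
  exists i a b (n : int), p = (mpow al i a b, mk (n%:~R, 0%N) 0 0).
Proof.
case: p => p1 p2 /= nz; have [n en] := YV_supp nz.
have [i [a [b e1]]] : exists i a b, p1 = mpow al i a b.
  by apply: pw_supp; apply: contraNneq nz => ->; rewrite (linf0 (YV_linl A v p2)).
by exists i, a, b, n; rewrite e1 en.
Qed.

Lemma mk_al_inj y i a b y' i' a' b' :
  mk (y%:~R, 0%N) (- al, a) (al - i%:R, b) = mk (y'%:~R, 0%N) (- al, a') (al - i'%:R, b') :> mono R ->
  [/\ y = y', i = i', a = a' & b = b'].
Proof.
move=> /mk_inj[h1 h2 h3]; have /= /intr_int_inj -> := congr1 fst h1.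
have /= -> := congr1 snd h2; have /= -> := congr1 snd h3.
have /= /addrI/oppr_inj := congr1 fst h3.
by move=> /eqP; rewrite eqr_nat => /eqP ->.
Qed.

(** The monomial determines the single pair of terms that contributes to it. *)
Lemma iterate_at y i a b : Yuv (mk (y%:~R, 0%N) (- al, a) (al - i%:R, b)) =
  vsa_Y A (pc i a b) v (y - i%:Z).
Proof.
rewrite (@fapply_reindex _ _ _ _ _ _ unit (fun=> (mpow al i a b, mk ((y - i%:Z)%:~R, 0%N) 0 0))).
- by rewrite (@fsumE _ _ _ [:: tt]) ?big_seq1 //= pw_at YV_at.
- by move=> [] [].
- by move=> _ /=; rewrite mIE (_ : i%:Z + _ = y) //; ring.
- move=> p pm /cover1[i' [a' [b' [n e]]]]; exists tt.
  move: pm; rewrite e -[_ + _]/(mpow al i' a' b' + mk (n%:~R, 0%N) 0 0) mIE.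
  move=> /mk_al_inj[<- -> -> ->].
  by rewrite (_ : i%:Z + n - i%:Z = n) //; ring.
Qed.

Lemma iterate_supp m : Yuv m != 0 ->
  exists y i a b, m = mk (y%:~R, 0%N) (- al, a) (al - i%:R, b).
Proof.
move=> nz; apply: contrapT => nm; move: nz; rewrite fapply_eq0 ?eqxx // => p pm.
apply/eqP/negPn/negP => /cover1[i [a [b [n e]]]]; apply: nm.
by exists (i%:Z + n), i, a, b; rewrite -pm e -mIE.
Qed.

Lemma iterate_ok : fapply_ok (fun a => YV A x0 a v) (pow_Lg g u).
Proof.
move=> m.
case: (pselect (exists p, p.1 + p.2 = m /\ YV A x0 (pow_Lg g u p.1) v p.2 != 0)) => [[p0 [pm nz]]|h].
  apply: sub_finite_set (finite_set1 p0) => p [/= pm' nz'].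
  have [i [a [b [n e]]]] := cover1 nz; have [i' [a' [b' [n' e']]]] := cover1 nz'.
  move: pm pm'; rewrite e e' -[RHS in _ -> _ = RHS -> _]/m /= !mIE => <- /mk_al_inj[h1 h2 h3 h4].
  rewrite h2 h3 h4; congr (_, mk (_, _) _ _); congr (_%:~R).
  by move: h1; rewrite h2 => /addrI.
by apply: sub_finite_set (finite_set0 _) => p hp; apply: h; exists p.
Qed.

Let cover2 p : YW M x2 (Yuv p.1) w p.2 != 0 -> exists y i a b e,
  p = (mk (y%:~R, 0%N) (- al, a) (al - i%:R, b), mk 0 0 e).
Proof.
case: p => p1 p2 /= nz; have [e en] := YW_supp nz.
have [y [i [a [b e1]]]] := iterate_supp (m := p1) (contraNneq
  (fun h => introT eqP (etrans (congr1 (fun x => YW M x2 x w p2) h) (linf0 (YW_linl M x2 w p2)))) nz).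
by exists y, i, a, b, e; rewrite e1 en mono_at2.
Qed.

Let h2 y a (be : C) b (ij : nat * 'I_b.+1) : mono R * mono R :=
  (mk (y%:~R, 0%N) (- al, a) (al - ij.1%:R, ij.2 : nat), mk 0 0 (be - al + ij.1%:R, (b - ij.2)%N)).

Let h2_cover y a be b p : p.1 + p.2 = mk (y%:~R, 0%N) (- al, a) (be, b) ->
  YW M x2 (Yuv p.1) w p.2 != 0 -> exists ij, @h2 y a be b ij = p.
Proof.
move=> pm /cover2[y' [i [a' [j [[c l] e]]]]]; move: pm; rewrite e /= mkD !addr0 pairD.
move=> /mk_inj[e1 e2 e3]; have hj : (j < b.+1)%N.
  by have /= <- := congr1 snd e3; rewrite ltnS leq_addr.
exists (i, Ordinal hj); rewrite /h2 /=.
have /= <- := congr1 snd e3; have /= <- := congr1 fst e3; rewrite addKn.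
have /= -> := congr1 fst e1; have /= -> := congr1 snd e2.
by congr (_, mk _ _ (_, _)); ring.
Qed.

Lemma iterate2_at y a be b : YYuv (mk (y%:~R, 0%N) (- al, a) (be, b)) =
  \sum_(ij \in [set: nat * 'I_b.+1])
    Y (vsa_Y A (pc ij.1 a (ij.2 : nat)) v (y - ij.1%:Z)) w (be - al + ij.1%:R, (b - ij.2)%N).
Proof.
rewrite (@fapply_reindex _ _ _ _ _ _ (nat * 'I_b.+1)%type (@h2 y a be b)).
- apply: eq_fsbigr => -[i j] _ /=.
  by rewrite iterate_at -mono_at2 YW_at.
- by move=> [i j] [i' j'] [/mk_al_inj[_ -> _ /val_inj ->]].
- move=> [i j]; rewrite /h2 /= mkD !addr0 pairD subnKC; last by rewrite -ltnS.
  by congr (mk _ _ (_, _)); ring.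
- exact: h2_cover.
Qed.

Lemma iterate2_supp m : YYuv m != 0 -> exists y a e, m = mk (y%:~R, 0%N) (- al, a) e.
Proof.
move=> nz; apply: contrapT => nm; move: nz; rewrite fapply_eq0 ?eqxx // => p pm.
apply/eqP/negPn/negP => /cover2[y [i [a [b [e ep]]]]]; apply: nm.
by exists y, a, ((al - i%:R, b) + e); rewrite -pm ep /= mkD !addr0.
Qed.

Variable n0 : int.
Hypothesis trunc : forall i a b (n : int), n < n0 -> vsa_Y A (pc i a b) v n = 0.

Lemma iterate2_fin y a be b : YYuv (mk (y%:~R, 0%N) (- al, a) (be, b)) =
  \sum_(i < (absz (y - n0)%R).+1) \sum_(j < b.+1)
    Y (vsa_Y A (pc i a j) v (y - i%:Z)) w (be - al + i%:R, (b - j)%N).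
Proof.
rewrite iterate2_at (@fsum_nat_ord _ _ _ (absz (y - n0)%R).+1) // => i j hi /=.
by rewrite trunc ?(linf0 (tw_Y_linl M _ _)) //; lia.
Qed.

Lemma iterate2_below y a e : y < n0 -> YYuv (mk (y%:~R, 0%N) (- al, a) e) = 0.
Proof.
move=> hy; case: e => be b; rewrite iterate2_at fsbig1 // => -[i j] _ /=.
by rewrite trunc ?(linf0 (tw_Y_linl M _ _)) //; lia.
Qed.

Lemma iterate2_ok : fapply_ok (fun a => YW M x2 a w) Yuv.
Proof.
move=> m; case: (pselect (exists y a e, m = mk (y%:~R, 0%N) (- al, a) e)); last first.
  move=> nm; apply: sub_finite_set (finite_set0 _) => p [pm /cover2[y [i [a [b [e ep]]]]]].
  by apply: nm; exists y, a, ((al - i%:R, b) + e); rewrite -pm ep /= mkD !addr0.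
move=> [y [a [[be b] ->]]]; apply: (fapply_finite (F := fun a => YW M x2 a w) (@h2_cover y a be b)).
apply: (@seq_finite_supp _ _ _ [seq (i, j) | i <- iota 0 (absz (y - n0)%R).+1, j <- index_enum 'I_b.+1]).
move=> [i j] nz; apply/allpairsP; exists (i, j); split; [|exact: mem_index_enum|by []].
rewrite mem_iota leq0n add0n ltnNge; apply: contraNN nz => /= hi.
rewrite /h2 /= iterate_at trunc; last lia.
by rewrite (linf0 (YW_linl M x2 w _)).
Qed.

End Iterates.

(** * The Jacobi identity for homogeneous vectors *)

(** The change of index [j = q - r]; the sum over the triangle [j + r < K] is extended by
    zeros. It matches the powers of [lambda N_g] with those of [log x_2]. *)
Lemma fsum_triangle (C : nmodType) (X : nat -> nat -> C) K b :
  (forall j r, (K <= j + r)%N -> X j r = 0) ->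
  \sum_(q < K) \sum_(r < q.+1) (if (q - r <= b)%N then X (q - r)%N r else 0) =
  \sum_(j < b.+1) \sum_(r < K) X j r.
Proof.
move=> h.
have -> : \sum_(j < b.+1) \sum_(r < K) X j r =
    \sum_(j < b.+1) \sum_(r < K) \sum_(q < K) (if (q == j + r :> nat)%N then X j r else 0).
  apply: eq_bigr => j _; apply: eq_bigr => r _; rewrite -big_mkcond.
  have [le|lt] := leqP K (j + r); first by rewrite (h _ _ le) big1.
  rewrite (eq_bigl (fun q : 'I_K => q == Ordinal lt)); first by rewrite big_pred1_eq.
  by move=> q; rewrite -val_eqE.
rewrite [RHS](eq_bigr (fun j : 'I_b.+1 => \sum_(q < K) \sum_(r < K)
  (if (q == j + r :> nat)%N then X j r else 0))); last by move=> j _; rewrite exchange_big.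
rewrite [RHS]exchange_big; apply: eq_bigr => q _; rewrite [RHS]exchange_big /=.
rewrite (big_ord_widen K (fun r => if (q - r <= b)%N then X (q - r)%N r else 0)) //.
rewrite big_mkcond; apply: eq_bigr => r _; rewrite ltnS.
have [rq|qr] := leqP r q; last first.
  by rewrite big1 // => j _; case: eqP => // e; move: qr; rewrite e ltnNge leq_addl.
case: leqP => hb.
  have hj : (q - r < b.+1)%N by rewrite ltnS.
  rewrite -big_mkcond (eq_bigl (fun j : 'I_b.+1 => j == Ordinal hj)); first by rewrite big_pred1_eq.
  by move=> j; rewrite -val_eqE /=; apply/eqP/eqP; lia.
rewrite big1 // => j _; case: eqP => // e; have := ltn_ord j; lia.
Qed.

Section Homogeneous.
Variables (R : realType) (V : lmodType R[i]) (A : vertex_superalgebra V).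
Variables (g : {linear V -> V}) (hg : is_automorphism A g).
Variables (W : lmodType R[i]) (M : twisted_module A g W).
Local Notation C := R[i].
Local Notation wt := (vsa_wt A).
Local Notation Y := (tw_Y M).
Local Notation gen := (gen_eigenspace (tw_L0 M)).
Local Notation N := (Ng g).
Variable B : R.
Hypothesis hB : forall n w, complex.Re n < B -> tw_weight M n w -> w = 0.
Variables (h h' : int) (al be mu : C) (u v : V) (w : W).
Hypotheses (hu : wt h u) (ual : eig_gr g al u) (hv : wt h' v) (vbe : eig_gr g be v).
Hypothesis hw : gen mu w.
Implicit Types (m : mono R) (y n : int).

Local Notation YuYv := (fapply (YW M x1 u) (YW M x2 v w)).
Local Notation YvYu := (fapply (YW M x2 v) (YW M x1 u w)).
Local Notation Yuv := (fapply (fun a => YV A x0 a v) (pow_Lg g u)).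
Local Notation YYuv := (fapply (fun a => YW M x2 a w) Yuv).
Local Notation d012 := (fdelta x0 1 x1 (- 1) x2).
Local Notation d021 := (fdelta x0 (- 1) x2 1 x1).
Local Notation d120 := (fdelta x1 1 x2 1 x0).

Lemma tw_lower_nat k (x : V) mu' (z : W) (c : C) : wt k x -> gen mu' z ->
  exists b : nat, forall j l, (b <= j)%N -> Y x z (c - j%:R, l) = 0.
Proof.
move=> hx hz; have [m0 hm0] := tw_lower hB c hx hz; exists (absz m0).+1 => j l hj.
by rewrite -[j%:R]/(j%:Z%:~R) -rmorphN hm0 //; lia.
Qed.

Lemma product_bound n e1 e2 : exists b, forall k, (b <= k)%N ->
  YuYv (mk 0 (e1.1 - n%:~R + k%:R, e1.2) (e2.1 - k%:R, e2.2)) = 0.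
Proof.
have [b hb] := tw_lower_nat e2.1 hv hw; exists b => k bk.
by rewrite products_at12 hb // (linf0 (tw_Y_linr M _ _)).
Qed.

Lemma opposite_bound n e1 e2 : exists b, forall k, (b <= k)%N ->
  YvYu (mk 0 (e1.1 - k%:R, e1.2) (e2.1 - n%:~R + k%:R, e2.2)) = 0.
Proof.
have [b hb] := tw_lower_nat e1.1 hu hw; exists b => k bk.
by rewrite products_at21 hb // (linf0 (tw_Y_linr M _ _)).
Qed.

Lemma product_ok : fmul_ok d012 YuYv.
Proof.
move=> m; case: (pselect (exists n : int, m x0 = ((- n - 1)%:~R, 0%N))) => [[n hn]|nm].
  have [b hb] := product_bound n (m x1) (m x2).
  rewrite {1}[m]mkE hn; apply: (delta012_finite (@products_supp12 _ _ _ _ _ M u v w) hb).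
by apply: (delta012_out (@products_supp12 _ _ _ _ _ M u v w) _).2 => n e; apply: nm; exists n.
Qed.

Lemma opposite_ok : fmul_ok d021 YvYu.
Proof.
move=> m; case: (pselect (exists n : int, m x0 = ((- n - 1)%:~R, 0%N))) => [[n hn]|nm].
  have [b hb] := opposite_bound n (m x1) (m x2).
  rewrite {1}[m]mkE hn; apply: (delta021_finite (@products_supp21 _ _ _ _ _ M u v w) hb).
by apply: (delta021_out (@products_supp21 _ _ _ _ _ M u v w) _).2 => n e; apply: nm; exists n.
Qed.

Variable K : nat.
Hypothesis hK : forall q, (K <= q)%N -> iter q N u = 0.
Variable n0 : int.
Hypothesis hn0 : forall x n, wt h x -> n < n0 -> vsa_Y A x v n = 0.

Lemma power_coef_wt i a b : wt h (power_coef g al K i a b u).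
Proof.
apply: (grZ (vsa_grading A).1); elim/big_ind: _ => [|x z|r _].
- exact: (gr0 (vsa_grading A).1).
- exact: (grD (vsa_grading A).1).
- by apply: (grZ (vsa_grading A).1); exact: (iter_Ng_wt hg _ ual hu).
Qed.

Lemma power_trunc i a b n : n < n0 -> vsa_Y A (power_coef g al K i a b u) v n = 0.
Proof. by move=> hn; rewrite hn0 //; exact: power_coef_wt. Qed.

Let supp3 := @iterate2_supp _ _ _ _ hg _ M _ _ _ v w ual hK.

Lemma iterate_bound n y a e k : ((absz (y - n0)%R).+1 <= k)%N ->
  YYuv (mk ((y - k%:Z)%:~R, 0%N) (- al, a) (e.1 - n%:~R + k%:R, e.2)) = 0.
Proof. by move=> hk; rewrite (iterate2_below hg M w ual hK power_trunc) //; lia. Qed.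

Lemma iterate_delta_ok : fmul_ok d120 YYuv.
Proof.
move=> m; case: (pselect (exists (n y : int) a e,
    m = mk (y%:~R, 0%N) ((- n - 1)%:~R - al, a) e)) => [[n [y [a [e ->]]]]|nm].
  apply: (delta120_finite supp3 (B := (absz (y - n0)%R).+1)) => k hk.
  exact: iterate_bound.
by apply: (delta120_out supp3 _).2 => n y a e em; apply: nm; exists n, y, a, e.
Qed.

Section MatrixCoefficient.
Variables (i0 : C * bool * C) (w' : {scalar W}).
Hypothesis hw' : forall i w, tw_gr M i w -> i != i0 -> w' w = 0.

Let d : C := i0.1.1 - h%:~R / 2%:R - h'%:~R / 2%:R - mu.
Let sgn : C := (-1) ^+ (half_parity h && half_parity h').

Variables (n mm : int) (a b : nat) (c : C).
Let u' := iter a N u.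
Let f : C := (-1) ^+ a / a`!%:R.

Let Yu x k' : Y u x (k', a) = f *: Y u' x (k', 0%N).
Proof. by rewrite (tw_Y_logE hg M _ _ _ hu ual). Qed.

(** The power [a] of [log x_1] has been traded for [N_g ^ a u] and the factor [f]; the
    same happens in the other two products. *)
Lemma product_matrix_coef : c = d - (mm%:~R - al) + n%:~R ->
  w' (fmul d012 YuYv (mk ((- n - 1)%:~R, 0%N) (mm%:~R - al, a) (c, b))) =
  f * coef_inf n mm (product_mc M i0 w' h h' al mu v w u' b).
Proof.
move=> hc; rewrite (delta012_at (@products_supp12 _ _ _ _ _ M u v w)).
have [k0 hk0] := product_bound n (mm%:~R - al, a) (c, b).
rewrite (@fsum_nat _ _ k0); last by move=> k /hk0 ->; rewrite scaler0.
have e (k : nat) : w' (YuYv (mk 0 (mm%:~R - al - n%:~R + k%:R, a) (c - k%:R, b))) =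
    f * product_mc M i0 w' h h' al mu v w u' b (- (n - mm - k%:Z)).
  rewrite products_at12 Yu linearZ /= /product_mc -/d.
  have -> : (- (n - mm - k%:Z))%:~R - al = mm%:~R - al - n%:~R + k%:R :> C.
    by rewrite rmorphN !rmorphB /= -pmulrn; ring.
  by congr (_ * w' (Y _ (Y _ _ (_, _)) _)); rewrite hc; ring.
rewrite /coef_inf /conv (@fsum_nat _ _ k0); last first.
  move=> k hk; have f0 : f != 0.
    by rewrite /f mulf_neq0 ?signr_eq0 // invr_eq0 pnatr_eq0 -lt0n fact_gt0.
  apply/eqP; rewrite mulf_eq0; apply/orP; right.
  by have /= := e k; rewrite (hk0 k hk) linear0 => /esym/eqP; rewrite mulf_eq0 (negbTE f0).
rewrite linear_sum mulr_sumr; apply: eq_bigr => k _ /=.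
by rewrite linearZ /= e mulrCA.
Qed.

Lemma opposite_matrix_coef : c = d - (mm%:~R - al) + n%:~R ->
  sgn * w' (fmul d021 YvYu (mk ((- n - 1)%:~R, 0%N) (mm%:~R - al, a) (c, b))) =
  f * coef_0 n mm (opposite_mc M i0 w' h h' al mu v w u' b).
Proof.
move=> hc; rewrite (delta021_at (@products_supp21 _ _ _ _ _ M u v w)).
have [k0 hk0] := opposite_bound n (mm%:~R - al, a) (c, b).
rewrite (@fsum_nat _ _ k0); last by move=> k /hk0 ->; rewrite scaler0.
have e (k : nat) : sgn * w' (YvYu (mk 0 (mm%:~R - al - k%:R, a) (c - n%:~R + k%:R, b))) =
    f * opposite_mc M i0 w' h h' al mu v w u' b (mm - k%:Z).
  rewrite products_at21 Yu (linfZ (tw_Y_linr M _ _)) linearZ /= /opposite_mc -/d -/sgn.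
  have -> : (mm - k%:Z)%:~R - al = mm%:~R - al - k%:R :> C by rewrite rmorphB /= -pmulrn; ring.
  by rewrite mulrCA; congr (_ * (_ * w' (Y _ _ (_, _)))); rewrite hc; ring.
rewrite /coef_0 /conv (@fsum_nat _ _ k0); last first.
  move=> k hk; have f0 : f != 0.
    by rewrite /f mulf_neq0 ?signr_eq0 // invr_eq0 pnatr_eq0 -lt0n fact_gt0.
  apply/eqP; rewrite mulf_eq0; apply/orP; right.
  have /= := e k; rewrite (hk0 k hk) linear0 mulr0 => /esym/eqP.
  by rewrite mulf_eq0 (negbTE f0).
rewrite linear_sum !mulr_sumr; apply: eq_bigr => k _ /=.
by rewrite linearZ /= mulrCA e mulrCA.
Qed.

Local Notation imc q l := (iterate_mc M i0 w' h h' mu v w (iter q N u') l).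
Local Notation cr r := (cauchy (cbin al) (logpow R r)).

Lemma imc_vanish q l : vanish_below (imc q l) n0.
Proof.
move=> y hy; rewrite /iterate_mc hn0 ?(linf0 (tw_Y_linl M _ _)) ?linear0 //.
by rewrite /u' -iterD; exact: (iter_Ng_wt hg _ ual hu).
Qed.

Lemma iterate_matrix_coef y c' : c' - al = d - y%:~R ->
  w' (YYuv (mk (y%:~R, 0%N) (- al, a) (c', b))) =
  f * \sum_(j < b.+1) \sum_(r < K) (j`!%:R * r`!%:R)^-1 * conv (cr r) (imc (r + j)%N (b - j)%N) y.
Proof.
move=> hc; rewrite (iterate2_fin hg M w ual hK power_trunc) linear_sum /=.
set I := (absz (y - n0)%R).+1.
have f0 j : (j`!%:R : C) != 0 by rewrite pnatr_eq0 -lt0n fact_gt0.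
have e (i j : nat) : w' (Y (vsa_Y A (power_coef g al K i a j u) v (y - i%:Z)) w
    (c' - al + i%:R, (b - j)%N)) =
    f * \sum_(r < K) (j`!%:R * r`!%:R)^-1 * (cr r i * imc (r + j)%N (b - j)%N (y - i%:Z)).
  rewrite /power_coef (linfZ (vsa_Y_linl A _ _)) (linfZ (tw_Y_linl M _ _)) linearZ /=.
  rewrite (linf_sum (vsa_Y_linl A _ _)) (linf_sum (tw_Y_linl M _ _)) linear_sum /=.
  rewrite !mulr_sumr; apply: eq_bigr => r _.
  rewrite (linfZ (vsa_Y_linl A _ _)) (linfZ (tw_Y_linl M _ _)) linearZ /=.
  rewrite /iterate_mc -/d /u' -iterD (_ : r + j + a = r + (a + j))%N; last by lia.
  have -> : d - (y - i%:Z)%:~R = c' - al + i%:R by rewrite hc rmorphB /= -pmulrn; ring.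
  by rewrite /f; field; rewrite !f0.
have eI (r j : nat) : conv (cr r) (imc (r + j)%N (b - j)%N) y =
    \sum_(i < I) cr r i * imc (r + j)%N (b - j)%N (y - i%:Z).
  by apply: (convE _ (imc_vanish _ _)); rewrite /I; lia.
rewrite (eq_bigr (fun i : 'I_I => \sum_(j < b.+1) f * \sum_(r < K) (j`!%:R * r`!%:R)^-1 *
  (cr r i * imc (r + j)%N (b - j)%N (y - i%:Z)))); last first.
  by move=> i _; rewrite linear_sum; apply: eq_bigr => j _; rewrite e.
rewrite exchange_big mulr_sumr; apply: eq_bigr => j _ /=; rewrite -mulr_sumr; congr (_ * _).
by rewrite exchange_big; apply: eq_bigr => r _; rewrite eI mulr_sumr.
Qed.

Lemma iterate_delta_matrix_coef : c = d - (mm%:~R - al) + n%:~R ->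
  w' (fmul d120 YYuv (mk ((- n - 1)%:~R, 0%N) (mm%:~R - al, a) (c, b))) =
  f * \sum_(j < b.+1) \sum_(r < K) (j`!%:R * r`!%:R)^-1 *
    coef_1 n mm (conv (cr r) (imc (r + j)%N (b - j)%N)).
Proof.
move=> hc; pose n' := - mm - 1; pose y := - n - 1.
rewrite (_ : mm = - n' - 1); last by rewrite /n'; ring.
rewrite (delta120_at supp3) (@fsum_nat _ _ (absz (y - n0)%R).+1); last first.
  by move=> k hk; rewrite iterate_bound ?scaler0.
have -> : - n' - 1 = mm by rewrite /n'; ring.
rewrite linear_sum /=.
have e (k : nat) : w' (YYuv (mk ((y - k%:Z)%:~R, 0%N) (- al, a) (c - n'%:~R + k%:R, b))) =
    f * \sum_(j < b.+1) \sum_(r < K) (j`!%:R * r`!%:R)^-1 *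
      conv (cr r) (imc (r + j)%N (b - j)%N) (y - k%:Z).
  apply: iterate_matrix_coef; rewrite hc /n' /y !rmorphB !rmorphN /= -pmulrn; ring.
rewrite (eq_bigr (fun k : 'I_(absz (y - n0)%R).+1 => f * \sum_(j < b.+1) \sum_(r < K)
  (j`!%:R * r`!%:R)^-1 * (cbin n'%:~R k * conv (cr r) (imc (r + j)%N (b - j)%N) (y - k%:Z)))).
  rewrite -mulr_sumr; congr (_ * _); rewrite exchange_big; apply: eq_bigr => j _ /=.
  rewrite exchange_big; apply: eq_bigr => r _ /=; rewrite -mulr_sumr; congr (_ * _).
  have lt : - n - 1 - n0 < (absz (y - n0)%R).+1%:Z by rewrite /y; lia.
  by rewrite /coef_1 (convE _ (conv_vanish (cr r) (imc_vanish _ _)) lt).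
move=> k _; rewrite linearZ /= e mulrCA; congr (_ * _); rewrite mulr_sumr.
by apply: eq_bigr => j _; rewrite mulr_sumr; apply: eq_bigr => r _; rewrite mulrCA.
Qed.

Lemma conv0 (c1 : nat -> C) k : conv c1 (fun=> 0) k = 0.
Proof. by rewrite /conv fsbig1 // => i _; rewrite mulr0. Qed.

(** If the exponents match the weights, this is [jacobi_mc] for [N_g ^ a u]; otherwise
    all three coefficients vanish. *)
Lemma matrix_coef_jacobi :
  w' (fmul d012 YuYv (mk ((- n - 1)%:~R, 0%N) (mm%:~R - al, a) (c, b))) -
  sgn * w' (fmul d021 YvYu (mk ((- n - 1)%:~R, 0%N) (mm%:~R - al, a) (c, b))) =
  w' (fmul d120 YYuv (mk ((- n - 1)%:~R, 0%N) (mm%:~R - al, a) (c, b))).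
Proof.
have u'q q : (K <= q)%N -> iter q N u' = 0.
  by move=> Kq; rewrite /u' -iterD hK // (leq_trans Kq) // leq_addr.
have [hc|nc] := eqVneq c (d - (mm%:~R - al) + n%:~R).
  rewrite product_matrix_coef // opposite_matrix_coef // iterate_delta_matrix_coef //.
  rewrite -mulrBr; congr (_ * _).
  have hu' : wt h u' := iter_Ng_wt hg _ ual hu.
  have ual' : eig_gr g al u' := iter_Ng_eig hg _ ual.
  rewrite (jacobi_mc hg hB hw' hv vbe hw n mm b hu' ual' u'q).
  rewrite -(fsum_triangle (X := fun j r => (j`!%:R * r`!%:R)^-1 *
    coef_1 n mm (conv (cr r) (imc (r + j)%N (b - j)%N)))); last first.
    move=> j r hjr; rewrite (_ : conv _ _ = fun=> 0); first by rewrite /coef_1 conv0 mulr0.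
    apply/funext => y; rewrite (_ : imc _ _ = fun=> 0) ?conv0 //.
    apply/funext => z; rewrite /iterate_mc u'q 1?addnC //.
    by rewrite (linf0 (vsa_Y_linl A _ _)) (linf0 (tw_Y_linl M _ _)) linear0.
  apply: eq_bigr => q _; apply: eq_bigr => r _; case: ifP => // _.
  by rewrite subnKC // -ltnS.
have z1 : w' (fmul d012 YuYv (mk ((- n - 1)%:~R, 0%N) (mm%:~R - al, a) (c, b))) = 0.
  rewrite (delta012_at (@products_supp12 _ _ _ _ _ M u v w)).
  have [k0 hk0] := product_bound n (mm%:~R - al, a) (c, b).
  rewrite (@fsum_nat _ _ k0); last by move=> k /hk0 ->; rewrite scaler0.
  rewrite linear_sum big1 // => k _; rewrite linearZ /= products_at12.
  apply/eqP; rewrite mulf_eq0; apply/orP; right; apply: contraNT nc.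
  by move=> /(product_weight hw' hv hw hu) /= e; rewrite /d -e; apply/eqP; ring.
have z2 : w' (fmul d021 YvYu (mk ((- n - 1)%:~R, 0%N) (mm%:~R - al, a) (c, b))) = 0.
  rewrite (delta021_at (@products_supp21 _ _ _ _ _ M u v w)).
  have [k0 hk0] := opposite_bound n (mm%:~R - al, a) (c, b).
  rewrite (@fsum_nat _ _ k0); last by move=> k /hk0 ->; rewrite scaler0.
  rewrite linear_sum big1 // => k _; rewrite linearZ /= products_at21.
  apply/eqP; rewrite mulf_eq0; apply/orP; right; apply: contraNT nc.
  by move=> /(opposite_product_weight hw' hv hw hu) /= e; rewrite /d -e; apply/eqP; ring.
rewrite z1 z2 mulr0 subr0; pose n' := - mm - 1; pose y := - n - 1.
rewrite (_ : mm = - n' - 1); last by rewrite /n'; ring.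
rewrite (delta120_at supp3) (@fsum_nat _ _ (absz (y - n0)%R).+1); last first.
  by move=> k hk; rewrite iterate_bound ?scaler0.
rewrite linear_sum big1 // => k _; rewrite linearZ /=.
apply/eqP; rewrite mulf_eq0; apply/orP; right; apply/eqP.
rewrite (iterate2_fin hg M w ual hK power_trunc) linear_sum big1 // => i _.
rewrite linear_sum big1 // => j _; apply/eqP; apply: contraNT nc.
move=> /(iterate_weight hw' hv hw (power_coef_wt i a j)) /= e.
apply/eqP; have -> : c = (c - n'%:~R + k%:R - al + i%:R) + n'%:~R - k%:R + al - i%:R by ring.
by rewrite e /d /n' !rmorphB !rmorphN /= -!pmulrn; ring.
Qed.

End MatrixCoefficient.

Lemma sub_scale_eq0 (T : lmodType C) (s : C) (x y z : T) : x = 0 -> y = 0 -> z = 0 ->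
  x - s *: y = z.
Proof. by move=> -> -> ->; rewrite scaler0 subr0. Qed.

Lemma scalar_sub_scale (w' : {scalar W}) (s : C) (x y z : W) : w' x - s * w' y = w' z ->
  w' (x - s *: y - z) = 0.
Proof.
have wB a b : w' (a - b) = w' a - w' b by exact: linearB.
have e1 : w' (s *: y) = s * w' y by exact: linearZ.
by move=> e; rewrite wB wB e1 e subrr.
Qed.

(** Unless the exponent of [x_0] is an integer and that of [x_1] lies in [Z - al], there
    is no contribution on either side; the other coefficients are compared by functionals
    on homogeneous subspaces. *)
Lemma jacobi_coef m :
  (fmul d012 YuYv - (-1) ^+ (half_parity h && half_parity h') *: fmul d021 YvYu) m =
  fmul d120 YYuv m.
Proof.
set sgn := (-1) ^+ _ : C.
rewrite -[LHS]/(fmul d012 YuYv m - sgn *: fmul d021 YvYu m).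
have s12 := @products_supp12 _ _ _ _ _ M u v w.
have s21 := @products_supp21 _ _ _ _ _ M u v w.
case: (pselect (exists n : int, m x0 = ((- n - 1)%:~R, 0%N))) => [[n hn]|nm]; last first.
  have hm n : m x0 <> ((- n - 1)%:~R, 0%N) by move=> e; apply: nm; exists n.
  have z1 : fmul d012 YuYv m = 0 by have [] := delta012_out s12 hm.
  have z2 : fmul d021 YvYu m = 0 by have [] := delta021_out s21 hm.
  have z3 : fmul d120 YYuv m = 0.
    have ne k y a e : m <> mk (y%:~R, 0%N) ((- k - 1)%:~R - al, a) e.
      move=> em; apply: (hm (- y - 1)); rewrite em ffunE /=; congr (_%:~R, _); ring.
    by have [] := delta120_out supp3 ne.
  exact: sub_scale_eq0 z1 z2 z3.
case: (pselect (exists mm : int, (m x1).1 = mm%:~R - al)) => [[mm hmm]|nmm]; last first.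
  have z3 : fmul d120 YYuv m = 0.
    have ne k y a e : m <> mk (y%:~R, 0%N) ((- k - 1)%:~R - al, a) e.
      by move=> em; apply: nmm; exists (- k - 1); rewrite em ffunE.
    by have [] := delta120_out supp3 ne.
  have z (x : W) (k : int) l : Y u x ((m x1).1 + k%:~R, l) = 0.
    apply/eqP/negPn/negP => /(tw_exponent (M := M) hg hu ual)[j hj]; apply: nmm.
    by exists (j - k); rewrite rmorphB /= addrAC -hj addrK.
  have z1 : fmul d012 YuYv m = 0.
    rewrite [m]mkE hn (delta012_at s12) fsbig1 // => k _.
    rewrite products_at12 (_ : (m x1).1 - n%:~R + k%:R = (m x1).1 + (- n + k%:Z)%:~R); last first.
      by rewrite rmorphD rmorphN /= addrA.
    by rewrite z scaler0.
  have z2 : fmul d021 YvYu m = 0.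
    rewrite [m]mkE hn (delta021_at s21) fsbig1 // => k _.
    rewrite products_at21 (_ : (m x1).1 - k%:R = (m x1).1 + (- k%:Z)%:~R); last by rewrite rmorphN.
    by rewrite z (linf0 (tw_Y_linr M _ _)) scaler0.
  exact: sub_scale_eq0 z1 z2 z3.
rewrite [m]mkE hn; case: (m x1) (m x2) hmm => [e1 a] [c b] /= ->.
apply/eqP; rewrite -subr_eq0; apply/eqP; set D := _ - _.
have [//|nz] := eqVneq D 0.
have [i0 [w' [hw' /eqP[]]]] := graded_separation (tw_grading M) nz.
have key := matrix_coef_jacobi hw' n mm a b c.
exact: scalar_sub_scale key.
Qed.

End Homogeneous.

(** * Reduction to homogeneous vectors *)

Section Jacobi.
Variables (R : realType) (V : lmodType R[i]) (A : vertex_superalgebra V).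
Variables (g : {linear V -> V}) (hg : is_automorphism A g).
Variables (W : lmodType R[i]) (M : twisted_module A g W) (hM : lower_bounded M).
Local Notation C := R[i].
Local Notation wt := (vsa_wt A).
Local Notation gen := (gen_eigenspace (tw_L0 M)).
Variables s t : bool.
Implicit Types (u v : V) (w : W) (m : mono R).

Let dsV := vsa_grading A.
Let dsW := tw_grading M.

(** The parities [s] and [t] are fixed: summands of one vector must have the same sign. *)
Definition jacobi u v w :=
  let d012 := fdelta x0 1 x1 (-1) x2 in
  let d021 := fdelta x0 (-1) x2 1 x1 in
  let d120 := fdelta x1 1 x2 1 x0 in
  let YuYv := fapply (YW M x1 u) (YW M x2 v w) in
  let YvYu := fapply (YW M x2 v) (YW M x1 u w) in
  let Yuv := fapply (fun a => YV A x0 a v) (pow_Lg g u) in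
  let YYuv := fapply (fun a => YW M x2 a w) Yuv in
  [/\ fapply_ok (fun a => YV A x0 a v) (pow_Lg g u),
      fapply_ok (fun a => YW M x2 a w) Yuv,
      fmul_ok d012 YuYv /\ fmul_ok d021 YvYu,
      fmul_ok d120 YYuv
    & fmul d012 YuYv - (-1) ^+ (s && t) *: fmul d021 YvYu = fmul d120 YYuv].

Lemma jacobi_homogeneous h h' al be mu u v w : half_parity h = s -> half_parity h' = t ->
  wt h u -> eig_gr g al u -> wt h' v -> eig_gr g be v -> gen mu w -> jacobi u v w.
Proof.
move=> hs ht hu ual hv vbe hw; rewrite /jacobi -hs -ht; have [B hB] := hM.
have [K hK] := Ng_nilpotent hg ual; have [n0 hn0] := vsa_lower h hv.
have hn0' x n : wt h x -> n < n0 -> vsa_Y A x v n = 0 by exact: hn0.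
split.
- exact: (iterate_ok hg v ual hK).
- exact: (iterate2_ok hg M w ual hK (power_trunc hg hu ual K hn0')).
- split; first exact: (product_ok hB u hv hw).
  exact: (opposite_ok hB v hu hw).
- exact: (iterate_delta_ok hg M w hu ual hK hn0').
- by apply/funext => m; exact: (jacobi_coef hg hB hu ual hv vbe hw hK hn0').
Qed.

Lemma products12_add u v w u1 v1 w1 u2 v2 w2 :
  (forall e1 e2, tw_Y M u (tw_Y M v w e2) e1 =
    tw_Y M u1 (tw_Y M v1 w1 e2) e1 + tw_Y M u2 (tw_Y M v2 w2 e2) e1) ->
  forall m, fapply (YW M x1 u) (YW M x2 v w) m =
    fapply (YW M x1 u1) (YW M x2 v1 w1) m + fapply (YW M x1 u2) (YW M x2 v2 w2) m.
Proof.
move=> h m; case: (pselect (exists e1 e2, m = mk 0 e1 e2)) => [[e1 [e2 ->]]|nm].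
  by rewrite !products_at12.
have z x y z : fapply (YW M x1 x) (YW M x2 y z) m = 0.
  by apply/eqP/negPn/negP => /products_supp12.
by rewrite !z addr0.
Qed.

Lemma products21_add u v w u1 v1 w1 u2 v2 w2 :
  (forall e1 e2, tw_Y M v (tw_Y M u w e1) e2 =
    tw_Y M v1 (tw_Y M u1 w1 e1) e2 + tw_Y M v2 (tw_Y M u2 w2 e1) e2) ->
  forall m, fapply (YW M x2 v) (YW M x1 u w) m =
    fapply (YW M x2 v1) (YW M x1 u1 w1) m + fapply (YW M x2 v2) (YW M x1 u2 w2) m.
Proof.
move=> h m; case: (pselect (exists e1 e2, m = mk 0 e1 e2)) => [[e1 [e2 ->]]|nm].
  by rewrite !products_at21.
have z x y z : fapply (YW M x2 y) (YW M x1 x z) m = 0.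
  by apply/eqP/negPn/negP => /products_supp21.
by rewrite !z addr0.
Qed.

Lemma sub_scale_add (T : lmodType C) (c : C) (x x' x'' y y' y'' z z' z'' : T) :
  x = x' + x'' -> y = y' + y'' -> z = z' + z'' -> x' - c *: y' = z' -> x'' - c *: y'' = z'' ->
  x - c *: y = z.
Proof. by move=> -> -> -> <- <-; rewrite scalerDr opprD addrACA. Qed.

(** Each formal expression is additive once the finiteness of its coefficients is known
    ([fapply_add]). The hypotheses fit a sum in any one of the three vectors. *)
Lemma jacobi_add u v w u1 v1 w1 u2 v2 w2 :
  (forall e1 e2, tw_Y M u (tw_Y M v w e2) e1 =
    tw_Y M u1 (tw_Y M v1 w1 e2) e1 + tw_Y M u2 (tw_Y M v2 w2 e2) e1) ->
  (forall e1 e2, tw_Y M v (tw_Y M u w e1) e2 =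
    tw_Y M v1 (tw_Y M u1 w1 e1) e2 + tw_Y M v2 (tw_Y M u2 w2 e1) e2) ->
  fapply_ok (fun a => YV A x0 a v) (pow_Lg g u) ->
  (forall m m', YW M x2 (fapply (fun a => YV A x0 a v) (pow_Lg g u) m) w m' =
     YW M x2 (fapply (fun a => YV A x0 a v1) (pow_Lg g u1) m) w1 m' +
     YW M x2 (fapply (fun a => YV A x0 a v2) (pow_Lg g u2) m) w2 m') ->
  jacobi u1 v1 w1 -> jacobi u2 v2 w2 -> jacobi u v w.
Proof.
move=> h12 h21 ok h [_ b1 [c1 d1] e1 f1] [_ b2 [c2 d2] e2 f2].
have [okb eb] := fapply_add (F := fun a => YW M x2 a w)
  (S := fapply (fun a => YV A x0 a v) (pow_Lg g u)) h b1 b2.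
have hc m m' : fdelta x0 1 x1 (-1) x2 m *: fapply (YW M x1 u) (YW M x2 v w) m' =
    fdelta x0 1 x1 (-1) x2 m *: fapply (YW M x1 u1) (YW M x2 v1 w1) m' +
    fdelta x0 1 x1 (-1) x2 m *: fapply (YW M x1 u2) (YW M x2 v2 w2) m'.
  by rewrite (products12_add h12) scalerDr.
have [okc ec] := fapply_add (F := fun c m => c *: fapply (YW M x1 u) (YW M x2 v w) m)
  (S := fdelta x0 1 x1 (-1) x2) hc c1 c2.
have hd m m' : fdelta x0 (-1) x2 1 x1 m *: fapply (YW M x2 v) (YW M x1 u w) m' =
    fdelta x0 (-1) x2 1 x1 m *: fapply (YW M x2 v1) (YW M x1 u1 w1) m' +
    fdelta x0 (-1) x2 1 x1 m *: fapply (YW M x2 v2) (YW M x1 u2 w2) m'.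
  by rewrite (products21_add h21) scalerDr.
have [okd ed] := fapply_add (F := fun c m => c *: fapply (YW M x2 v) (YW M x1 u w) m)
  (S := fdelta x0 (-1) x2 1 x1) hd d1 d2.
have he m m' : fdelta x1 1 x2 1 x0 m *:
      fapply (fun a => YW M x2 a w) (fapply (fun a => YV A x0 a v) (pow_Lg g u)) m' =
    fdelta x1 1 x2 1 x0 m *:
      fapply (fun a => YW M x2 a w1) (fapply (fun a => YV A x0 a v1) (pow_Lg g u1)) m' +
    fdelta x1 1 x2 1 x0 m *:
      fapply (fun a => YW M x2 a w2) (fapply (fun a => YV A x0 a v2) (pow_Lg g u2)) m'.
  have -> := congr1 (fun F => F m') eb; exact: scalerDr.
have [oke ee] := fapply_add (F := fun c m => c *: fapply (fun a => YW M x2 a w)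
  (fapply (fun a => YV A x0 a v) (pow_Lg g u)) m) (S := fdelta x1 1 x2 1 x0) he e1 e2.
split; [exact: ok|exact: okb|by split; [exact: okc|exact: okd]|exact: oke|].
exact: (sub_scale_add ec ed ee f1 f2).
Qed.

Lemma iterate_add u v u1 v1 u2 v2 :
  (forall m m', YV A x0 (pow_Lg g u m) v m' =
     YV A x0 (pow_Lg g u1 m) v1 m' + YV A x0 (pow_Lg g u2 m) v2 m') ->
  fapply_ok (fun a => YV A x0 a v1) (pow_Lg g u1) ->
  fapply_ok (fun a => YV A x0 a v2) (pow_Lg g u2) ->
  fapply_ok (fun a => YV A x0 a v) (pow_Lg g u) /\
  forall w m m', YW M x2 (fapply (fun a => YV A x0 a v) (pow_Lg g u) m) w m' =
     YW M x2 (fapply (fun a => YV A x0 a v1) (pow_Lg g u1) m) w m' +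
     YW M x2 (fapply (fun a => YV A x0 a v2) (pow_Lg g u2) m) w m'.
Proof.
move=> h ok1 ok2; have [ok e] := fapply_add (F := fun a => YV A x0 a v)
  (S := pow_Lg g u) h ok1 ok2; split => // w m m'.
have -> := congr1 (fun F => F m) e; exact: (linfD (YW_linl M x2 w m')).
Qed.

Lemma jacobi_addu u u' v w : jacobi u v w -> jacobi u' v w -> jacobi (u + u') v w.
Proof.
move=> /[dup] j1 [a1 _ _ _ _] /[dup] j2 [a2 _ _ _ _].
have [ok e] := @iterate_add (u + u') v u v u' v (fun m m' => etrans
  (congr1 (fun x => YV A x0 x v m') (pow_LgD hg u u' m)) (linfD (YV_linl A v m') _ _)) a1 a2.
apply: (jacobi_add _ _ ok (e w) j1 j2) => e1 e2.
  by rewrite (linfD (tw_Y_linl M _ _)).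
by rewrite (linfD (tw_Y_linl M _ _)) (linfD (tw_Y_linr M _ _)).
Qed.

Lemma jacobi_addv u v v' w : jacobi u v w -> jacobi u v' w -> jacobi u (v + v') w.
Proof.
move=> /[dup] j1 [a1 _ _ _ _] /[dup] j2 [a2 _ _ _ _].
have [ok e] := @iterate_add u (v + v') u v u v'
  (fun m m' => linfD (YV_linr A (pow_Lg g u m) m') _ _) a1 a2.
apply: (jacobi_add _ _ ok (e w) j1 j2) => e1 e2.
  by rewrite (linfD (tw_Y_linl M _ _)) (linfD (tw_Y_linr M _ _)).
by rewrite (linfD (tw_Y_linl M _ _)).
Qed.

Lemma jacobi_addw u v w w' : jacobi u v w -> jacobi u v w' -> jacobi u v (w + w').
Proof.
move=> /[dup] j1 [a1 _ _ _ _] j2.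
apply: (jacobi_add _ _ a1 _ j1 j2) => [e1 e2|e1 e2|m m'].
- by rewrite !(linfD (tw_Y_linr M _ _)).
- by rewrite !(linfD (tw_Y_linr M _ _)).
- exact: (linfD (YW_linr M x2 _ m')).
Qed.

(** Combines the grading by weights with [eig_ind] on each weight space. *)
Lemma parity_ind (Q : V -> Prop) (p : bool) : (forall u u', Q u -> Q u' -> Q (u + u')) ->
  (forall h al u, half_parity h = p -> wt h u -> eig_gr g al u -> Q u) ->
  forall u, vsa_parity A p u -> Q u.
Proof.
move=> QD Qh u hu.
have Q0 : Q 0.
  apply: (Qh p%:Z 0); first by case: (p).
    exact: (gr0 dsV.1).
  by have [] := eig_sub g 0.
apply: (gr_ind (ds := dsV) Q0 QD) => h; have [hp|np] := eqVneq (half_parity h) p.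
  apply: (eig_ind hg Q0 QD (k := h)) => [al x hx xal|]; last exact: proj_gr.
  exact: (Qh h al).
have /(subsumP dsV) hz := hu; rewrite hz //= => e; by rewrite e eqxx in np.
Qed.

Lemma jacobi_holds u v w : vsa_parity A s u -> vsa_parity A t v -> jacobi u v w.
Proof.
move=> hu hv; move: u hu; apply: parity_ind => [u u'|h al u hs hu ual]; first exact: jacobi_addu.
move: v hv; apply: parity_ind => [v v'|h' be v ht hv vbe]; first exact: jacobi_addv.
have homog mu x : gen mu x -> jacobi u v x.
  by move=> hx; exact: (jacobi_homogeneous hs ht hu ual hv vbe hx).
apply: (gr_ind (ds := dsW)) => [|x y|i].
- exact: (homog 0 _ (gen_eigenspace0 _ _)).
- exact: jacobi_addw.
- exact: (homog _ _ (gr_gen (proj_gr dsW i w))).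
Qed.

End Jacobi.

Theorem theorem3p8 (R : realType) (V : lmodType R[i])
    (A : vertex_superalgebra V) (g : {linear V -> V})
    (hg : is_automorphism A g)
    (W : lmodType R[i]) (M : twisted_module A g W) (hM : lower_bounded M)
    (s t : bool) (u v : V)
    (hu : vsa_parity A s u) (hv : vsa_parity A t v) (w : W) :
  let d012 := fdelta x0 1 x1 (-1) x2 in
  let d021 := fdelta x0 (-1) x2 1 x1 in
  let d120 := fdelta x1 1 x2 1 x0 in
  let YuYv := fapply (YW M x1 u) (YW M x2 v w) in
  let YvYu := fapply (YW M x2 v) (YW M x1 u w) in
  let Yuv := fapply (fun a => YV A x0 a v) (pow_Lg g u) in
  let YYuv := fapply (fun a => YW M x2 a w) Yuv in
  [/\ fapply_ok (fun a => YV A x0 a v) (pow_Lg g u),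
      fapply_ok (fun a => YW M x2 a w) Yuv,
      fmul_ok d012 YuYv /\ fmul_ok d021 YvYu,
      fmul_ok d120 YYuv
    & fmul d012 YuYv - (-1) ^+ (s && t) *: fmul d021 YvYu = fmul d120 YYuv].
Proof. exact: (jacobi_holds hg hM w hu hv). Qed.
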